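(* Let $\mathfrak g$ be a simple complex Lie algebra of type $A_n$, $B_n$, $C_n$ or $D_n$, and let $\iota_0=i_1i_2\cdots i_L$ be a reduced word of the longest element of its Weyl group. Then there is an isomorphism of geometric crystals $B^-_{\iota_0}\cong U^-_{\iota_0}$ given by the rational map $$\Phi: B^-_{\iota_0}\longrightarrow U^-_{\iota_0},\qquad Y_{\iota_0}(A_1,\dots,A_L)\mapsto y_{\iota_0}(a_1,\dots,a_L),$$ where, for $A=(A_1,\dots,A_L)\in(\mathbb C^\times)^L$ and $1\le j\le L$, $$a_j=\Phi_j(A)=\bigl(A_1^{\mathbf a_{i_1,i_j}}\cdots A_{j-1}^{\mathbf a_{i_{j-1},i_j}}A_j\bigr)^{-1}.$$
   Context: Notation. $\mathfrak g$ has Cartan matrix $(\mathbf a_{ij})_{i,j\in I}$, simple roots $\alpha_i$ and simple coroots $h_i$ with $\alpha_j(h_i)=\mathbf a_{ij}$, and Chevalley generators $e_i,f_i$. $G$ is the associated (simply connected) complex algebraic group, $T$ its maximal torus, $U=U^+$ and $U^-$ the opposite maximal unipotent subgroups (generated by positive, resp. negative, root subgroups), $B=UT$, $B^-=U^-T$. Put $x_i(t)=\exp(te_i)$, $y_i(t)=\exp(tf_i)$, and let $\alpha_i^\vee:\mathbb C^\times\to T$ be the cocharacter of the coroot $h_i$. Fundamental weights $\Lambda_i$ satisfy $\Lambda_i(h_j)=\delta_{ij}$; $L(\Lambda_i)$ is the irreducible highest weight module with fixed highest weight vector $u_{\Lambda_i}$. Geometric crystal. It consists of a variety $V$ with rational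 $\mathbb C^\times$-actions $e_i:\mathbb C^\times\times V\to V$, $(c,x)\mapsto e_i^c(x)$, and rational functions $\gamma_i,\varepsilon_i$ on $V$ ($i\in I$) such that: (i) $(\{1\}\times V)\cap \mathrm{dom}(e_i)$ is open dense in $\{1\}\times V$; (ii) $\gamma_j(e_i^c(x))=c^{\mathbf a_{ij}}\gamma_j(x)$; (iii) the Verma relations hold: $e_i^{c_1}e_j^{c_2}=e_j^{c_2}e_i^{c_1}$ if $\mathbf a_{ij}=\mathbf a_{ji}=0$; $e_i^{c_1}e_j^{c_1c_2}e_i^{c_2}=e_j^{c_2}e_i^{c_1c_2}e_j^{c_1}$ if $\mathbf a_{ij}=\mathbf a_{ji}=-1$; $e_i^{c_1}e_j^{c_1^2c_2}e_i^{c_1c_2}e_j^{c_2}=e_j^{c_2}e_i^{c_1c_2}e_j^{c_1^2c_2}e_i^{c_1}$ if $\mathbf a_{ij}=-2,\mathbf a_{ji}=-1$ (and an analogous relation for $\mathbf a_{ij}=-3$, not occurring here); (iv) $\varepsilon_i(e_i^c(x))=c^{-1}\varepsilon_i(x)$, and $\varepsilon_i(e_j^c(x))=\varepsilon_i(x)$ if $\mathbf a_{ij}=\mathbf a_{ji}=0$. An isomorphism of geometric crystals is a birational map $\Phi$ with $\Phi\circ e_i^c=e_i^c\circ\Phi$, $\gamma_i\circ\Phi=\gamma_i$, $\varepsilon_i\circ\Phi=\varepsilon_i$ for all $i\in I$ (as rational maps). The geometric crystal $B^-_{\iota_0}$. Put $Y_i(c)=y_i(1/c)\alpha_i^\vee(c)$,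 $Y_{\iota_0}(c_1,\dots,c_L)=Y_{i_1}(c_1)\cdots Y_{i_L}(c_L)$ and $B^-_{\iota_0}=\{Y_{\iota_0}(c_1,\dots,c_L): c_k\in\mathbb C^\times\}\subset B^-$. With $S_m=\bigl(c_1^{\mathbf a_{i_1,i}}\cdots c_{m-1}^{\mathbf a_{i_{m-1},i}}c_m\bigr)^{-1}$ (for fixed $i$), the structure is $$\gamma_i(Y_{\iota_0}(c_1,\dots,c_L))=c_1^{\mathbf a_{i_1,i}}\cdots c_L^{\mathbf a_{i_L,i}},\qquad \varepsilon_i(Y_{\iota_0}(c_1,\dots,c_L))=\sum_{1\le m\le L,\ i_m=i}S_m,$$ $$e_i^c(Y_{\iota_0}(c_1,\dots,c_L))=Y_{\iota_0}(\mathcal C_1,\dots,\mathcal C_L),\quad \mathcal C_j=c_j\,\frac{\sum_{m\le j,\,i_m=i}c\,S_m+\sum_{j<m\le L,\,i_m=i}S_m}{\sum_{m<j,\,i_m=i}c\,S_m+\sum_{j\le m\le L,\,i_m=i}S_m}.$$ The geometric crystal $U^-_{\iota_0}$. Put $y_{\iota_0}(a)=y_{\iota_0}(a_1,\dots,a_L)=y_{i_1}(a_1)\cdots y_{i_L}(a_L)$ and $U^-_{\iota_0}=\{y_{\iota_0}(a):a\in\mathbb C^L\}$, which is birationally equivalent to $U^-$ (with the $a_k$ as rational coordinates). The structure is the restriction of the following one on $U^-$. (1) $\varepsilon_i:U^-\to\mathbb C$ is the coefficient of the $U_{-\alpha_i}$-component: $u\in y_i(\varepsilon_i(u))\cdot(U^-\cap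 \bar s_iU^-\bar s_i^{-1})$, where $\bar s_i\in N_G(T)$ is a representative of the simple reflection $s_i$; thus $\varepsilon_i(y_{\iota_0}(a))=\sum_{i_j=i}a_j$. (2) $e_i^c(u)=\pi^{--}\bigl(x_i(\tfrac{c-1}{\varepsilon_i(u)})\,u\bigr)$, where $\pi^{--}:G\to U^-$ is the rational projection coming from the birational multiplication map $U^-\times B\hookrightarrow G$. (3) $\gamma_i(u)=\alpha_i(\mathcal T(u))$ with $\mathcal T(u)=\prod_{j\in I}\alpha_j^\vee\bigl(F_j^{(n)}(u)^{-1}\bigr)\in T$, i.e. $\gamma_i(u)=\prod_jF_j^{(n)}(u)^{-\mathbf a_{j,i}}$, where $F_j^{(n)}(u)=\langle u\cdot u_{\Lambda_j},v_{\Lambda_j}\rangle$. Here $\langle\ ,\ \rangle$ is the symmetric bilinear form on $L(\Lambda_j)$ with $\langle u_{\Lambda_j},u_{\Lambda_j}\rangle=1$ and $\langle gu,v\rangle=\langle u,\hat\omega(g)v\rangle$, $\hat\omega$ being the anti-involution with $\hat\omega(e_i)=f_i$, $\hat\omega(f_i)=e_i$, $\hat\omega(h)=h$ for $h$ in the Cartan subalgebra; and $v_{\Lambda_j}$ is the lowest weight vector with $\langle v_{\Lambda_j},v_{\Lambda_j}\rangle=1$ given by $v_{\Lambda_j}=f_{i_1}^{(m_1)}\cdots f_{i_L}^{(m_L)}u_{\Lambda_j}$, where $f^{(m)}=f^m/m!$ and $m_k=(s_{i_{k+1}}\cdots s_{i_L}\Lambda_j)(h_{i_k})$. *)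

(* Defs.v *)
From HB Require Import structures.
From mathcomp Require Import all_boot all_order all_algebra.
From mathcomp Require Import boolp reals complex.
From mathcomp Require Import mpoly.

Set Implicit Arguments.
Unset Strict Implicit.
Unset Printing Implicit Defensive.

Import GRing.Theory.
Local Open Scope ring_scope.

(** * Cartan matrices and Weyl groups *)

Inductive classical_type := TypeA | TypeB | TypeC | TypeD.

(* [D_3] is [A_3] up to relabelling, so nothing is lost by [4 <= n]. *)
Definition valid_rank (X : classical_type) (n : nat) : bool :=
  match X with
  | TypeA => (1 <= n)%N
  | TypeB | TypeC => (2 <= n)%N
  | TypeD => (4 <= n)%N
  end.

(* Bourbaki labelling, shifted to start at 0; the entry (i, j) is
   alpha_j (h_i).  For B_n the simple root n - 1 is short, for C_n it is
   long. *)
Definition cartan (X : classical_type) (n : nat) : 'M[int]_n :=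
  let adj (i j : nat) := (i.+1 == j) || (j.+1 == i) in
  let arc_D (i j : nat) :=
    (i.+1 == j) && (j.+1 < n)%N || (i.+2 == j) && (j.+1 == n) in
  \matrix_(i, j)
    if i == j then 2
    else match X with
    | TypeA => if adj i j then -1 else 0
    | TypeB => if adj i j then (if i.+1 == n then - 2%:Z else -1) else 0
    | TypeC => if adj i j then (if j.+1 == n then - 2%:Z else -1) else 0
    | TypeD => if arc_D i j || arc_D j i then -1 else 0
    end.

Section Weyl.
Variables (n : nat) (a : 'M[int]_n).

(* A weight lambda is the row of its values lambda (h_i), that is, its
   coordinates on the fundamental weights. *)
Definition simple_root (i : 'I_n) : 'rV[int]_n := \row_k a k i.

Definition fund_weight (j : 'I_n) : 'rV[int]_n := delta_mx 0 j.

Definition simple_refl (i : 'I_n) (lam : 'rV[int]_n) : 'rV[int]_n :=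
  lam - lam 0 i *: simple_root i.

(* s_{i_1} (... (s_{i_L} lam)) *)
Definition weyl_act (w : seq 'I_n) (lam : 'rV[int]_n) : 'rV[int]_n :=
  foldr simple_refl lam w.

Definition reduced_word (w : seq 'I_n) : Prop :=
  forall w', weyl_act w' =1 weyl_act w -> (size w <= size w')%N.

Definition reduced_longest_word (w : seq 'I_n) : Prop :=
  reduced_word w /\ forall w', reduced_word w' -> (size w' <= size w)%N.

Definition positive_weight (b : 'rV[int]_n) : Prop :=
  exists k : 'I_n -> nat, b = \sum_i (k i)%:Z *: simple_root i.

End Weyl.

(** * Fundamental representations *)

Section Representations.
Variables (K : fieldType) (n : nat) (a : 'M[int]_n).

Definition mx_bracket d (A B : 'M[K]_d) : 'M[K]_d := A *m B - B *m A.

(* Serre's presentation of the Lie algebra with Cartan matrix [a]: the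
   matrices [e], [f], [h] define a module over it. *)
Record serre_relations d (e f h : 'I_n -> 'M[K]_d) : Prop := SerreRelations {
  serre_hh : forall i j, mx_bracket (h i) (h j) = 0;
  serre_he : forall i j, mx_bracket (h i) (e j) = (a i j)%:~R *: e j;
  serre_hf : forall i j, mx_bracket (h i) (f j) = - ((a i j)%:~R *: f j);
  serre_ef : forall i j, mx_bracket (e i) (f j) = if i == j then h i else 0;
  serre_ee : forall i j, i != j ->
    iter `|1 - a i j|%N (mx_bracket (e i)) (e j) = 0;
  serre_ff : forall i j, i != j ->
    iter `|1 - a i j|%N (mx_bracket (f i)) (f j) = 0
}.

(* No proper nonzero subspace is stable; subspaces of column vectors are
   encoded by the row space of the transposed vectors. *)
Definition irreducible_module d (e f h : 'I_n -> 'M[K]_d) : Prop :=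
  (0 < d)%N /\
  forall W : 'M[K]_d,
    (forall i, [/\ stablemx W (e i)^T, stablemx W (f i)^T
                 & stablemx W (h i)^T]) ->
    W = 0 \/ row_full W.

(* The irreducible highest weight module L(Lambda_j), acting on column
   vectors and written in a basis of weight vectors: the b-th basis vector
   has weight [fm_wt b].  [fm_form] is the Gram matrix of the contravariant
   form < , >. *)
Record fundamental_module (j : 'I_n) := FundamentalModule {
  fm_dim : nat;
  fm_wt : 'I_fm_dim -> 'rV[int]_n;
  fm_e : 'I_n -> 'M[K]_fm_dim;
  fm_f : 'I_n -> 'M[K]_fm_dim;
  fm_h : 'I_n -> 'M[K]_fm_dim := fun i => diag_mx (\row_b (fm_wt b 0 i)%:~R);
  fm_hw : 'cV[K]_fm_dim;
  fm_form : 'M[K]_fm_dim;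
  fm_relations : serre_relations fm_e fm_f fm_h;
  fm_irreducible : irreducible_module fm_e fm_f fm_h;
  fm_hw_neq0 : fm_hw != 0;
  fm_hw_e : forall i, fm_e i *m fm_hw = 0;
  fm_hw_h : forall i, fm_h i *m fm_hw = (fund_weight j 0 i)%:~R *: fm_hw;
  fm_form_sym : fm_form^T = fm_form;
  fm_form_e : forall i, (fm_e i)^T *m fm_form = fm_form *m fm_f i;
  fm_form_f : forall i, (fm_f i)^T *m fm_form = fm_form *m fm_e i;
  fm_form_h : forall i, (fm_h i)^T *m fm_form = fm_form *m fm_h i;
  fm_form_hw : (fm_hw^T *m fm_form *m fm_hw) 0 0 = 1
}.

Definition fm_pairing j (M : fundamental_module j) (u v : 'cV[K]_(fm_dim M)) : K :=
  (u^T *m fm_form M *m v) 0 0.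

(* f_{i_1}^{(m_1)} ... f_{i_L}^{(m_L)} u with
   m_k = (s_{i_{k+1}} ... s_{i_L} Lambda_j) (h_{i_k}), which is nonnegative
   when the word is reduced. *)
Fixpoint extremal_vector j (M : fundamental_module j) (w : seq 'I_n) :
    'cV[K]_(fm_dim M) :=
  if w is i :: w' then
    let m := `|weyl_act a w' (fund_weight j) 0%R i|%N in
    (m`!%:R)^-1 *: (fm_f M i ^+ m *m extremal_vector M w')
  else fm_hw M.

(* Exponential of a nilpotent d x d matrix N; N ^+ d = 0. *)
Definition nilp_exp d (N : 'M[K]_d) : 'M[K]_d :=
  \sum_(k < d) (k`!%:R)^-1 *: N ^+ k.

End Representations.

(** * Partial functions and rational maps *)

(* The partial function defined at [x] exactly when [R x] holds for one and
   only one value. *)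
Definition the_value (S T : Type) (R : S -> T -> Prop) (x : S) : option T :=
  if pselect (exists! y, R x y) is left h then Some (proj1_sig (cid h))
  else None.

Section Rational.
Variable K : fieldType.

(* [P] holds on a nonempty Zariski open subset of affine L-space. *)
Definition generically L (P : ('I_L -> K) -> Prop) : Prop :=
  exists2 p : {mpoly K[L]}, p != 0 & forall x, p.@[x] != 0 -> P x.

(* The data of a geometric crystal on an L-dimensional rational variety.
   The variety is described up to birational equivalence, by rational
   coordinates: [gc_chart] is defined on affine L-space and parametrizes a
   dense subset of it, and [gc_point] is any set containing its points.
   Rational functions and maps are partial functions on points. *)
Record crystal_data (n L : nat) := CrystalData {
  gc_point : Type;
  gc_chart : ('I_L -> K) -> gc_point;
  gc_act : 'I_n -> K -> gc_point -> option gc_point;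
  gc_gamma : 'I_n -> gc_point -> option K;
  gc_eps : 'I_n -> gc_point -> option K
}.

Section Maps.
Variables n L : nat.

(* Equality of rational maps out of [V]: both are defined, and agree, on a
   dense open subset. *)
Definition rational_eq (V : crystal_data n L) (Z : Type)
    (f g : gc_point V -> option Z) : Prop :=
  generically (fun x : 'I_L -> K =>
    exists z, f (gc_chart V x) = Some z /\ g (gc_chart V x) = Some z).

Definition rational_map (V W : crystal_data n L)
    (F : gc_point V -> option (gc_point W)) : Prop :=
  exists num den : 'I_L -> {mpoly K[L]},
    (forall k, den k != 0) /\
    generically (fun x : 'I_L -> K =>
      F (gc_chart V x) =
        Some (gc_chart W (fun k => (num k).@[x] / (den k).@[x]))).

Definition birational_map (V W : crystal_data n L)
    (F : gc_point V -> option (gc_point W)) : Prop :=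
  rational_map F /\
  exists G : gc_point W -> option (gc_point V),
    [/\ rational_map G,
        rational_eq (fun v => obind G (F v)) Some
      & rational_eq (fun w => obind F (G w)) Some].

Definition crystal_isomorphism (V W : crystal_data n L)
    (F : gc_point V -> option (gc_point W)) : Prop :=
  [/\ birational_map F,
      forall i c, c != 0 ->
        rational_eq (fun v => obind F (gc_act i c v))
                    (fun v => obind (gc_act i c) (F v)),
      forall i, rational_eq (fun v => obind (gc_gamma i) (F v)) (gc_gamma i)
    & forall i, rational_eq (fun v => obind (gc_eps i) (F v)) (gc_eps i)].

End Maps.
End Rational.

Arguments crystal_isomorphism {K n L} V W F.

(** * The group and the two geometric crystals *)

Section Crystals.
Variables (K : fieldType) (n : nat) (a : 'M[int]_n).
Variable M : forall j : 'I_n, fundamental_module K a j.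

(* The simply connected group G acts faithfully on the sum of the
   fundamental modules, because their weights span the weight lattice.  It
   is identified with its image, the subgroup of the product of the
   GL(L(Lambda_j)) generated by the [x_ i t] and the [y_ i t]; all group
   elements below belong to it. *)
Definition ambient : Type := forall j : 'I_n, 'M[K]_(fm_dim (M j)).

Definition gone : ambient := fun j => 1%:M.
Definition gmul (g g' : ambient) : ambient := fun j => g j *m g' j.
Definition ginv (g : ambient) : ambient := fun j => invmx (g j).
Definition gconj (g g' : ambient) : ambient := gmul (gmul g g') (ginv g).

Definition x_ (i : 'I_n) (t : K) : ambient :=
  fun j => nilp_exp (t *: fm_e (M j) i).

Definition y_ (i : 'I_n) (t : K) : ambient :=
  fun j => nilp_exp (t *: fm_f (M j) i).

(* The cocharacter of h_i: it acts by c ^ mu (h_i) on the weight space of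
   weight mu. *)
Definition cochar (i : 'I_n) (c : K) : ambient :=
  fun j => diag_mx (\row_b c ^ fm_wt b 0 i).

Definition sbar (i : 'I_n) : ambient :=
  gmul (gmul (x_ i (-1)) (y_ i 1)) (x_ i (-1)).

Definition sbar_word (w : seq 'I_n) : ambient :=
  foldr (fun i g => gmul (sbar i) g) gone w.

(* The generating families used below are stable under inversion, so the
   generated submonoid is the generated subgroup. *)
Inductive generated (S : ambient -> Prop) : ambient -> Prop :=
  | generated_one : generated S gone
  | generated_mul g h : S g -> generated S h -> generated S (gmul g h).

(* The root subgroup of the root w alpha_i (resp. - w alpha_i) is the
   conjugate of the image of [x_ i] (resp. [y_ i]) by a representative
   of w. *)
Definition Uplus : ambient -> Prop :=
  generated (fun g => exists w i t,
    positive_weight a (weyl_act a w (simple_root a i)) /\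
    g = gconj (sbar_word w) (x_ i t)).

Definition Uminus : ambient -> Prop :=
  generated (fun g => exists w i t,
    positive_weight a (weyl_act a w (simple_root a i)) /\
    g = gconj (sbar_word w) (y_ i t)).

Definition torus : ambient -> Prop :=
  generated (fun g => exists i c, c != 0 /\ g = cochar i c).

Definition borel (b : ambient) : Prop :=
  exists u t, [/\ Uplus u, torus t & b = gmul u t].

(* u belongs to y_i(t) (U^- \cap sbar_i U^- sbar_i^-1) *)
Definition eps_U (i : 'I_n) : ambient -> option K :=
  the_value (fun u t => exists u' u'' : ambient,
    [/\ Uminus u', Uminus u'', u' = gconj (sbar i) u''
      & u = gmul (y_ i t) u']).

Definition proj_Uminus : ambient -> option ambient :=
  the_value (fun g u => Uminus u /\ exists b, borel b /\ g = gmul u b).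

Definition act_U (i : 'I_n) (c : K) (u : ambient) : option ambient :=
  if eps_U i u is Some t then
    if (c != 0) && (t != 0) then proj_Uminus (gmul (x_ i ((c - 1) / t)) u)
    else None
  else None.

Variables (L : nat) (iota : L.-tuple 'I_n).
Local Notation i_ k := (tnth iota k).

Definition lowest_pairing (j : 'I_n) (u : ambient) : K :=
  fm_pairing (u j *m fm_hw (M j)) (extremal_vector (M j) iota).

Definition gamma_U (i : 'I_n) (u : ambient) : option K :=
  if [forall j, lowest_pairing j u != 0]
  then Some (\prod_j lowest_pairing j u ^ (- a j i)) else None.

Definition y_word (t : 'I_L -> K) : ambient :=
  \big[gmul/gone]_(k < L) y_ (i_ k) (t k).

Definition U_crystal : crystal_data K n L :=
  CrystalData y_word act_U gamma_U eps_U.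

Definition Y_ (i : 'I_n) (c : K) : ambient := gmul (y_ i c^-1) (cochar i c).

Definition Y_word (c : 'I_L -> K) : ambient :=
  \big[gmul/gone]_(k < L) Y_ (i_ k) (c k).

Definition in_torus (c : 'I_L -> K) : Prop := forall k, c k != 0.

Definition S_ (i : 'I_n) (c : 'I_L -> K) (m : 'I_L) : K :=
  ((\prod_(k < L | (k < m)%N) c k ^ a (i_ k) i) * c m)^-1.

Definition gamma_B (i : 'I_n) : ambient -> option K :=
  the_value (fun x t => exists c,
    [/\ in_torus c, x = Y_word c & t = \prod_k c k ^ a (i_ k) i]).

Definition eps_B (i : 'I_n) : ambient -> option K :=
  the_value (fun x t => exists c,
    [/\ in_torus c, x = Y_word c & t = \sum_(m < L | i_ m == i) S_ i c m]).

Definition act_B_num (i : 'I_n) (s : K) (c : 'I_L -> K) (j : 'I_L) : K :=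
  \sum_(m < L | (m <= j)%N && (i_ m == i)) s * S_ i c m +
  \sum_(m < L | (j < m)%N && (i_ m == i)) S_ i c m.

Definition act_B_den (i : 'I_n) (s : K) (c : 'I_L -> K) (j : 'I_L) : K :=
  \sum_(m < L | (m < j)%N && (i_ m == i)) s * S_ i c m +
  \sum_(m < L | (j <= m)%N && (i_ m == i)) S_ i c m.

Definition act_B (i : 'I_n) (s : K) : ambient -> option ambient :=
  the_value (fun x y => exists c,
    [/\ s != 0, in_torus c,
        forall j, act_B_num i s c j != 0 /\ act_B_den i s c j != 0,
        x = Y_word c
      & y = Y_word (fun j => c j * (act_B_num i s c j / act_B_den i s c j))]).

Definition B_crystal : crystal_data K n L :=
  CrystalData Y_word act_B gamma_B eps_B.

Definition Phi_coord (A : 'I_L -> K) (j : 'I_L) : K :=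
  ((\prod_(k < L | (k < j)%N) A k ^ a (i_ k) (i_ j)) * A j)^-1.

Definition Phi_map : gc_point B_crystal -> option (gc_point U_crystal) :=
  the_value (fun x u : ambient => exists A,
    [/\ in_torus A, x = Y_word A & u = y_word (Phi_coord A)]).

End Crystals.

Arguments U_crystal {K n a} M {L} iota.
Arguments B_crystal {K n a} M {L} iota.
Arguments Phi_map {K n a} M {L} iota _.

(* Main.v *)
Require Import Defs.
From HB Require Import structures.
From mathcomp Require Import all_boot all_order all_algebra.
From mathcomp Require Import boolp reals complex.
From mathcomp Require Import mpoly.
From mathcomp Require Import ring zify.

Set Implicit Arguments.
Unset Strict Implicit.
Unset Printing Implicit Defensive.

Import Order.TTheory GRing.Theory Num.Theory.
Local Open Scope ring_scope.

(** Write y(a) for y_{i_1}(a_1) ... y_{i_L}(a_L) and t(A) for the product of the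
  alpha_{i_k}^vee(A_k). Since alpha_i^vee(c) y_j(s) = y_j(c^(-a_ij) s) alpha_i^vee(c),
  moving all torus factors of Y(A) to the right gives Y(A) = y(a) t(A) with exactly
  a = Phi(A) ([Yprod_split], [Y_word_split]). So Phi forgets the torus part of a
  point of B^-; it is well defined because U^- and B meet trivially
  ([Uminus_borel_uniq]), and it is birational on coordinates because the monomial
  map is triangular.

  The action. In SL_2 one has x(s) Y(c) = Y(c + s) x(s / (c (c + s))), and x_i(s)
  commutes with Y_j(c) up to rescaling s, for j <> i. Hence x_i(tau) Y(A) = Y(A') x_i(tau')
  with explicit A', and for tau = (c - 1) / eps_i the coordinates A' are those of
  e_i^c ([xm_Yprod], [x_Y_word]). Modulo B on the right, this says that e_i^c acts on
  y(Phi(A)) by x_i(tau) followed by the projection to U^-, which is the action on U^-.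

  The function eps. On U^- it is the coordinate along U_{-alpha_i}, which is the sum
  of the a_j with i_j = i ([eps_UE]); these a_j are the S_j of B^-.

  The function gamma. The element Y_i(c) lies in U s_i U, and its normalization makes
  the coefficient between the highest and the lowest weight vectors equal to 1 along
  a reduced word ([lowest_pairing_word]). Therefore F_j(y(Phi(A))) is the inverse of
  the value of Lambda_j on t(A), and T(y(Phi(A))) = t(A). The same formula recovers
  t(A), and so the point Y(A), from the point y(Phi(A)), which makes the inverse map
  well defined even though coordinates might not be unique.

  The group is given by matrices on the fundamental modules, so the rank one
  identities are proved there. The relation in SL_2 is obtained from irreducibility
  under the whole Lie algebra ([commutant_hw], [sl2_relation]). The facts on the Weyl
  group (a reduced word keeps roots on the expected side, every letter occurs in a
  longest word) are derived from the sets of weights of the modules, which are stable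
  under the Weyl group and bounded by the highest weights ([root_dichotomy],
  [exchange]). *)

(** * Exponentials of nilpotent matrices *)

Section Exp.
Variables (K : numFieldType) (d : nat).
Implicit Types (N A B C P : 'M[K]_d).

Definition dpow k N : 'M[K]_d := (k`!%:R)^-1 *: N ^+ k.

Lemma fact_neq0 k : (k`!%:R : K) != 0.
Proof. by rewrite pnatr_eq0 -lt0n fact_gt0. Qed.

Lemma natS_neq0 k : (k.+1%:R : K) != 0.
Proof. by rewrite pnatr_eq0. Qed.

Lemma dpow0 N : dpow 0 N = 1%:M.
Proof. by rewrite /dpow fact0 invr1 scale1r expr0. Qed.

Lemma dpow1 N : dpow 1 N = N.
Proof. by rewrite /dpow factS fact0 muln1 invr1 scale1r expr1. Qed.

Lemma dpowS k N : N *m dpow k N = k.+1%:R *: dpow k.+1 N.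
Proof.
rewrite /dpow -scalemxAr scalerA exprS; congr (_ *: _).
by rewrite factS natrM invfM mulrA divff ?mul1r ?natS_neq0.
Qed.

Lemma dpowZ k s N : dpow k (s *: N) = s ^+ k *: dpow k N.
Proof.
rewrite /dpow; have -> : (s *: N) ^+ k = s ^+ k *: N ^+ k.
  elim: k => [|k IH]; first by rewrite !expr0 scale1r.
  by rewrite !exprS IH -!mulmxE -scalemxAl -scalemxAr scalerA.
by rewrite !scalerA mulrC.
Qed.

Definition mxnilp N := N ^+ d = 0.

Lemma nilp_exp0 N k : mxnilp N -> (d <= k)%N -> N ^+ k = 0.
Proof. by move=> N0 /subnK <-; rewrite exprD N0 mulr0. Qed.

Lemma dpow_nilp N k : mxnilp N -> (d <= k)%N -> dpow k N = 0.
Proof. by move=> N0 dk; rewrite /dpow nilp_exp0 ?scaler0. Qed.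

Lemma nilpZ s N : mxnilp N -> mxnilp (s *: N).
Proof.
move=> N0; have := dpowZ d s N; rewrite (dpow_nilp N0) // scaler0 /dpow.
by move/eqP; rewrite scaler_eq0 invr_eq0 (negPf (fact_neq0 _)) => /eqP.
Qed.

Lemma nilp_expE N m : mxnilp N -> (d <= m)%N -> nilp_exp N = \sum_(k < m) dpow k N.
Proof.
move=> N0 dm; rewrite /nilp_exp (big_ord_widen m (fun k => dpow k N) dm).
rewrite [RHS](bigID (fun k : 'I_m => (k < d)%N)) /= [X in _ + X]big1 ?addr0 //.
by move=> k; rewrite -leqNgt => dk; rewrite dpow_nilp.
Qed.

Lemma nilp_exp_at0 : nilp_exp (0 : 'M[K]_d) = 1%:M.
Proof.
rewrite (@nilp_expE _ d.+1) //; last first.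
  rewrite /mxnilp; case: d => [|n]; last by rewrite expr0n.
  by apply/matrixP; case.
rewrite big_ord_recl dpow0 big1 ?addr0 // => k _.
by rewrite /dpow expr0n /= scaler0.
Qed.

Lemma sum_triangle (V : zmodType) m (F : nat -> nat -> V) :
  (forall k l, (m <= k + l)%N -> F k l = 0) ->
  \sum_(p < m) \sum_(k < p.+1) F k (p - k)%N = \sum_(k < m) \sum_(l < m) F k l.
Proof.
move=> F0.
transitivity (\sum_(p < m) \sum_(k < m | (k < p.+1)%N) F k (p - k)%N).
  by apply: eq_bigr => p _; rewrite (big_ord_widen m (fun k => F k (p - k)%N)).
rewrite (exchange_big_dep xpredT) //=; apply: eq_bigr => k _.
transitivity (\sum_(k <= p < m) F k (p - k)%N).
  rewrite big_geq_mkord; apply: eq_bigl => p.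
  by rewrite ltnS.
rewrite -{1}[nat_of_ord k]add0n big_addn big_mkord.
rewrite (big_ord_widen m (fun l => F k (l + k - k)%N)) ?leq_subr //.
rewrite [RHS](bigID (fun l : 'I_m => (l < m - k)%N)) /= [X in _ = _ + X]big1 ?addr0.
  by apply: eq_bigr => l _; rewrite addnK.
by move=> l; rewrite -leqNgt leq_subLR => /F0.
Qed.

Lemma nilp_expD N s t : mxnilp N ->
  nilp_exp (s *: N) *m nilp_exp (t *: N) = nilp_exp ((s + t) *: N).
Proof.
move=> N0; rewrite !(@nilp_expE _ d) //; try exact: nilpZ.
transitivity (\sum_(k < d) \sum_(l < d) (s ^+ k * t ^+ l) *: (dpow k N *m dpow l N)).
  rewrite mulmx_suml; apply: eq_bigr => k _; rewrite mulmx_sumr.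
  by apply: eq_bigr => l _; rewrite !dpowZ -scalemxAl -scalemxAr scalerA.
rewrite -(@sum_triangle _ d (fun k l => (s ^+ k * t ^+ l) *: (dpow k N *m dpow l N))).
  apply: eq_bigr => p _; rewrite dpowZ [s + t]addrC exprDn scaler_suml.
  apply: eq_bigr => k _.
  have kp : (k <= p)%N by rewrite -ltnS.
  rewrite /dpow -scalemxAl -scalemxAr mulmxE -exprD subnKC // !scalerA.
  congr (_ *: _).
  rewrite -(bin_fact kp) !natrM.
  have := fact_neq0 k; have := fact_neq0 (p - k).
  have : ('C(p, k)%:R : K) != 0 by rewrite pnatr_eq0 -lt0n bin_gt0.
  rewrite -(mulr_natr (_ * _)); move: (s ^+ k) (t ^+ _) => x y h1 h2 h3.
  by field; rewrite h1 h2 h3.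
move=> k l dkl; rewrite /dpow -scalemxAl -scalemxAr mulmxE -exprD nilp_exp0 //.
by rewrite !scaler0.
Qed.

Lemma conj_exp P P' N : P *m P' = 1%:M -> P' *m P = 1%:M ->
  P *m nilp_exp N *m P' = nilp_exp (P *m N *m P').
Proof.
move=> PP' P'P; rewrite /nilp_exp mulmx_sumr mulmx_suml; apply: eq_bigr => k _.
rewrite -scalemxAr -scalemxAl; congr (_ *: _).
elim: (nat_of_ord k) => [|m IH]; first by rewrite !expr0 mulmx1 PP'.
rewrite !exprS -IH -!mulmxE !mulmxA; congr (_ *m _ *m _).
by rewrite -!mulmxA P'P mulmx1.
Qed.

Lemma exp_contravariant P N N' : N^T *m P = P *m N' ->
  (nilp_exp N)^T *m P = P *m nilp_exp N'.
Proof.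
move=> NP; rewrite /nilp_exp raddf_sum /= mulmx_suml mulmx_sumr.
apply: eq_bigr => k _; rewrite linearZ /= -scalemxAl -scalemxAr; congr (_ *: _).
elim: (nat_of_ord k) => [|m IH]; first by rewrite !expr0 trmx1 mul1mx mulmx1.
rewrite exprSr -mulmxE trmx_mul -mulmxA IH mulmxA NP -mulmxA; congr (_ *m _).
by rewrite exprS.
Qed.

Lemma comm_exp A N : A *m N = N *m A -> A *m nilp_exp N = nilp_exp N *m A.
Proof.
move=> AN; rewrite /nilp_exp mulmx_suml mulmx_sumr; apply: eq_bigr => k _.
rewrite -scalemxAr -scalemxAl; congr (_ *: _).
elim: (nat_of_ord k) => [|m IH]; first by rewrite !expr0 mulmx1 mul1mx.
by rewrite exprS -mulmxE mulmxA AN -!mulmxA IH mulmxA.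
Qed.

Lemma exp_vec2 N (u : 'cV[K]_d) : mxnilp N -> N *m (N *m u) = 0 ->
  nilp_exp N *m u = u + N *m u.
Proof.
move=> N0 NNu; rewrite (@nilp_expE _ d.+2) ?leqW // 2!big_ord_recl dpow0 dpow1.
rewrite !mulmxDl mul1mx mulmx_suml big1 ?addr0 // => k _.
by rewrite /dpow -scalemxAl !exprSr -!mulmxE -!mulmxA NNu mulmx0 scaler0.
Qed.

Lemma exp_vec1 N (u : 'cV[K]_d) : mxnilp N -> N *m u = 0 -> nilp_exp N *m u = u.
Proof. by move=> N0 Nu; rewrite exp_vec2 // Nu ?mulmx0 ?addr0. Qed.

(** The Leibniz expansion of ad(N)-iterates, for divided powers. *)
Lemma dpow_bracket N A B C k :
  mx_bracket N A = B -> mx_bracket N B = C -> mx_bracket N C = 0 ->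
  dpow k.+2 N *m A = A *m dpow k.+2 N + B *m dpow k.+1 N + 2^-1 *: (C *m dpow k N).
Proof.
move=> /(canRL (subrK _)) NA /(canRL (subrK _)) NB /(canRL (subrK _)) NC.
rewrite add0r in NC.
have Nk0 : dpow 0 N *m A = A *m dpow 0 N by rewrite dpow0 mulmx1 mul1mx.
have Nk1 : dpow 1 N *m A = A *m dpow 1 N + B *m dpow 0 N.
  by rewrite dpow0 dpow1 mulmx1 NA addrC.
have step m : m.+1%:R *: (dpow m.+1 N *m A) = N *m (dpow m N *m A).
  by rewrite mulmxA dpowS -scalemxAl.
have inj m (X Y : 'M[K]_d) : m.+1%:R *: X = m.+1%:R *: Y -> X = Y.
  by apply: scalerI; rewrite natS_neq0.
elim: k => [|k IH].
  apply: (inj 1%N); rewrite step Nk1 !mulmxDr !mulmxA NA NB !mulmxDl.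
  rewrite -(mulmxA A) -(mulmxA B N) !(dpowS _ N) -!(scalemxAr _.+1%:R) dpow0 !mulmx1.
  move: (B *m _) (A *m _) => X Y; by apply/matrixP => u v; rewrite !mxE; field.
apply: (inj k.+2); rewrite step IH !mulmxDr -(scalemxAr 2^-1) !mulmxA NA NB NC !mulmxDl.
rewrite -(mulmxA A) -(mulmxA B N) -(mulmxA C N) !(dpowS _ N) -!(scalemxAr _.+1%:R).
move: (B *m _) (A *m _) (C *m _) => X Y Z; apply/matrixP => u v; rewrite !mxE.
by rewrite -![_.+3%:R]natr1 -![_.+2%:R]natr1 -![_.+1%:R]natr1; field.
Qed.

(** For N with ad(N)^3 A = 0, the series exp(ad N) A stops after three terms. This
  is all that is needed, since off-diagonal Cartan entries are at least -2. *)
Lemma exp_bracket N A B C : mxnilp N ->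
  mx_bracket N A = B -> mx_bracket N B = C -> mx_bracket N C = 0 ->
  nilp_exp N *m A = (A + B + 2^-1 *: C) *m nilp_exp N.
Proof.
move=> N0 NA NB NC.
pose S m := \sum_(k < d) dpow (m + k) N.
have E0 : nilp_exp N = S 0%N by rewrite (@nilp_expE N d).
have E1 : nilp_exp N = 1%:M + S 1%N.
  by rewrite (@nilp_expE N d.+1) // big_ord_recl dpow0.
have E2 : nilp_exp N = 1%:M + (N + S 2%N).
  by rewrite (@nilp_expE N d.+2) ?leqW // 2!big_ord_recl dpow0 dpow1.
have S2A : S 2%N *m A = A *m S 2%N + B *m S 1%N + 2^-1 *: (C *m S 0%N).
  rewrite mulmx_suml; under eq_bigr => k _ do rewrite (dpow_bracket _ NA NB NC).
  by rewrite !big_split /= -!mulmx_sumr -scaler_sumr -mulmx_sumr.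
rewrite 2!(mulmxDl _ _ (nilp_exp N)) -scalemxAl {1 2}E2 {1}E1 E0.
rewrite !mulmxDl !mulmxDr S2A !mulmx1 mul1mx.
have -> : N *m A = A *m N + B by rewrite -NA /mx_bracket addrC subrK.
move: (A *m N) (A *m S _) (B *m S _) (C *m S _) => X Y Z T.
by rewrite !addrA; congr (_ + _); rewrite -!addrA; congr (_ + (_ + _)); rewrite addrCA.
Qed.

End Exp.

(** * Triangular matrices with respect to a height *)

Section Triangular.
Variables (K : numFieldType) (d : nat) (g : 'I_d -> int).
Implicit Types (N A B : 'M[K]_d).

Definition strictly_lowers N := forall b b', N b b' != 0 -> g b < g b'.
Definition lower_uni A := strictly_lowers (A - 1%:M).

Lemma mulmx_neq0 m n p (A : 'M[K]_(m, n)) (B : 'M[K]_(n, p)) i j :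
  (A *m B) i j != 0 -> exists k, A i k != 0 /\ B k j != 0.
Proof.
rewrite mxE => ABij; have [/existsP[k /andP[? ?]]|/existsPn AB0] :=
  boolP [exists k, (A i k != 0) && (B k j != 0)]; first by exists k.
case/negP: ABij; rewrite big1 // => k _; apply/eqP; rewrite mulf_eq0.
by have := AB0 k; rewrite negb_and !negbK.
Qed.

Lemma strictly_lowersD A B : strictly_lowers A -> strictly_lowers B -> strictly_lowers (A + B).
Proof.
move=> hA hB b b'; rewrite mxE; case: (eqVneq (A b b') 0) => [-> | /hA //].
by rewrite add0r => /hB.
Qed.

Lemma strictly_lowersZ s A : strictly_lowers A -> strictly_lowers (s *: A).
Proof. by move=> hA b b'; rewrite mxE mulf_eq0 negb_or => /andP[_ /hA]. Qed.

Lemma strictly_lowersM A B : strictly_lowers A -> strictly_lowers B -> strictly_lowers (A *m B).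
Proof. by move=> hA hB b b' /mulmx_neq0[k [/hA h1 /hB h2]]; exact: lt_trans h2. Qed.

(** The number of indices of smaller height grows strictly along a nonzero product
  of entries, and it is less than d; so the exponent d required by [nilp_exp]
  suffices. *)
Lemma strictly_lowers_nilp N : strictly_lowers N -> mxnilp N.
Proof.
move=> hN.
pose r b := #|[set b' | g b' < g b]|.
have rd b : (r b < d)%N.
  rewrite -[X in (_ < X)%N]card_ord -cardsT; apply: proper_card.
  by apply/properP; split; [exact/subsetP | exists b; rewrite ?inE ?ltxx].
have rN b b' : N b b' != 0 -> (r b < r b')%N.
  move=> /hN bb'; apply: proper_card; apply/properP; split.
    by apply/subsetP => b''; rewrite !inE => /lt_trans; apply.
  by exists b; rewrite !inE ?ltxx.
have rNk k b b' : (N ^+ k) b b' != 0 -> (r b + k <= r b')%N.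
  elim: k b => [|k IH] b.
    by rewrite expr0 mxE addn0; case: (eqVneq b b') => [-> //|_]; rewrite eqxx.
  rewrite exprS -mulmxE => /mulmx_neq0[c [/rN h1 /IH h2]].
  by rewrite addnS -addSn; apply: leq_trans h2; rewrite leq_add2r.
apply/matrixP => b b'; rewrite [RHS]mxE; apply/eqP; apply: contraT => /rNk h.
by have := leq_trans (leq_addl _ _) h; rewrite leqNgt rd.
Qed.

Lemma lower_uni1 : lower_uni 1%:M.
Proof. by move=> b b'; rewrite subrr mxE eqxx. Qed.

Lemma lower_uniM A B : lower_uni A -> lower_uni B -> lower_uni (A *m B).
Proof.
move=> hA hB; rewrite /lower_uni.
have -> : A *m B - 1%:M = (A - 1%:M) *m (B - 1%:M) + (A - 1%:M) + (B - 1%:M).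
  rewrite mulmxBl !mulmxBr !mulmx1 !mul1mx; apply/matrixP => u v; rewrite !mxE.
  ring.
by apply: strictly_lowersD => //; apply: strictly_lowersD => //; apply: strictly_lowersM.
Qed.

Lemma lower_uni_exp N : strictly_lowers N -> lower_uni (nilp_exp N).
Proof.
move=> hN; rewrite /lower_uni (@nilp_expE _ _ _ d.+1) //; last exact: strictly_lowers_nilp.
rewrite big_ord_recl dpow0 addrC addKr.
elim/big_ind: _ => [b b'|? ?|k _]; first by rewrite mxE eqxx.
  exact: strictly_lowersD.
apply: strictly_lowersZ; rewrite /= /bump leq0n add1n.
elim: (nat_of_ord k) => [|m IH]; first by rewrite expr1.
by rewrite exprS; apply: strictly_lowersM.
Qed.

Lemma lower_uni_diag A b : lower_uni A -> A b b = 1.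
Proof.
move=> hA; have := hA b b; rewrite ltxx !mxE eqxx subr_eq0.
by case: eqVneq => // _ /(_ isT).
Qed.

Lemma lower_uni_off A b b' : lower_uni A -> A b b' != 0 -> b != b' -> g b < g b'.
Proof. by move=> hA Ab nbb; apply: hA; rewrite !mxE (negPf nbb) subr0. Qed.

End Triangular.

Section Upper.
Variables (K : numFieldType) (d : nat) (g : 'I_d -> int).
Implicit Types A B : 'M[K]_d.

Definition raising A := forall b b', A b b' != 0 -> b != b' -> g b < g b'.

Lemma raising1 : raising 1%:M.
Proof. by move=> b b'; rewrite mxE => + /negPf bb'; rewrite bb' eqxx. Qed.

Lemma raisingM A B : raising A -> raising B -> raising (A *m B).
Proof.
move=> hA hB b b' /mulmx_neq0[k [Ak Bk]] bb'.
have [bk|bk] := eqVneq b k; first by apply: hB; rewrite ?bk // -bk.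
have [kb|kb] := eqVneq k b'; first by apply: hA; rewrite -?kb.
exact: lt_trans (hA _ _ Ak bk) (hB _ _ Bk kb).
Qed.

Lemma raising_diag (D : 'rV[K]_d) : raising (diag_mx D).
Proof. by move=> b b'; rewrite mxE => + /negPf bb'; rewrite bb' eqxx. Qed.

Lemma raising_uni A : lower_uni g A -> raising A.
Proof. by move=> hA b b'; apply: lower_uni_off. Qed.

End Upper.

Lemma lower_raising_eq1 (K : numFieldType) d (g : 'I_d -> int) (A : 'M[K]_d) :
  lower_uni g A -> raising (fun b => - g b) A -> A = 1%:M.
Proof.
move=> lA rA; apply/matrixP => b b'; rewrite [RHS]mxE.
case: eqVneq => [<-|bb']; first exact: lower_uni_diag lA.
apply/eqP; apply: contraT => Ab.
have := lower_uni_off lA Ab bb'; have := rA _ _ Ab bb'; lia.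
Qed.

(** * Root lattice and Weyl group *)

Definition height n (del : 'I_n -> int) (lam : 'rV[int]_n) : int :=
  \sum_k del k * lam 0 k.

(** What the proof uses of a Cartan matrix of type A, B, C or D. The weights [del]
  define a coroot on which all simple roots are positive (a stand-in for
  2 rho^vee); it provides a height, and forces the simple roots to be free. *)
Record finite_cartan n (a : 'M[int]_n) (del : 'I_n -> int) : Prop := FiniteCartan {
  cartan_diag : forall i, a i i = 2;
  cartan_off : forall i j, i != j -> [\/ a i j = 0, a i j = -1 | a i j = - 2%:Z];
  cartan_del : forall k, 0 < del k;
  cartan_height : forall i, 0 < height del (simple_root a i)
}.

Section WeylTheory.
Variables (n : nat) (a : 'M[int]_n) (del : 'I_n -> int).
Hypothesis ha : finite_cartan a del.
Local Notation s_ := (simple_refl a).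
Local Notation W := (weyl_act a).
Local Notation root := (simple_root a).
Local Notation ht := (height del).
Local Notation pos := (positive_weight a).
Implicit Types (w v : seq 'I_n) (lam mu b : 'rV[int]_n).

Lemma heightD lam mu : ht (lam + mu) = ht lam + ht mu.
Proof. by rewrite /height -big_split; apply: eq_bigr => k _; rewrite mxE mulrDr. Qed.

Lemma heightZ z lam : ht (z *: lam) = z * ht lam.
Proof. by rewrite /height mulr_sumr; apply: eq_bigr => k _; rewrite mxE mulrCA. Qed.

Lemma heightN lam : ht (- lam) = - ht lam.
Proof. by rewrite -scaleN1r heightZ mulN1r. Qed.

Lemma height_sum (I : finType) (F : I -> 'rV[int]_n) :
  ht (\sum_i F i) = \sum_i ht (F i).
Proof.
elim/big_ind2: _ => [|x x' y y' <- <-|//]; last exact: heightD.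
by rewrite /height big1 // => k _; rewrite mxE mulr0.
Qed.

Lemma root_coef i k : root i 0 k = a k i.
Proof. by rewrite mxE. Qed.

Lemma root_diag i : root i 0 i = 2.
Proof. by rewrite root_coef (cartan_diag ha). Qed.

Lemma root_neq0 i : root i != 0.
Proof. by apply/eqP => /matrixP/(_ 0 i); rewrite root_diag mxE. Qed.

Lemma cartan_off_le0 i j : i != j -> a i j <= 0.
Proof. by case/(cartan_off ha) => ->. Qed.

(** The matrix, with its rows scaled by [del], is strictly column diagonally
  dominant; summing the resulting bounds on the |z_i| gives z = 0. *)
Lemma roots_free (z : 'I_n -> int) : \sum_i z i *: root i = 0 -> forall i, z i = 0.
Proof.
move=> z0.
have row k : 2 * `|z k| <= \sum_(i | i != k) - a k i * `|z i|.
  have /matrixP/(_ 0 k) := z0; rewrite !mxE summxE (bigD1 k) //= mxE root_diag.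
  under eq_bigr => i _ do rewrite mxE root_coef mulrC.
  move=> /eqP; rewrite addr_eq0 => /eqP zk.
  have -> : 2 * `|z k| = `|z k * 2| by rewrite normrM mulrC.
  rewrite zk normrN; apply: le_trans (ler_norm_sum _ _ _) _.
  apply: ler_sum => i ik; rewrite normrM ler0_norm // cartan_off_le0 //.
  by rewrite eq_sym.
have tot : \sum_i `|z i| * ht (root i) <= 0.
  have e i : ht (root i) = 2 * del i - \sum_(k | i != k) - a k i * del k.
    rewrite /height (bigD1 i) //= root_diag mulrC; congr (_ + _).
    rewrite -sumrN; apply: eq_big => k; first by rewrite eq_sym.
    by move=> _; rewrite root_coef; ring.
  have -> : \sum_i `|z i| * ht (root i) =
     \sum_k del k * (2 * `|z k| - \sum_(i | i != k) - a k i * `|z i|).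
    under eq_bigr => i _ do rewrite e mulrBr.
    under [RHS]eq_bigr => i _ do rewrite mulrBr.
    rewrite !big_split /= !sumrN; congr (_ - _).
      by apply: eq_bigr => i _; ring.
    under eq_bigr => i _ do rewrite mulr_sumr.
    under [RHS]eq_bigr => i _ do rewrite mulr_sumr.
    rewrite (exchange_big_dep xpredT) //=; apply: eq_bigr => k _.
    by apply: eq_bigr => i _; ring.
  apply: sumr_le0 => k _; rewrite pmulr_rle0 ?(cartan_del ha) // subr_le0.
  exact: row.
move=> i; apply/eqP; rewrite -normr_eq0.
have ge0 k : 0 <= `|z k| * ht (root k).
  by rewrite mulr_ge0 // ltW // (cartan_height ha).
have /eqP : \sum_i `|z i| * ht (root i) = 0.
  by apply/eqP; rewrite eq_le tot sumr_ge0.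
rewrite psumr_eq0 // => /allP/(_ i); rewrite mem_index_enum => /(_ isT).
by rewrite mulf_eq0 (gt_eqF (cartan_height ha i)) orbF.
Qed.

Definition comb (z : 'I_n -> int) : 'rV[int]_n := \sum_i z i *: root i.

Lemma comb_inj z z' : comb z = comb z' -> z =1 z'.
Proof.
move=> /eqP; rewrite -subr_eq0 -sumrB => /eqP zz' i.
apply/eqP; rewrite -subr_eq0; apply/eqP; apply: (@roots_free (fun i => z i - z' i)).
by rewrite -[RHS]zz'; apply: eq_bigr => k _; rewrite scalerBl.
Qed.

Lemma combD z z' : comb z + comb z' = comb (fun i => z i + z' i).
Proof. by rewrite -big_split; apply: eq_bigr => i _; rewrite scalerDl. Qed.

Lemma combN z : - comb z = comb (fun i => - z i).
Proof. by rewrite -sumrN; apply: eq_bigr => i _; rewrite scaleNr. Qed.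

Lemma combZ c z : c *: comb z = comb (fun i => c * z i).
Proof. by rewrite scaler_sumr; apply: eq_bigr => i _; rewrite scalerA. Qed.

Lemma comb_delta c i : c *: root i = comb (fun k => if k == i then c else 0).
Proof.
rewrite /comb (bigD1 i) //= eqxx big1 ?addr0 // => k /negPf ->.
by rewrite scale0r.
Qed.

Lemma eq_comb z z' : z =1 z' -> comb z = comb z'.
Proof. by move=> zz'; apply: eq_bigr => i _; rewrite zz'. Qed.

Lemma posP b : pos b <-> exists2 z, b = comb z & forall i, 0 <= z i.
Proof.
split=> [[k ->]|[z -> z0]]; first by exists (fun i => (k i)%:Z).
exists (fun i => `|z i|%N); apply: eq_bigr => i _.
by rewrite gez0_abs.
Qed.

Lemma pos_comb z : pos (comb z) <-> forall i, 0 <= z i.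
Proof.
by split=> [/posP[z' /comb_inj zz' z0] i|z0]; [rewrite zz' | apply/posP; exists z].
Qed.

Lemma pos0 : pos 0.
Proof. by exists (fun=> 0%N); rewrite big1 // => i _; rewrite scale0r. Qed.

Lemma pos_root i : pos (root i).
Proof.
rewrite -[root i]scale1r comb_delta; apply/pos_comb => k.
by case: ifP.
Qed.

Lemma posD b b' : pos b -> pos b' -> pos (b + b').
Proof.
move=> /posP[z -> z0] /posP[z' -> z0']; rewrite combD; apply/pos_comb => i.
by rewrite addr_ge0.
Qed.

Lemma posZ (c : int) b : 0 <= c -> pos b -> pos (c *: b).
Proof.
by move=> c0 /posP[z -> z0]; rewrite combZ; apply/pos_comb => i; rewrite mulr_ge0.
Qed.

Lemma pos_height b : pos b -> b != 0 -> 0 < ht b.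
Proof.
move=> /posP[z -> z0] nz; rewrite /comb height_sum.
have ge0 i : 0 <= ht (z i *: root i).
  by rewrite heightZ mulr_ge0 // ltW // (cartan_height ha).
rewrite lt_neqAle sumr_ge0 // andbT eq_sym; apply: contra nz.
rewrite psumr_eq0 // => /allP h; apply/eqP; apply: big1 => i _.
have := h i; rewrite mem_index_enum heightZ => /(_ isT).
by rewrite mulf_eq0 (gt_eqF (cartan_height ha i)) orbF => /eqP ->; rewrite scale0r.
Qed.

Lemma pos_antisym b : pos b -> pos (- b) -> b = 0.
Proof.
move=> bp bn; apply/eqP; apply: contraT => nb.
have := pos_height bp nb; have := pos_height bn.
rewrite oppr_eq0 heightN => /(_ nb); lia.
Qed.


Lemma refl_lin i c lam mu : s_ i (c *: lam + mu) = c *: s_ i lam + s_ i mu.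
Proof. by apply/matrixP => u v; rewrite !mxE; ring. Qed.

Lemma act_lin w c lam mu : W w (c *: lam + mu) = c *: W w lam + W w mu.
Proof. by elim: w => //= i w ->; rewrite refl_lin. Qed.

Lemma actD w lam mu : W w (lam + mu) = W w lam + W w mu.
Proof. by rewrite -[lam]scale1r act_lin !scale1r. Qed.

Lemma act0 w : W w 0 = 0.
Proof. by apply: (addrI (W w 0)); rewrite -actD !addr0. Qed.

Lemma actZ w c lam : W w (c *: lam) = c *: W w lam.
Proof. by rewrite -[c *: lam]addr0 act_lin act0 !addr0. Qed.

Lemma actN w lam : W w (- lam) = - W w lam.
Proof. by rewrite -scaleN1r actZ scaleN1r. Qed.

Lemma act_refl w i lam : W w (s_ i lam) = W w lam - lam 0 i *: W w (root i).
Proof. by rewrite /simple_refl actD actN actZ. Qed.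

Lemma act_cat w v lam : W (w ++ v) lam = W w (W v lam).
Proof. by rewrite /weyl_act foldr_cat. Qed.

Lemma reflK i : involutive (s_ i).
Proof.
move=> lam; apply/matrixP => u v; rewrite !mxE (cartan_diag ha) (ord1 u); ring.
Qed.

Lemma act_revK w lam : W (rev w) (W w lam) = lam.
Proof.
elim: w lam => //= i w IH lam.
by rewrite rev_cons -cats1 act_cat /= reflK IH.
Qed.

Lemma act_Krev w lam : W w (W (rev w) lam) = lam.
Proof. by rewrite -{1}(revK w) act_revK. Qed.

Lemma refl_root i : s_ i (root i) = - root i.
Proof. by rewrite /simple_refl root_diag -{1}[root i]scale1r -scalerBl -scaleN1r. Qed.

Lemma act_comb w z : exists z', W w (comb z) = comb z'.
Proof.
elim: w => [|i w [z' IH]] /=; first by exists z.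
rewrite IH /simple_refl -scaleNr comb_delta combD; eexists; reflexivity.
Qed.

Lemma act_root w i : exists z, W w (root i) = comb z.
Proof. by rewrite -[root i]scale1r comb_delta; apply: act_comb. Qed.

Lemma act_neq0 w lam : lam != 0 -> W w lam != 0.
Proof. by apply: contra => /eqP h; rewrite -(act_revK w lam) h act0. Qed.

Lemma act_eq_rev w v : W w =1 W v -> W (rev w) =1 W (rev v).
Proof. by move=> wv lam; rewrite -{1}(act_Krev v lam) -wv act_revK. Qed.

Lemma fund_weight_sum lam : lam = \sum_j lam 0 j *: fund_weight j.
Proof.
apply/matrixP => u k; rewrite (ord1 u) summxE (bigD1 k) //= !mxE !eqxx mulr1.
rewrite big1 ?addr0 // => j jk; rewrite !mxE /= eq_sym (negPf jk).
by rewrite mulr0.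
Qed.

Lemma act_sum (I : finType) w (F : I -> 'rV[int]_n) :
  W w (\sum_i F i) = \sum_i W w (F i).
Proof. by elim/big_ind2: _ => [|x x' y y' <- <-|//]; [apply: act0 | apply: actD]. Qed.

(** The only input from representation theory: for each j, a set of weights
  (later, the weights of the module with highest weight Lambda_j) that is stable
  under the Weyl group and lies below Lambda_j. It replaces the root system:
  signs of roots, and the exchange property, are read off from these sets. *)

Variable Wt : 'I_n -> 'rV[int]_n -> Prop.
Hypothesis Wt_fund : forall j, Wt j (fund_weight j).
Hypothesis Wt_refl : forall j i mu, Wt j mu -> Wt j (s_ i mu).
Hypothesis Wt_le : forall j mu, Wt j mu -> pos (fund_weight j - mu).

Lemma Wt_act j w mu : Wt j mu -> Wt j (W w mu).
Proof. by elim: w => //= i w IH /IH; apply: Wt_refl. Qed.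

Lemma pos_of_mul (c : int) w i : 0 < c -> pos (c *: W w (root i)) -> pos (W w (root i)).
Proof.
move=> c0; have [z ->] := act_root w i; rewrite combZ => /pos_comb h.
by apply/pos_comb => k; move: (h k); rewrite pmulr_rge0.
Qed.

(** With m = (w^-1 Lambda_j)(h_i), the weight w s_i w^-1 Lambda_j is
  Lambda_j - m w alpha_i, and it lies below Lambda_j. *)
Lemma sign_root j w i : let m := W (rev w) (fund_weight j) 0 i in
  (0 < m -> pos (W w (root i))) /\ (m < 0 -> pos (- W w (root i))).
Proof.
move=> m.
have h : pos (m *: W w (root i)).
  have := Wt_le (Wt_act w (Wt_refl i (Wt_act (rev w) (Wt_fund j)))).
  by rewrite act_refl -/m act_Krev opprB addrC subrK.
split=> m0; first exact: pos_of_mul h.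
have [z ez] := act_root w i; move: h; rewrite ez combN combZ => /pos_comb h.
by apply/pos_comb => k; have := h k; rewrite oppr_ge0 nmulr_rge0.
Qed.

(** If (w^-1 Lambda_j)(h_i) were 0 for all j, then w^-1 would send every weight,
  among them w alpha_i, to one vanishing on h_i; but alpha_i(h_i) = 2. *)
Lemma root_dichotomy w i : pos (W w (root i)) \/ pos (- W w (root i)).
Proof.
have [/forallP m0|] := boolP [forall j, W (rev w) (fund_weight j) 0 i == 0].
  have : W (rev w) (W w (root i)) 0 i = 0.
    rewrite [X in W (rev w) X]fund_weight_sum act_sum summxE big1 // => j _.
    by rewrite actZ mxE (eqP (m0 j)) mulr0.
  by rewrite act_revK root_diag.
rewrite negb_forall => /existsP[j]; have [hp hn] := sign_root j w i.
by case: ltgtP hp hn => // _ hp hn _; [left; apply: hp | right; apply: hn].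
Qed.

(** Both s_i and r = u s_k u^-1 reverse the line Lambda_j + Z alpha_i, so their two
  composites translate it by opposite amounts. The translates of Lambda_j are
  weights below Lambda_j, so the translation is zero and r = s_i on every
  fundamental weight. *)
Lemma refl_conj u k i : W u (root k) = root i -> forall lam, W u (s_ k lam) = s_ i (W u lam).
Proof.
move=> uk.
have uki : W (rev u) (root i) = root k by rewrite -uk act_revK.
have E j : W (rev u) (fund_weight j) 0 k = fund_weight j 0 i.
  set c := W (rev u) _ 0 k; set m := fund_weight j 0 i.
  have e1 : W u (s_ k (W (rev u) (fund_weight j))) = fund_weight j - c *: root i.
    by rewrite act_refl -/c act_Krev uk.
  have e2 : W u (s_ k (W (rev u) (s_ i (fund_weight j)))) = fund_weight j - (c - m) *: root i.
    rewrite [W (rev u) (s_ i _)]act_refl -/m uki -scaleNr addrC refl_lin act_lin e1.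
    by rewrite refl_root actN uk; apply/matrixP => x y; rewrite !mxE; ring.
  have w1 : pos ((c - m) *: root i).
    have := Wt_le (Wt_act u (Wt_refl k (Wt_act (rev u) (Wt_refl i (Wt_fund j))))).
    by rewrite e2 opprB addrC subrK.
  have w2 : pos ((m - c) *: root i).
    have := Wt_le (Wt_refl i (Wt_act u (Wt_refl k (Wt_act (rev u) (Wt_fund j))))).
    rewrite e1 -scaleNr [X in s_ i X]addrC refl_lin refl_root /simple_refl -/m.
    by congr (pos _); apply/matrixP => x y; rewrite !mxE; ring.
  apply/eqP; rewrite -subr_eq0; apply: contraT => cm.
  have : (c - m) *: root i == 0.
    by apply/eqP/pos_antisym; rewrite // -scaleNr opprB.
  move=> /eqP/matrixP/(_ 0 i); rewrite mxE root_diag mxE; lia.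
have E' lam : W (rev u) lam 0 k = lam 0 i.
  rewrite (fund_weight_sum lam) act_sum !summxE; apply: eq_bigr => j _.
  by rewrite actZ mxE E [in RHS]mxE.
by move=> lam; rewrite act_refl uk -{2}(act_revK u lam) E'.
Qed.

(** The exchange property. Along the letters of v, the root alpha_i first becomes
  negative at some letter k; just before, it is a positive root made negative by s_k,
  hence alpha_k, and [refl_conj] moves s_i across the preceding letters to cancel
  s_k. *)
Lemma exchange v i : pos (- W (rev v) (root i)) ->
  exists2 v', (size v').+1 = size v & W v' =1 W (i :: v).
Proof.
elim/last_ind: v => [|v k IH] hv.
  by have := root_neq0 i; rewrite (@pos_antisym (root i)) ?eqxx //; exact: pos_root.
rewrite rev_rcons /= in hv.
have [vp|vn] := root_dichotomy (rev v) i; last first.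
  have [v' sv' ev'] := IH vn; exists (rcons v' k); first by rewrite !size_rcons sv'.
  by move=> lam; rewrite -!cats1 -cat_cons !act_cat ev'.
(* only the coordinate on alpha_k can have changed sign, and it is 1 because
   the Weyl group acts invertibly on the root lattice *)
have vi : W (rev v) (root i) = root k.
  have [z ez] := act_root (rev v) i; rewrite ez in vp hv.
  move: hv; rewrite /simple_refl -scaleNr comb_delta combD combN => /pos_comb hz.
  have zk l : l != k -> z l = 0.
    move=> lk; apply/eqP; rewrite eq_le (pos_comb z).1 // andbT.
    by have := hz l; rewrite (negPf lk) addr0 oppr_ge0.
  have ezk : W (rev v) (root i) = z k *: root k.
    rewrite ez comb_delta; apply: eq_comb => l.
    by case: eqVneq => [->//|/zk].
  have [y ey] := act_root v k.
  have : z k * y i = 1.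
    have : comb (fun l => z k * y l) = root i.
      by rewrite -combZ -ey -actZ -ezk act_Krev.
    by rewrite -[root i]scale1r comb_delta => /comb_inj/(_ i); rewrite eqxx.
  have zk0 : 0 <= z k by apply: (pos_comb z).1.
  move: zk0; rewrite ezk; move: (z k) (y i) => c c' c0 cc'.
  have c'1 : 0 < c' by rewrite ltNge; apply/negP => c'0; nia.
  have -> : c = 1 by nia.
  by rewrite scale1r.
exists v; first by rewrite size_rcons.
move=> lam; rewrite -cats1 -cat_cons act_cat /= (@refl_conj v k i) ?reflK //.
by rewrite -vi act_Krev.
Qed.

Lemma reduced_suffix i w : reduced_word a (i :: w) -> reduced_word a w.
Proof.
move=> red w' ww'; have := red (i :: w'); rewrite /= ltnS; apply.
by move=> lam /=; rewrite ww'.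
Qed.

Lemma reduced_cons_not_neg i w : reduced_word a (i :: w) -> ~ pos (- W (rev w) (root i)).
Proof.
move=> red /exchange[v' sv' ev']; have := red v' ev'.
by rewrite /=; lia.
Qed.

Lemma extremal_ge0 i w j : reduced_word a (i :: w) -> 0 <= W w (fund_weight j) 0 i.
Proof.
move=> /reduced_cons_not_neg nneg; rewrite leNgt; apply/negP => m0.
by apply: nneg; apply: (sign_root j (rev w) i).2; rewrite revK.
Qed.

(** Such a weight would be moved by w^-1 to Lambda_j + w^-1 alpha_i, above Lambda_j
  because w^-1 alpha_i is positive. Consequently the extremal vector of weight
  w Lambda_j is killed by e_i and is the top of its i-string. *)
Lemma extremal_not_Wt i w j : reduced_word a (i :: w) ->
  ~ Wt j (W w (fund_weight j) + root i).
Proof.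
move=> /reduced_cons_not_neg nneg /(Wt_act (rev w))/Wt_le.
by rewrite actD act_revK opprD addrA subrr add0r.
Qed.

(** If i were missing, w^-1 alpha_i would be alpha_i plus other simple roots, hence
  positive; by [exchange], i :: w would then be reduced and longer. *)
Lemma longest_mem i w : reduced_longest_word a w -> i \in w.
Proof.
move=> [red long]; apply: contraT => iw.
suff /long : reduced_word a (i :: w) by rewrite /= ltnn.
have nneg : ~ pos (- W (rev w) (root i)).
  suff [z ez zi] : exists2 z, W (rev w) (root i) = comb z & z i = 1.
    by rewrite ez combN => /pos_comb/(_ i); rewrite zi.
  have : i \notin rev w by rewrite mem_rev.
  elim: (rev w) => [|k v IH] /=.
    move=> _; rewrite -[root i]scale1r comb_delta; eexists; first reflexivity.
    by rewrite /= eqxx.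
  rewrite inE negb_or => /andP[ik /IH[z ez zi]].
  rewrite ez /simple_refl -scaleNr comb_delta combD; eexists; first reflexivity.
  by rewrite /= (negPf ik) addr0.
have wp : pos (W (rev w) (root i)) by have [//|/nneg] := root_dichotomy (rev w) i.
move=> w' ww'; rewrite ltnNge /=; apply/negP => sw'.
have /exchange[v sv ev] : pos (- W (rev w') (root i)).
  by rewrite (act_eq_rev ww') rev_cons -cats1 act_cat /= refl_root actN opprK.
have /red : W v =1 W w by move=> lam; rewrite ev /= ww' /= reflK.
by move: sw'; rewrite -sv; move=> h1 h2; have := leq_trans h1 h2; rewrite ltnn.
Qed.

End WeylTheory.

(** * Brackets, conjugation and subspaces *)

Ltac mxfield := apply/matrixP => ? ?; rewrite !mxE; field.

Section Bracket.
Variables (K : fieldType) (d : nat).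
Implicit Types A B C P X Y : 'M[K]_d.

Lemma bracketC A B : mx_bracket A B = - mx_bracket B A.
Proof. by rewrite /mx_bracket opprB. Qed.

Lemma bracketZl s A B : mx_bracket (s *: A) B = s *: mx_bracket A B.
Proof. by rewrite /mx_bracket -scalemxAl -scalemxAr scalerBr. Qed.

Lemma bracketZr s A B : mx_bracket A (s *: B) = s *: mx_bracket A B.
Proof. by rewrite /mx_bracket -scalemxAl -scalemxAr scalerBr. Qed.

Lemma bracketNr A B : mx_bracket A (- B) = - mx_bracket A B.
Proof. by rewrite /mx_bracket mulmxN mulNmx opprB opprK addrC. Qed.

Lemma bracket0r A : mx_bracket A 0 = 0.
Proof. by rewrite /mx_bracket mulmx0 mul0mx subrr. Qed.

Lemma bracketAA A : mx_bracket A A = 0.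
Proof. by rewrite /mx_bracket subrr. Qed.

Lemma jacobi A B C :
  mx_bracket A (mx_bracket B C) = mx_bracket (mx_bracket A B) C + mx_bracket B (mx_bracket A C).
Proof.
rewrite /mx_bracket !mulmxBl !mulmxBr !mulmxA.
by apply/matrixP => i k; rewrite !mxE; ring.
Qed.

Lemma bracket0_comm A B : mx_bracket A B = 0 -> A *m B = B *m A.
Proof. by move/eqP; rewrite subr_eq0 => /eqP. Qed.

Definition Ad P P' X : 'M[K]_d := P *m X *m P'.

Lemma AdD P P' X Y : Ad P P' (X + Y) = Ad P P' X + Ad P P' Y.
Proof. by rewrite /Ad mulmxDr mulmxDl. Qed.
Lemma AdZ P P' s X : Ad P P' (s *: X) = s *: Ad P P' X.
Proof. by rewrite /Ad -scalemxAr -scalemxAl. Qed.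
Lemma AdN P P' X : Ad P P' (- X) = - Ad P P' X.
Proof. by rewrite /Ad mulmxN mulNmx. Qed.
Lemma AdAd P P' Q Q' X : Ad P P' (Ad Q Q' X) = Ad (P *m Q) (Q' *m P') X.
Proof. by rewrite /Ad !mulmxA. Qed.

Lemma AdM P P' X Y : P' *m P = 1%:M -> Ad P P' (X *m Y) = Ad P P' X *m Ad P P' Y.
Proof. by move=> P'P; rewrite /Ad !mulmxA -(mulmxA _ P') P'P mulmx1. Qed.

Lemma Ad_eq_comm A A' B B' X : A' *m A = 1%:M -> B' *m B = 1%:M ->
  Ad A A' X = Ad B B' X -> comm_mx (B' *m A) X.
Proof.
move=> AA' BB' AB; rewrite /comm_mx.
have -> : B' *m A *m X = B' *m Ad A A' X *m A.
  by rewrite /Ad !mulmxA -(mulmxA _ A') AA' mulmx1.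
by rewrite AB /Ad !mulmxA BB' mul1mx -!mulmxA.
Qed.

Lemma Ad_move P P' X Y : P *m P' = 1%:M -> Ad P' P X = Y -> X *m P = P *m Y.
Proof. by move=> PP' <-; rewrite /Ad !mulmxA PP' mul1mx. Qed.

End Bracket.

(** A subspace given by a predicate is a row space: take a matrix of maximal rank
  among those whose rows satisfy the predicate. *)
Lemma subspace_mx (K : fieldType) d (S : 'rV[K]_d -> Prop) :
  S 0 -> (forall c u v, S u -> S v -> S (c *: u + v)) ->
  exists U : 'M[K]_d, forall v, (v <= U)%MS <-> S v.
Proof.
move=> S0 Slin.
pose P r := `[< exists2 U : 'M[K]_d, \rank U = r & forall v, (v <= U)%MS -> S v >].
have exP : exists r, P r.
  exists 0%N; apply/asboolP; exists 0; first by rewrite mxrank0.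
  by move=> v; rewrite submx0 => /eqP ->.
have bP r : P r -> (r <= d)%N by move=> /asboolP[U <- _]; apply: rank_leq_col.
case: (ex_maxnP exP bP) => r /asboolP[U rU US] maxr.
exists U => v; split; first exact: US.
move=> Sv; have : P (\rank (U + v)%MS).
  apply/asboolP; exists (U + v)%MS => // w /sub_addsmxP[[w1 w2] /= ->].
  rewrite addrC [w2]mx11_scalar mul_scalar_mx; apply: Slin => //.
  by apply: US; apply: submxMl.
move/maxr; rewrite -rU => le; apply: submx_trans (addsmxSr U v) _.
by rewrite -(geq_leqif (mxrank_leqif_sup (addsmxSl U v))).
Qed.

Lemma poly_vanish (K : numFieldType) (p B : {poly K}) :
  B != 0 -> (forall s, B.[s] != 0 -> p.[s] = 0) -> p = 0.
Proof.
move=> B0 hp; apply/eqP; apply: contraT => p0.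
have pB0 : p * B != 0 by rewrite mulf_neq0.
pose rs := [seq k%:R : K | k <- iota 0 (size (p * B))].
have := max_poly_roots pB0 (_ : all (root (p * B)) rs) (_ : uniq rs).
rewrite size_map size_iota ltnn => -> //.
  apply/allP => x _; rewrite /root hornerM mulf_eq0 orbC.
  by case: (eqVneq B.[x] 0) => //= /hp ->; rewrite eqxx.
rewrite map_inj_uniq ?iota_uniq // => x y /eqP; rewrite eqr_nat => /eqP //.
Qed.

(** * Coordinates of words *)

HB.instance Definition _ (R : pzRingType) d :=
  Monoid.isLaw.Build 'M[R]_d 1%:M (@mulmx R d d d)
    (@mulmxA R d d d d) (@mul1mx R d d) (@mulmx1 R d d).

Section Words.
Variables (K : numFieldType) (n : nat) (a : 'M[int]_n).
Variables (i : 'I_n) (ii : nat -> 'I_n).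
Implicit Type c : nat -> K.

(** The value of the root alpha_i on the torus part of the first k letters. *)
Definition root_val c k : K := \prod_(l < k) c l ^ a (ii l) i.
Definition S_nat c m : K := (root_val c m * c m)^-1.
Definition S_sum c k : K := \sum_(m < k | ii m == i) S_nat c m.
(** Left multiplication by x_i(tau) changes the coordinates in this way. With
  tau = (s - 1) / eps, where eps is the full sum of the S_m, the two factors are
  the numerator and the denominator of e_i^s, both divided by eps. *)
Definition shift_coord tau c k : K := c k * ((1 + tau * S_sum c k.+1) / (1 + tau * S_sum c k)).

Lemma root_valS c k : root_val c k.+1 = root_val c k * c k ^ a (ii k) i.
Proof. by rewrite /root_val big_ord_recr. Qed.

Lemma S_sumS c k : S_sum c k.+1 = S_sum c k + (if ii k == i then S_nat c k else 0).
Proof. by rewrite /S_sum big_mkcond big_ord_recr /= -big_mkcond. Qed.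

Lemma S_sum0 c : S_sum c 0 = 0.
Proof. by rewrite /S_sum big_ord0. Qed.

Lemma root_val_neq0 c k : (forall l, (l < k)%N -> c l != 0) -> root_val c k != 0.
Proof. by move=> hc; apply/prodf_neq0 => l _; rewrite expfz_neq0 ?hc. Qed.

End Words.

(** * Weights and one-parameter subgroups of a fundamental module *)

Section Module.
Variables (K : numFieldType) (n : nat) (a : 'M[int]_n) (del : 'I_n -> int).
Hypothesis ha : finite_cartan a del.
Variables (j0 : 'I_n) (M : fundamental_module K a j0).
Local Notation d := (fm_dim M).
Local Notation wt := (@fm_wt _ _ _ _ M).
Local Notation e := (fm_e M).
Local Notation f := (fm_f M).
Local Notation h := (fm_h M).
Local Notation hw := (fm_hw M).
Local Notation root := (simple_root a).
Local Notation s_ := (simple_refl a).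
Local Notation pos := (positive_weight a).
Local Notation Lam := (fund_weight j0).
Local Notation "[ A , B ]" := (mx_bracket A B).

Implicit Types (X Y Z : 'M[K]_d).

Let rel := fm_relations M.

Lemma fm_hE m i (X : 'M[K]_(d, m)) b c : (h i *m X) b c = (wt b 0 i)%:~R * X b c.
Proof. by rewrite mul_diag_mx !mxE. Qed.

Lemma fm_hEr m i (X : 'M[K]_(m, d)) b c : (X *m h i) b c = X b c * (wt c 0 i)%:~R.
Proof. by rewrite mul_mx_diag !mxE. Qed.

(** An ad(h_i)-eigenvector shifts weights by its eigenvalue. *)
Lemma intertwine_entry i (x : int) (X : 'M[K]_d) b b' :
  [h i, X] = x%:~R *: X -> X b b' != 0 -> wt b 0 i = wt b' 0 i + x.
Proof.
move=> /matrixP/(_ b b'); rewrite mxE [X in _ + X]mxE fm_hE fm_hEr [RHS]mxE.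
rewrite [X b b' * _]mulrC -mulrBl => /eqP; rewrite -subr_eq0 -mulrBl mulf_eq0.
move=> + /negPf Xn; rewrite Xn orbF -!rmorphB /= intr_eq0; lia.
Qed.

Lemma e_wt i b b' : e i b b' != 0 -> wt b = wt b' + root i.
Proof.
move=> eb; apply/matrixP => u k; rewrite (ord1 u) mxE root_coef.
by apply: (@intertwine_entry k _ (e i)) => //; rewrite (serre_he rel).
Qed.

Lemma f_wt i b b' : f i b b' != 0 -> wt b = wt b' - root i.
Proof.
move=> fb; apply/matrixP => u k; rewrite (ord1 u) mxE [X in _ + X]mxE root_coef.
apply: (@intertwine_entry k _ (f i)) => //; rewrite (serre_hf rel).
by rewrite -scaleNr rmorphN.
Qed.

Definition gdn b := height del (wt b).
Definition gup b := - height del (wt b).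

Lemma f_lowers i : strictly_lowers gdn (f i).
Proof.
move=> b b' /f_wt; rewrite /gdn => ->; rewrite heightD heightN.
by have := cartan_height ha i; lia.
Qed.

Lemma e_raises i : strictly_lowers gup (e i).
Proof.
move=> b b' /e_wt; rewrite /gup => ->; rewrite heightD.
by have := cartan_height ha i; lia.
Qed.

Lemma nilp_e i : mxnilp (e i). Proof. apply: strictly_lowers_nilp; exact: e_raises. Qed.
Lemma nilp_f i : mxnilp (f i). Proof. apply: strictly_lowers_nilp; exact: f_lowers. Qed.

Lemma hw_wt b : hw b 0 != 0 -> wt b = Lam.
Proof.
move=> hb; apply/matrixP => u i; rewrite (ord1 u).
have /matrixP/(_ b 0) := fm_hw_h M i; rewrite fm_hE [RHS]mxE => /(mulIf hb) /eqP.
by rewrite eqr_int => /eqP.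
Qed.

Definition is_weight mu := exists b, wt b = mu.

Lemma is_weight_Lam : is_weight Lam.
Proof.
have /cV0Pn[b hb] := fm_hw_neq0 M.
by exists b; apply: hw_wt.
Qed.

(** The vectors f_{i_1} ... f_{i_r} hw span a submodule, hence everything: this
  bounds the weights. *)
Inductive fspan : 'cV[K]_d -> Prop :=
  | fspan_hw : fspan hw
  | fspan0 : fspan 0
  | fspan_lin c u v : fspan u -> fspan v -> fspan (c *: u + v)
  | fspan_f i u : fspan u -> fspan (f i *m u).

Lemma fspanZ c u : fspan u -> fspan (c *: u).
Proof. by move=> hu; rewrite -[_ *: _]addr0; apply: fspan_lin => //; apply: fspan0. Qed.

Lemma fspan_h i u : fspan u -> fspan (h i *m u).
Proof.
elim=> [||c v w _ hv _ hw'|k v Sv hv].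
- by rewrite fm_hw_h; apply/fspanZ/fspan_hw.
- by rewrite mulmx0; apply: fspan0.
- by rewrite mulmxDr -scalemxAr; apply: fspan_lin.
have := serre_hf rel i k; rewrite /mx_bracket => /(canRL (subrK _)) hf.
rewrite mulmxA hf mulmxDl -scaleNr -scalemxAl; apply: fspan_lin; first exact: fspan_f.
by rewrite -mulmxA; apply: fspan_f.
Qed.

Lemma fspan_e i u : fspan u -> fspan (e i *m u).
Proof.
elim=> [||c v w _ hv _ hw'|k v Sv hv].
- by rewrite fm_hw_e; apply: fspan0.
- by rewrite mulmx0; apply: fspan0.
- by rewrite mulmxDr -scalemxAr; apply: fspan_lin.
have := serre_ef rel i k; rewrite /mx_bracket => /(canRL (subrK _)) ef.
rewrite mulmxA ef mulmxDl -[X in X + _]scale1r; apply: fspan_lin.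
  by case: eqP => _; [apply: fspan_h | rewrite mul0mx; apply: fspan0].
by rewrite -mulmxA; apply: fspan_f.
Qed.

Lemma fspan_wt u b : fspan u -> u b 0 != 0 -> pos (Lam - wt b).
Proof.
move=> hu; elim: hu b => [b /hw_wt ->||c v w _ hv _ hw' b|k v _ hv b].
- by rewrite subrr; apply: pos0.
- by move=> b; rewrite mxE eqxx.
- rewrite !mxE; case: (eqVneq (v b 0) 0) => [->|/hv //].
  by rewrite mulr0 add0r => /hw'.
case/mulmx_neq0 => b' [/f_wt -> /hv h'].
by rewrite opprB addrCA; apply: (posD ha) => //; apply: (pos_root ha).
Qed.

Lemma fspanT u : fspan u.
Proof.
have [|c x y|U hU] := @subspace_mx K d (fun v => fspan v^T).
- by rewrite trmx0; apply: fspan0.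
- by rewrite linearD linearZ; apply: fspan_lin.
have stab X : (forall v, fspan v -> fspan (X *m v)) -> stablemx U X^T.
  move=> hX; apply/row_subP => i; rewrite row_mul.
  by apply/hU; rewrite trmx_mul trmxK; apply: hX; apply/hU; apply: row_sub.
have [i|U0|full] := (fm_irreducible M).2 U.
- by split; apply: stab; [apply: fspan_e | apply: fspan_f | apply: fspan_h].
- have /eqP : hw^T = 0.
    by apply/eqP; rewrite -submx0 -U0; apply/hU; rewrite trmxK; apply: fspan_hw.
  by rewrite trmx_eq0 (negPf (fm_hw_neq0 M)).
by rewrite -[u]trmxK; apply/hU; apply: submx_full.
Qed.

Lemma weight_le mu : is_weight mu -> pos (Lam - mu).
Proof.
move=> [b <-]; apply: (fspan_wt (fspanT (delta_mx b 0))).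
by rewrite mxE !eqxx oner_neq0.
Qed.

Lemma not_weight_raise i : ~ is_weight (Lam + root i).
Proof.
move/weight_le; rewrite opprD addrA subrr add0r => hN.
by have := root_neq0 ha i; rewrite (pos_antisym ha (pos_root ha i) hN) eqxx.
Qed.

Definition xm i t : 'M[K]_d := nilp_exp (t *: e i).
Definition ym i t : 'M[K]_d := nilp_exp (t *: f i).
Definition cm i c : 'M[K]_d := diag_mx (\row_b c ^ wt b 0 i).
(** The representative of s_i acting on the module, and its inverse. *)
Definition sm i := xm i (-1) *m ym i 1 *m xm i (-1).
Definition sm' i := xm i 1 *m ym i (-1) *m xm i 1.

Lemma xmD i s t : xm i s *m xm i t = xm i (s + t).
Proof. exact: nilp_expD (nilp_e i). Qed.
Lemma ymD i s t : ym i s *m ym i t = ym i (s + t).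
Proof. exact: nilp_expD (nilp_f i). Qed.
Lemma xm0 i : xm i 0 = 1%:M. Proof. by rewrite /xm scale0r nilp_exp_at0. Qed.
Lemma ym0 i : ym i 0 = 1%:M. Proof. by rewrite /ym scale0r nilp_exp_at0. Qed.
Lemma xmN i s : xm i s *m xm i (- s) = 1%:M. Proof. by rewrite xmD subrr xm0. Qed.
Lemma xmN' i s : xm i (- s) *m xm i s = 1%:M. Proof. by rewrite xmD addNr xm0. Qed.
Lemma ymN i s : ym i s *m ym i (- s) = 1%:M. Proof. by rewrite ymD subrr ym0. Qed.
Lemma ymN' i s : ym i (- s) *m ym i s = 1%:M. Proof. by rewrite ymD addNr ym0. Qed.

Lemma cmD i c c' : c != 0 -> c' != 0 -> cm i c *m cm i c' = cm i (c * c').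
Proof.
move=> c0 c'0; rewrite mulmx_diag; congr diag_mx; apply/rowP => b.
by rewrite !mxE expfzMl.
Qed.
Lemma cm1 i : cm i 1 = 1%:M.
Proof.
by apply/matrixP => b b'; rewrite !mxE exp1rz.
Qed.
Lemma cmV i c : c != 0 -> cm i c *m cm i c^-1 = 1%:M.
Proof. by move=> c0; rewrite cmD ?invr_eq0 // divff // cm1. Qed.
Lemma cmV' i c : c != 0 -> cm i c^-1 *m cm i c = 1%:M.
Proof. by move=> c0; rewrite cmD ?invr_eq0 // mulVf // cm1. Qed.

Lemma smV i : sm i *m sm' i = 1%:M.
Proof.
rewrite /sm /sm' -!mulmxA (mulmxA (xm i (-1)) (xm i 1)) xmN' mul1mx.
by rewrite (mulmxA (ym i 1)) ymN mul1mx xmN'.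
Qed.
Lemma smV' i : sm' i *m sm i = 1%:M.
Proof. exact: mulmx1C (smV i). Qed.

(** * Adjoint action of the rank one subgroups *)

Definition Adx i t := Ad (xm i t) (xm i (- t)).
Definition Ady i t := Ad (ym i t) (ym i (- t)).
Definition Adc i q := Ad (cm i q) (cm i q^-1).

Lemma AdxD i t X Y : Adx i t (X + Y) = Adx i t X + Adx i t Y.
Proof. exact: AdD. Qed.
Lemma AdxN i t X : Adx i t (- X) = - Adx i t X.
Proof. exact: AdN. Qed.
Lemma AdxZ i t s X : Adx i t (s *: X) = s *: Adx i t X.
Proof. exact: AdZ. Qed.
Lemma AdyD i t X Y : Ady i t (X + Y) = Ady i t X + Ady i t Y.
Proof. exact: AdD. Qed.
Lemma AdyN i t X : Ady i t (- X) = - Ady i t X.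
Proof. exact: AdN. Qed.
Lemma AdyZ i t s X : Ady i t (s *: X) = s *: Ady i t X.
Proof. exact: AdZ. Qed.
Lemma AdcD i t X Y : Adc i t (X + Y) = Adc i t X + Adc i t Y.
Proof. exact: AdD. Qed.
Lemma AdcN i t X : Adc i t (- X) = - Adc i t X.
Proof. exact: AdN. Qed.
Lemma AdcZ i t s X : Adc i t (s *: X) = s *: Adc i t X.
Proof. exact: AdZ. Qed.

Lemma Adx_bracket i t A B C : [e i, A] = B -> [e i, B] = C -> [e i, C] = 0 ->
  Adx i t A = A + t *: B + (t ^+ 2 / 2) *: C.
Proof.
move=> AB BC C0; rewrite /Adx /Ad /xm.
rewrite (@exp_bracket _ _ (t *: e i) A (t *: B) (t ^+ 2 *: C)).
- rewrite -mulmxA (xmN) mulmx1 scalerA; congr (_ + _ *: _); exact: mulrC.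
- by apply: nilpZ; apply: nilp_e.
- by rewrite bracketZl AB.
- by rewrite bracketZl bracketZr BC scalerA.
- by rewrite bracketZl bracketZr C0 !scaler0.
Qed.

Lemma Ady_bracket i t A B C : [f i, A] = B -> [f i, B] = C -> [f i, C] = 0 ->
  Ady i t A = A + t *: B + (t ^+ 2 / 2) *: C.
Proof.
move=> AB BC C0; rewrite /Ady /Ad /ym.
rewrite (@exp_bracket _ _ (t *: f i) A (t *: B) (t ^+ 2 *: C)).
- rewrite -mulmxA (ymN) mulmx1 scalerA; congr (_ + _ *: _); exact: mulrC.
- by apply: nilpZ; apply: nilp_f.
- by rewrite bracketZl AB.
- by rewrite bracketZl bracketZr BC scalerA.
- by rewrite bracketZl bracketZr C0 !scaler0.
Qed.

Lemma bracket_eh i k : [e i, h k] = - (a k i)%:~R *: e i.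
Proof. by rewrite bracketC (serre_he rel) scaleNr. Qed.
Lemma bracket_fh i k : [f i, h k] = (a k i)%:~R *: f i.
Proof. by rewrite bracketC (serre_hf rel) opprK. Qed.
Lemma bracket_ef i : [e i, f i] = h i.
Proof. by rewrite (serre_ef rel) eqxx. Qed.
Lemma bracket_fe i : [f i, e i] = - h i.
Proof. by rewrite bracketC bracket_ef. Qed.
Lemma bracket_ef_neq i k : i != k -> [e i, f k] = 0.
Proof. by move=> ik; rewrite (serre_ef rel) (negPf ik). Qed.
Lemma bracket_fe_neq i k : i != k -> [f i, e k] = 0.
Proof. by move=> ik; rewrite bracketC bracket_ef_neq ?oppr0 // eq_sym. Qed.
Lemma diagE i : (a i i)%:~R = 2 :> K.
Proof. by rewrite (cartan_diag ha). Qed.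

Lemma Adx_h i t k : Adx i t (h k) = h k - (t * (a k i)%:~R) *: e i.
Proof.
rewrite (Adx_bracket t (bracket_eh i k) (C := 0)) ?bracketZr ?bracketAA ?scaler0 ?bracket0r //.
by mxfield.
Qed.

Lemma Ady_h i t k : Ady i t (h k) = h k + (t * (a k i)%:~R) *: f i.
Proof.
rewrite (Ady_bracket t (bracket_fh i k) (C := 0)) ?bracketZr ?bracketAA ?scaler0 ?bracket0r //.
by mxfield.
Qed.

Lemma Adx_e i t : Adx i t (e i) = e i.
Proof.
rewrite (Adx_bracket t (bracketAA (e i)) (C := 0)) ?bracket0r //.
by rewrite !scaler0 !addr0.
Qed.

Lemma Ady_f i t : Ady i t (f i) = f i.
Proof.
rewrite (Ady_bracket t (bracketAA (f i)) (C := 0)) ?bracket0r //.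
by rewrite !scaler0 !addr0.
Qed.

Lemma Adx_f i t : Adx i t (f i) = f i + t *: h i - t ^+ 2 *: e i.
Proof.
rewrite (Adx_bracket t (bracket_ef i) (bracket_eh i i)).
  by rewrite diagE; mxfield.
by rewrite bracketZr bracketAA scaler0.
Qed.

Lemma Ady_e i t : Ady i t (e i) = e i - t *: h i - t ^+ 2 *: f i.
Proof.
rewrite (@Ady_bracket i t _ _ (- 2 *: f i) (bracket_fe i)).
- by mxfield.
- by rewrite bracketNr bracket_fh diagE scaleNr.
- by rewrite bracketZr bracketAA scaler0.
Qed.

Lemma Adx_fj i k t : i != k -> Adx i t (f k) = f k.
Proof.
move=> ik; rewrite (Adx_bracket t (bracket_ef_neq ik) (C := 0)) ?bracket0r //.
by rewrite !scaler0 !addr0.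
Qed.

Lemma Ady_ej i k t : i != k -> Ady i t (e k) = e k.
Proof.
move=> ik; rewrite (Ady_bracket t (bracket_fe_neq ik) (C := 0)) ?bracket0r //.
by rewrite !scaler0 !addr0.
Qed.

(** The strings of [e k] and [f k] under the i-th sl_2 have at most three terms.
  They are locked because a commutator is itself a difference, to which the
  linearity of the adjoint action would apply. *)
Definition e1 i k := locked [e i, e k].
Definition e2 i k := locked [e i, e1 i k].
Definition f1 i k := locked [f i, f k].
Definition f2 i k := locked [f i, f1 i k].

Lemma e1E i k : [e i, e k] = e1 i k. Proof. by rewrite /e1 -lock. Qed.
Lemma e2E i k : [e i, e1 i k] = e2 i k. Proof. by rewrite /e2 -lock. Qed.
Lemma f1E i k : [f i, f k] = f1 i k. Proof. by rewrite /f1 -lock. Qed.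
Lemma f2E i k : [f i, f1 i k] = f2 i k. Proof. by rewrite /f2 -lock. Qed.

(** The Serre relations, for the three possible values of an off-diagonal
  entry of the Cartan matrix. *)
Lemma serre_strings i k : i != k ->
  [\/ [/\ a i k = 0, e1 i k = 0, f1 i k = 0, e2 i k = 0 & f2 i k = 0],
      [/\ a i k = -1, e2 i k = 0 & f2 i k = 0]
    | [/\ a i k = - 2%:Z, [e i, e2 i k] = 0 & [f i, f2 i k] = 0]].
Proof.
move=> ik; have := serre_ee rel ik; have := serre_ff rel ik.
case: (cartan_off ha ik) => ->; rewrite ?subr0 ?opprK /= ?f1E ?f2E ?e1E ?e2E => ff ee.
- by apply: Or31; rewrite -e2E -f2E ee ff !bracket0r.
- by apply: Or32.
- by apply: Or33.
Qed.

Lemma e3 i k : i != k -> [e i, e2 i k] = 0.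
Proof. by case/serre_strings => [[_ _ _ -> _]|[_ -> _]|[_ -> _]]; rewrite ?bracket0r. Qed.

Lemma f3 i k : i != k -> [f i, f2 i k] = 0.
Proof. by case/serre_strings => [[_ _ _ _ ->]|[_ _ ->]|[_ _ ->]]; rewrite ?bracket0r. Qed.

Lemma Adx_ej i k t : i != k ->
  Adx i t (e k) = e k + t *: e1 i k + (t ^+ 2 / 2) *: e2 i k.
Proof. by move=> ik; rewrite (Adx_bracket t (e1E i k) (e2E i k) (e3 ik)). Qed.

Lemma Ady_fj i k t : i != k ->
  Ady i t (f k) = f k + t *: f1 i k + (t ^+ 2 / 2) *: f2 i k.
Proof. by move=> ik; rewrite (Ady_bracket t (f1E i k) (f2E i k) (f3 ik)). Qed.

Lemma bracket_fe1 i k : i != k -> [f i, e1 i k] = - (a i k)%:~R *: e k.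
Proof.
move=> ik; rewrite -e1E jacobi bracket_fe bracket_fe_neq // bracket0r addr0.
by rewrite bracketC bracketNr opprK bracketC (serre_he rel) scaleNr.
Qed.

Lemma bracket_ef1 i k : i != k -> [e i, f1 i k] = - (a i k)%:~R *: f k.
Proof.
move=> ik; rewrite -f1E jacobi bracket_ef bracket_ef_neq // bracket0r addr0.
by rewrite (serre_hf rel) scaleNr.
Qed.

Lemma bracket_h_shift i X Y (x y : int) :
  [h i, X] = x%:~R *: X -> [h i, Y] = y%:~R *: Y ->
  [h i, [X, Y]] = (x + y)%:~R *: [X, Y].
Proof. by move=> hX hY; rewrite jacobi hX hY bracketZl bracketZr -scalerDl rmorphD. Qed.

Lemma he i k : [h i, e k] = (a i k)%:~R *: e k. Proof. exact: (serre_he rel). Qed.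
Lemma hf i k : [h i, f k] = (- a i k)%:~R *: f k.
Proof. by rewrite (serre_hf rel) -scaleNr rmorphN. Qed.

Lemma bracket_he1 i k : [h i, e1 i k] = (2 + (a i k)%:~R) *: e1 i k.
Proof.
rewrite -e1E jacobi !(serre_he rel) bracketZr bracketZl diagE -scalerDl.
by rewrite addrC.
Qed.

Lemma bracket_hf1 i k : [h i, f1 i k] = - (2 + (a i k)%:~R) *: f1 i k.
Proof.
rewrite -f1E (bracket_h_shift (hf i i) (hf i k)) (cartan_diag ha) -opprD.
by rewrite rmorphN rmorphD.
Qed.

Lemma bracket_fe2 i k : i != k ->
  [f i, e2 i k] = - (2 + 2 * (a i k)%:~R) *: e1 i k.
Proof.
move=> ik; rewrite -e2E jacobi bracket_fe bracket_fe1 // bracketZr e1E.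
rewrite bracketC bracketNr opprK bracketC bracket_he1 -scaleNr -scalerDl.
by congr (_ *: _); ring.
Qed.

Lemma bracket_ef2 i k : i != k ->
  [e i, f2 i k] = - (2 + 2 * (a i k)%:~R) *: f1 i k.
Proof.
move=> ik; rewrite -f2E jacobi bracket_ef bracket_ef1 // bracketZr f1E bracket_hf1 -scalerDl.
by congr (_ *: _); ring.
Qed.

Lemma Ady_e1 i k t : i != k -> Ady i t (e1 i k) = e1 i k - (t * (a i k)%:~R) *: e k.
Proof.
move=> ik; rewrite (Ady_bracket t (bracket_fe1 ik) (C := 0)) ?bracketZr ?bracket_fe_neq //.
- by mxfield.
- by rewrite scaler0.
- by rewrite bracket0r.
Qed.

Lemma Adx_f1 i k t : i != k -> Adx i t (f1 i k) = f1 i k - (t * (a i k)%:~R) *: f k.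
Proof.
move=> ik; rewrite (Adx_bracket t (bracket_ef1 ik) (C := 0)) ?bracketZr ?bracket_ef_neq //.
- by mxfield.
- by rewrite scaler0.
- by rewrite bracket0r.
Qed.

Lemma Ady_e2 i k t : i != k -> Ady i t (e2 i k) =
  e2 i k - (t * (2 + 2 * (a i k)%:~R)) *: e1 i k
  + (t ^+ 2 * (1 + (a i k)%:~R) * (a i k)%:~R) *: e k.
Proof.
move=> ik; rewrite (@Ady_bracket i t _ _ ((2 + 2 * (a i k)%:~R) * (a i k)%:~R *: e k) (bracket_fe2 ik)).
- by mxfield.
- by rewrite bracketZr bracket_fe1 // scalerA mulrNN.
- by rewrite bracketZr bracket_fe_neq // scaler0.
Qed.

Lemma Adx_f2 i k t : i != k -> Adx i t (f2 i k) =
  f2 i k - (t * (2 + 2 * (a i k)%:~R)) *: f1 i k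
  + (t ^+ 2 * (1 + (a i k)%:~R) * (a i k)%:~R) *: f k.
Proof.
move=> ik; rewrite (@Adx_bracket i t _ _ ((2 + 2 * (a i k)%:~R) * (a i k)%:~R *: f k) (bracket_ef2 ik)).
- by mxfield.
- by rewrite bracketZr bracket_ef1 // scalerA mulrNN.
- by rewrite bracketZr bracket_ef_neq // scaler0.
Qed.

Lemma Adc_weight i q (x : int) X : q != 0 ->
  [h i, X] = x%:~R *: X -> Adc i q X = q ^ x *: X.
Proof.
move=> q0 hX; apply/matrixP => b b'.
rewrite /Adc /Ad mul_mx_diag mul_diag_mx !mxE.
case: (eqVneq (X b b') 0) => [->|/(intertwine_entry hX) ->]; first by rewrite !mulr0 mul0r.
rewrite expfzDr // exprz_inv -invr_expz.
by field; rewrite expfz_neq0.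
Qed.

Lemma Adc_e i k q : q != 0 -> Adc i q (e k) = q ^ a i k *: e k.
Proof. by move=> q0; apply: Adc_weight; rewrite // (serre_he rel). Qed.

Lemma Adc_f i k q : q != 0 -> Adc i q (f k) = q ^ (- a i k) *: f k.
Proof. by move=> q0; apply: Adc_weight; rewrite // (serre_hf rel) -scaleNr rmorphN. Qed.

Lemma Adc_h i k q : q != 0 -> Adc i q (h k) = h k.
Proof.
by move=> q0; rewrite (@Adc_weight i q 0) ?expr0z ?scale1r // (serre_hh rel) scale0r.
Qed.

Lemma Adc_e1 i k q : q != 0 -> Adc i q (e1 i k) = q ^ (2 + a i k) *: e1 i k.
Proof.
by move=> q0; apply: Adc_weight => //; rewrite -(cartan_diag ha i) -e1E; apply: bracket_h_shift; apply: he.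
Qed.

Lemma Adc_e2 i k q : q != 0 -> Adc i q (e2 i k) = q ^ (2 + (2 + a i k)) *: e2 i k.
Proof.
move=> q0; apply: Adc_weight => //; rewrite -(cartan_diag ha i) -e2E -e1E.
by apply: bracket_h_shift; [apply: he | apply: bracket_h_shift; apply: he].
Qed.

(** Z - 1 has a nonzero kernel, which is a submodule of an irreducible module. *)
Lemma commutant_hw Z : (forall i, comm_mx Z (e i)) -> (forall i, comm_mx Z (f i)) ->
  Z *m hw = hw -> Z = 1%:M.
Proof.
move=> Ze Zf Zhw; pose Y := (Z - 1%:M)^T.
have cY X : comm_mx Z X -> stablemx (kermx Y) X^T.
  move=> ZX; apply: comm_mx_stable_ker; rewrite /comm_mx /Y -!trmx_mul.
  by rewrite mulmxBl mulmxBr ZX mul1mx mulmx1.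
have Zh i : comm_mx Z (h i).
  rewrite /comm_mx -bracket_ef /mx_bracket mulmxBl mulmxBr.
  by rewrite !mulmxA Ze Zf -!mulmxA Ze Zf.
have [i|k0|full] := (fm_irreducible M).2 (kermx Y).
- by split; apply: cY.
- have : (hw^T <= kermx Y)%MS.
    by apply/sub_kermxP; rewrite /Y -trmx_mul mulmxBl Zhw mul1mx subrr trmx0.
  by rewrite k0 submx0 trmx_eq0 (negPf (fm_hw_neq0 M)).
have Y0 : Y = 0.
  have := mulmx_ker Y; rewrite row_full_unit in full.
  by move/(congr1 (mulmx (invmx (kermx Y)))); rewrite mulKmx // mulmx0.
by apply/eqP; rewrite -subr_eq0 -trmx_eq0 -/Y Y0.
Qed.


(** * Reflections of weights and the relation in SL_2 *)

Let AdE := (AdxD, AdxN, AdxZ,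
  AdyD, AdyN, AdyZ,
  AdcD, AdcN, AdcZ).
Let AdsE := (Adx_h, Ady_h,
  Adx_e, Ady_e,
  Adx_f, Ady_f).

Lemma Ad_sm i X : Ad (sm i) (sm' i) X = Adx i (-1) (Ady i 1 (Adx i (-1) X)).
Proof. by rewrite /Adx /Ady !AdAd opprK /sm /sm' !mulmxA. Qed.

Lemma Ad_sm' i X : Ad (sm' i) (sm i) X = Adx i 1 (Ady i (-1) (Adx i 1 X)).
Proof. by rewrite /Adx /Ady !AdAd opprK /sm /sm' !mulmxA. Qed.

Lemma Ad_sm_h i k : Ad (sm i) (sm' i) (h k) = h k - (a k i)%:~R *: h i.
Proof.
rewrite Ad_sm. rewrite !(AdE, AdsE) !diagE.
move: (h k) (h i) (e i) (f i) => A B C D; by mxfield.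
Qed.

Lemma Ad_sm'_h i k : Ad (sm' i) (sm i) (h k) = h k - (a k i)%:~R *: h i.
Proof.
rewrite Ad_sm' !(AdE, AdsE) !diagE.
by move: (h k) (h i) (e i) (f i) => A B C D; mxfield.
Qed.

(** Conjugation by P acts on the Cartan subalgebra as s_i, so P carries weight
  spaces to weight spaces. *)
Lemma refl_intertwine i P P' b b' : P' *m P = 1%:M ->
  (forall k, Ad P P' (h k) = h k - (a k i)%:~R *: h i) ->
  P b b' != 0 -> wt b = s_ i (wt b').
Proof.
move=> P'P hP sb; rewrite -(reflK ha i (wt b)); congr (s_ i _).
apply/matrixP => u k; rewrite (ord1 u) {u} !mxE.
have : P *m h k = (h k - (a k i)%:~R *: h i) *m P.
  by rewrite -hP /Ad -(mulmxA _ P') P'P mulmx1.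
move/matrixP/(_ b b'); rewrite fm_hEr mulmxBl -scalemxAl [RHS]mxE [X in _ + X]mxE
  [X in - X]mxE !fm_hE => /eqP.
rewrite -subr_eq0 => E.
have : P b b' * ((wt b' 0 k) - (wt b 0 k - wt b 0 i * a k i))%:~R == 0.
  rewrite -(eqP E); apply/eqP.
  by rewrite !rmorphB !rmorphM /=; ring.
by rewrite mulf_eq0 (negPf sb) /= intr_eq0 subr_eq0 => /eqP <-.
Qed.

Lemma sm_wt i b b' : sm i b b' != 0 -> wt b = s_ i (wt b').
Proof. exact: (refl_intertwine (smV' i) (Ad_sm_h i)). Qed.

Lemma sm'_wt i b b' : sm' i b b' != 0 -> wt b = s_ i (wt b').
Proof. exact: (refl_intertwine (smV i) (Ad_sm'_h i)). Qed.

(** The representative of s_i is invertible, so it has a nonzero entry in the column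
  b; the row of that entry has the reflected weight. *)
Lemma weight_refl i mu : is_weight mu -> is_weight (s_ i mu).
Proof.
move=> [b <-]; have := smV' i => /matrixP/(_ b b); rewrite [RHS]mxE eqxx => E.
have /mulmx_neq0[b' [sb' sb]] : (sm' i *m sm i) b b != 0 by rewrite E oner_neq0.
by exists b'; apply: sm_wt.
Qed.

Definition weight_vec mu (v : 'cV[K]_d) := forall b, v b 0 != 0 -> wt b = mu.

Lemma weight_vec0 mu v : weight_vec mu v -> ~ is_weight mu -> v = 0.
Proof.
move=> hv nmu; apply/eqP; apply: contraT => /cV0Pn[b /hv wb].
by case: nmu; exists b.
Qed.

Lemma weight_vec_e mu v i : weight_vec mu v -> weight_vec (mu + root i) (e i *m v).
Proof. by move=> hv b /mulmx_neq0[b' [/e_wt -> /hv ->]]. Qed.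

Lemma weight_vec_f mu v i : weight_vec mu v -> weight_vec (mu - root i) (f i *m v).
Proof. by move=> hv b /mulmx_neq0[b' [/f_wt -> /hv ->]]. Qed.

Lemma weight_vecZ mu c v : weight_vec mu v -> weight_vec mu (c *: v).
Proof. by move=> hv b; rewrite mxE mulf_eq0 negb_or => /andP[_ /hv]. Qed.

Lemma weight_vec_hw : weight_vec Lam hw.
Proof. by move=> b; apply: hw_wt. Qed.

Lemma weight_vec_cm mu v i c : weight_vec mu v -> cm i c *m v = c ^ mu 0 i *: v.
Proof.
move=> hv; apply/colP => b; rewrite mul_diag_mx !mxE.
by case: (eqVneq (v b 0) 0) => [->|/hv ->]; rewrite ?mulr0.
Qed.

Lemma weight_vec_h mu v i : weight_vec mu v -> h i *m v = (mu 0 i)%:~R *: v.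
Proof.
move=> hv; apply/colP => b; rewrite fm_hE mxE.
by case: (eqVneq (v b 0) 0) => [->|/hv ->]; rewrite ?mulr0.
Qed.

Lemma fund_weightE i : Lam 0 i = (i == j0)%:Z.
Proof. by rewrite mxE eqxx /=; case: (i == j0). Qed.

Lemma f_hw_neq i : i != j0 -> f i *m hw = 0.
Proof.
move=> ij; apply: (weight_vec0 (weight_vec_f weight_vec_hw)) => /(@weight_refl i).
rewrite (_ : s_ i (Lam - root i) = Lam + root i); first exact: (not_weight_raise).
rewrite -[X in s_ i X]addrC -scaleN1r refl_lin (refl_root ha) /simple_refl fund_weightE (negPf ij).
by rewrite scale0r subr0 scaleN1r opprK addrC.
Qed.

(** The weight Lambda - 2 alpha would be reflected to Lambda + alpha. *)
Lemma f2_hw : f j0 *m (f j0 *m hw) = 0.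
Proof.
apply: (weight_vec0 (weight_vec_f (weight_vec_f weight_vec_hw))) => /(@weight_refl j0).
rewrite (_ : s_ j0 _ = Lam + root j0); first exact: (not_weight_raise).
apply/matrixP => u k; rewrite (ord1 u) !mxE !eqxx (cartan_diag ha). rewrite /= ; move: (_ %:R) => z; ring.
Qed.

Lemma xm_hw i s : xm i s *m hw = hw.
Proof.
rewrite /xm exp_vec1 //; first by apply: nilpZ; apply: nilp_e.
by rewrite -scalemxAl fm_hw_e scaler0.
Qed.

Lemma ym_hw_neq i t : i != j0 -> ym i t *m hw = hw.
Proof.
move=> ij; rewrite /ym exp_vec1 //; first by apply: nilpZ; apply: nilp_f.
by rewrite -scalemxAl f_hw_neq ?scaler0.
Qed.

Lemma ym_hw t : ym j0 t *m hw = hw + t *: (f j0 *m hw).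
Proof.
rewrite /ym exp_vec2; first by rewrite -scalemxAl.
- by apply: nilpZ; apply: nilp_f.
- by rewrite -!scalemxAl -scalemxAr f2_hw !scaler0.
Qed.

Lemma e_f_hw : e j0 *m (f j0 *m hw) = hw.
Proof.
have := bracket_ef j0; rewrite /mx_bracket => /(canRL (subrK _)) E.
rewrite mulmxA E mulmxDl -mulmxA fm_hw_e mulmx0 addr0 fm_hw_h fund_weightE eqxx.
by rewrite scale1r.
Qed.

Lemma xm_f_hw s : xm j0 s *m (f j0 *m hw) = f j0 *m hw + s *: hw.
Proof.
rewrite /xm exp_vec2; first by rewrite -scalemxAl e_f_hw.
- by apply: nilpZ; apply: nilp_e.
- by rewrite -!scalemxAl -scalemxAr e_f_hw fm_hw_e !scaler0.
Qed.

(** The SL_2 relation x(s) y(t) = y(t/q) q^h x(s/q), where q = 1 + s t. A module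
  over the i-th sl_2 need not be split into irreducible ones to prove it: the two
  sides act by conjugation in the same way on all Chevalley generators of the
  whole Lie algebra (a computation in strings of length at most 3) and agree on
  the highest weight vector, so they differ by an operator to which
  [commutant_hw] applies. *)
Section Relation.
Variables (i : 'I_n) (s t : K).
Let q := 1 + s * t.
Hypothesis q0 : q != 0.
Let p := t / q.
Let r := s / q.
Let A := xm i s *m ym i t.
Let A' := ym i (- t) *m xm i (- s).
Let B := ym i p *m cm i q *m xm i r.
Let B' := xm i (- r) *m cm i q^-1 *m ym i (- p).

Let AA' : A' *m A = 1%:M.
Proof. by rewrite /A /A' mulmxA -(mulmxA _ _ (xm i s)) (xmN') mulmx1 (ymN'). Qed.

Let BB' : B' *m B = 1%:M.
Proof.
rewrite /B /B' !mulmxA -(mulmxA _ _ (ym i p)) (ymN') mulmx1.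
by rewrite -(mulmxA _ _ (cm i q)) cmV' // mulmx1 (xmN').
Qed.

Let AdA X : Ad A A' X = Adx i s (Ady i t X).
Proof. by rewrite /Adx /Ady AdAd. Qed.

Let AdB X : Ad B B' X = Ady i p (Adc i q (Adx i r X)).
Proof. by rewrite /Adx /Ady /Adc !AdAd mulmxA. Qed.

Let Ad_e k : Ad A A' (e k) = Ad B B' (e k).
Proof.
have qq : 1 + s * t != 0 := q0.
rewrite AdA AdB; have [<-|ik] := eqVneq i k.
  rewrite !(AdE, AdsE) (Adc_e _ _ q0) !(AdE, AdsE) !diagE (cartan_diag ha).
  rewrite -exprnP; move: (h i) (e i) (f i) => X Y Z.
  by rewrite /p /r /q; mxfield.
rewrite (Ady_ej _ ik) !(Adx_ej _ ik) !AdE.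
rewrite (Adc_e _ _ q0) (Adc_e1 _ _ q0) (Adc_e2 _ _ q0).
rewrite !AdE (Ady_ej _ ik) (Ady_e1 _ ik) (Ady_e2 _ ik).
move: (e1 _ _) (e2 _ _) (serre_strings ik) => X Y.
case=> [[-> -> _ -> _]|[-> -> _]|[-> _ _]]; rewrite ?mulrNz ?addr0 ?scaler0 ?addr0.
- by rewrite expr0z; mxfield.
- rewrite (_ : 2 + -1 = 1 :> int) // expr1z -invr_expz expr1z /p /r /q.
  by mxfield.
  rewrite subrr expr0z -invr_expz -!exprnP -!pmulrn /p /r /q.
  by mxfield.
Qed.

Let Ad_f k : Ad A A' (f k) = Ad B B' (f k).
Proof.
have qq : 1 + s * t != 0 := q0.
rewrite AdA AdB; have [<-|ik] := eqVneq i k.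
  rewrite !(AdE, AdsE) (Adc_e _ _ q0) (Adc_f _ _ q0) (Adc_h _ _ q0).
  rewrite !(AdE, AdsE) !diagE (cartan_diag ha).
  rewrite -invr_expz -exprnP; move: (h i) (e i) (f i) => X Y Z.
  by rewrite /p /r /q; mxfield.
rewrite (Adx_fj _ ik) !(Ady_fj _ ik) !AdE (Adx_fj _ ik).
rewrite (Adx_f1 _ ik) (Adx_f2 _ ik) (Adc_f _ _ q0) !AdE (Ady_fj _ ik).
move: (f1 _ _) (f2 _ _) (serre_strings ik) => X Y.
case=> [[-> _ -> _ ->]|[-> _ ->]|[-> _ _]]; rewrite ?mulrNz ?addr0 ?scaler0 ?addr0.
- by rewrite oppr0 expr0z; mxfield.
- rewrite opprK expr1z /p /r /q; by mxfield.
- rewrite opprK -!exprnP -!pmulrn /p /r /q; by mxfield.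
Qed.

Lemma sl2_relation : xm i s *m ym i t = ym i p *m cm i q *m xm i r.
Proof.
have comm X := @Ad_eq_comm _ _ A A' B B' X AA' BB'.
have Ahw : A *m hw = B *m hw.
  rewrite /A /B -!mulmxA xm_hw (weight_vec_cm _ _ weight_vec_hw) -scalemxAr fund_weightE.
  case: eqVneq => [->|ij]; last by rewrite !ym_hw_neq // xm_hw expr0z scale1r.
  rewrite expr1z !ym_hw mulmxDr xm_hw -scalemxAr xm_f_hw /p.
  rewrite !scalerDr !scalerA addrCA addrC [q * _]mulrC divfK //; congr (_ + _).
  by rewrite -[X in X + _]scale1r -scalerDl /q mulrC.
have Z1 : B' *m A = 1%:M.
  apply: commutant_hw => [k|k|]; [exact/comm/Ad_e | exact/comm/Ad_f |].
  by rewrite -mulmxA Ahw mulmxA BB' mul1mx.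
have : A = B *m (B' *m A) by rewrite mulmxA (mulmx1C BB') mul1mx.
by rewrite Z1 mulmx1.
Qed.

End Relation.

(** * Commutation relations between the generators *)

Lemma Ad_exp (P P' X : 'M[K]_d) s : P *m P' = 1%:M -> P' *m P = 1%:M ->
  P *m nilp_exp (s *: X) *m P' = nilp_exp (s *: Ad P P' X).
Proof. by move=> PP' P'P; rewrite conj_exp // -scalemxAr -scalemxAl. Qed.

Lemma Adc_exp k c X s : c != 0 ->
  cm k c *m nilp_exp (s *: X) = nilp_exp (s *: Adc k c X) *m cm k c.
Proof.
move=> c0; rewrite /Adc -(Ad_exp _ _ (cmV k c0) (cmV' k c0)).
by rewrite -(mulmxA _ (cm k c^-1)) cmV' // mulmx1.
Qed.

Lemma Adx_exp i t X s :
  xm i t *m nilp_exp (s *: X) *m xm i (- t) = nilp_exp (s *: Adx i t X).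
Proof. exact: (Ad_exp _ _ (xmN i t) (xmN' i t)). Qed.

Lemma Ady_exp i t X s :
  ym i t *m nilp_exp (s *: X) *m ym i (- t) = nilp_exp (s *: Ady i t X).
Proof. exact: (Ad_exp _ _ (ymN i t) (ymN' i t)). Qed.

Lemma cm_xm k i c t : c != 0 -> cm k c *m xm i t = xm i (c ^ a k i * t) *m cm k c.
Proof. by move=> c0; rewrite /xm Adc_exp // (Adc_e _ _ c0) scalerA mulrC. Qed.

Lemma cm_ym k i c t : c != 0 -> cm k c *m ym i t = ym i (c ^ (- a k i) * t) *m cm k c.
Proof. by move=> c0; rewrite /ym Adc_exp // (Adc_f _ _ c0) scalerA mulrC. Qed.

Lemma xm_ym_comm i k s t : i != k -> xm i s *m ym k t = ym k t *m xm i s.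
Proof.
move=> ik; rewrite /xm /ym; apply/esym/comm_exp/esym; apply: comm_exp.
by rewrite -!scalemxAl -!scalemxAr (bracket0_comm (bracket_ef_neq ik)) scalerA mulrC -scalerA.
Qed.

Definition Ym i c := ym i c^-1 *m cm i c.

(** In SL_2: x(s) y(1/c) c^h = y(1/(c+s)) (c+s)^h x(s/(c(c+s))). *)
Lemma xm_Ym_same i s c : c != 0 -> c + s != 0 ->
  xm i s *m Ym i c = Ym i (c + s) *m xm i (s / (c * (c + s))).
Proof.
move=> c0 cs0.
have q0 : 1 + s * c^-1 != 0.
  have -> : 1 + s * c^-1 = (c + s) / c by field.
  by rewrite mulf_neq0 ?invr_eq0.
rewrite /Ym mulmxA (sl2_relation i q0) -[LHS]mulmxA.
pose r := s / (1 + s * c^-1); rewrite -/r.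
have -> : xm i r *m cm i c = cm i c *m xm i (s / (c * (c + s))).
  rewrite cm_xm // (cartan_diag ha) -exprnP; congr (xm _ _ *m _).
  by rewrite /r; field; rewrite ?q0 ?c0 ?cs0.
rewrite !mulmxA -(mulmxA (ym i _)) cmD //; congr (ym i _ *m cm i _ *m _).
  by field; rewrite ?q0 ?c0 ?cs0.
by field.
Qed.

Lemma xm_Ym_neq i k s c : c != 0 -> i != k ->
  xm i s *m Ym k c = Ym k c *m xm i (c ^ (- a k i) * s).
Proof.
move=> c0 ik; rewrite /Ym mulmxA xm_ym_comm // -!(mulmxA (ym k _)); congr (_ *m _).
by rewrite cm_xm // mulrA -expfzDr // subrr expr0z mul1r.
Qed.

Lemma Ad_sm'_f i : Ad (sm' i) (sm i) (f i) = - e i.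
Proof. by rewrite Ad_sm' !(AdE, AdsE) !diagE; move: (h i) (e i) (f i) => X Y Z; mxfield. Qed.

Lemma Ad_sm'_e i : Ad (sm' i) (sm i) (e i) = - f i.
Proof. by rewrite Ad_sm' !(AdE, AdsE) !diagE; move: (h i) (e i) (f i) => X Y Z; mxfield. Qed.

Lemma Ad_sm'_fk i k : i != k ->
  Ad (sm' i) (sm i) (f k) = (-1) ^+ `|a i k|%N *: Ad (sm i) (sm' i) (f k).
Proof.
move=> ik; rewrite Ad_sm' Ad_sm !(Adx_fj _ ik) !(Ady_fj _ ik) !AdE.
rewrite !(Adx_fj _ ik) !(Adx_f1 _ ik) !(Adx_f2 _ ik).
move: (f1 _ _) (f2 _ _) (serre_strings ik) => X Y.
by case=> [[-> _ -> _ ->]|[-> _ ->]|[-> _ _]]; rewrite /= -?pmulrn ?mulrNz; mxfield.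
Qed.

(** As e_i kills f_k, the line of f_k is fixed by a Borel subgroup of the i-th SL_2,
  and its orbit consists of the lines of y_i(u) f_k and of one more, that of
  s_i f_k. For t <> 0 the point x_i(t) s_i^-1 f_k is of the first kind, with u = 1/t. *)
Lemma Adx_sm'_fk i k t : i != k -> t != 0 ->
  Adx i t (Ad (sm' i) (sm i) (f k)) = (- t) ^+ `|a i k|%N *: Ady i t^-1 (f k).
Proof.
move=> ik t0; rewrite Ad_sm' !(Adx_fj _ ik) !(Ady_fj _ ik) !AdE.
rewrite !(Adx_fj _ ik) !(Adx_f1 _ ik) !(Adx_f2 _ ik) !AdE.
rewrite !(Adx_fj _ ik) !(Adx_f1 _ ik) !(Adx_f2 _ ik).
move: (f1 _ _) (f2 _ _) (serre_strings ik) => X Y.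
by case=> [[-> _ -> _ ->]|[-> _ ->]|[-> _ _]]; rewrite /= -?pmulrn ?mulrNz; mxfield.
Qed.

Lemma sm'_ym_sm i t : sm' i *m ym i t *m sm i = xm i (- t).
Proof.
by rewrite /ym (Ad_exp _ _ (smV' i) (smV i)) Ad_sm'_f scalerN -scaleNr.
Qed.

Lemma sm'_ymk_sm i k b : i != k ->
  sm' i *m ym k b *m sm i = sm i *m ym k (b * (-1) ^+ `|a i k|%N) *m sm' i.
Proof.
move=> ik; rewrite /ym (Ad_exp _ _ (smV' i) (smV i)).
by rewrite (Ad_exp _ _ (smV i) (smV' i)) Ad_sm'_fk // scalerA.
Qed.

(** Hence y_i(-t) y_k(b) y_i(t) lies in s_i U^- s_i^-1, without computing
  commutators in rank two. *)
Lemma sm'_conj_ymk i k b t : i != k -> t != 0 ->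
  sm' i *m (ym i (- t) *m ym k b *m ym i t) *m sm i =
  ym i t^-1 *m ym k (b * (- t) ^+ `|a i k|%N) *m ym i (- t^-1).
Proof.
move=> ik t0.
rewrite -/(Ad (sm' i) (sm i) _) !(AdM _ _ (smV i)) /Ad !sm'_ym_sm opprK.
rewrite {1 2}/ym (Ad_exp _ _ (smV' i) (smV i)) Adx_exp Adx_sm'_fk //.
by rewrite Ady_exp scalerA.
Qed.

(** * Products of the Y_i *)

Definition Yprod (ii : nat -> 'I_n) (c : nat -> K) p : 'M[K]_d :=
  \big[mulmx/1%:M]_(k < p) Ym (ii k) (c k).

(** The heart of the matter: x_i(tau) moves to the right through a product of Y's
  one letter at a time, by [xm_Ym_same] and [xm_Ym_neq], and the denominators
  telescope into the sums of the S_m. *)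
Lemma xm_Yprod i ii tau c p :
  (forall k, (k < p)%N -> c k != 0) ->
  (forall k, (k <= p)%N -> 1 + tau * S_sum a i ii c k != 0) ->
  xm i tau *m Yprod ii c p = Yprod ii (shift_coord a i ii tau c) p
    *m xm i (tau / root_val a i ii c p / (1 + tau * S_sum a i ii c p)).
Proof.
elim: p => [|p IH] hc hT.
  rewrite /Yprod !big_ord0 mulmx1 mul1mx; congr (xm _ _).
  by rewrite /root_val big_ord0 S_sum0 mulr0 addr0 !divr1.
rewrite /Yprod !big_ord_recr /= mulmxA -/(Yprod ii c p) IH; first last.
- by move=> k kp; apply: hT; apply: leqW.
- by move=> k kp; apply: hc; apply: leqW.
rewrite -mulmxA -[RHS]mulmxA; congr (_ *m _).
have cp := hc p (ltnSn p); have Tp := hT p (leqnSn p); have Tp' := hT p.+1 (leqnn _).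
have Rp : root_val a i ii c p != 0 by apply: root_val_neq0 => l lp; apply/hc/leqW.
rewrite root_valS /shift_coord; move: Tp'; rewrite S_sumS; case: (eqVneq (ii p) i) => [ip|ip] Tp'.
  rewrite ip; set T := 1 + tau * S_sum a i ii c p in Tp *.
  set T' := 1 + tau * _ in Tp' *; set P := root_val _ _ _ _ _ in Rp T' Tp' *.
  have eT : T' = T + tau / (P * c p) by rewrite /T' /T mulrDr addrA.
  have e1 : c p + tau / P / T = c p * (T' / T).
    by rewrite eT; field; rewrite ?cp ?Rp ?Tp.
  rewrite (xm_Ym_same) //; last by rewrite e1 !mulf_neq0 ?invr_eq0.
  rewrite e1 (cartan_diag ha) -exprnP; congr (_ *m xm _ _).
  by field; rewrite ?cp ?Rp ?Tp ?Tp'.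
rewrite addr0 divff // mulr1 xm_Ym_neq //; last by rewrite eq_sym.
congr (_ *m xm _ _); rewrite -invr_expz.
by field; rewrite Rp Tp expfz_neq0.
Qed.

Section String.
Variables (i : 'I_n) (mu : 'rV[int]_n) (v : 'cV[K]_d) (m : nat).
Hypothesis v_wt : weight_vec mu v.
Hypothesis mu_i : mu 0 i = m%:Z.
Hypothesis ev : e i *m v = 0.
Hypothesis fv : (f i ^+ m.+1) *m v = 0.

Let F k := dpow k (f i) *m v.

Let F_wt k : weight_vec (mu - k%:Z *: root i) (F k).
Proof.
rewrite /F /dpow -scalemxAl; apply: weight_vecZ.
elim: k => [|k IH]; first by rewrite expr0 mul1mx scale0r subr0.
rewrite exprS -mulmxE -mulmxA (_ : mu - _ = mu - k%:Z *: root i - root i).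
  exact: weight_vec_f.
rewrite -addrA -opprD; congr (_ - _); rewrite -[X in _ = _ + X]scale1r -scalerDl; congr (_ *: _); lia.
Qed.

Let fF k : f i *m F k = k.+1%:R *: F k.+1.
Proof. by rewrite /F mulmxA dpowS -scalemxAl. Qed.

Let hF k : h i *m F k = (m%:R - 2 * k%:R) *: F k.
Proof.
rewrite (weight_vec_h _ (@F_wt k)); congr (_ *: _).
rewrite !mxE mu_i (cartan_diag ha) rmorphB rmorphM /=; ring.
Qed.

Let eF k : e i *m F k.+1 = (m%:R - k%:R) *: F k.
Proof.
have ef (X : 'cV[K]_d) : e i *m (f i *m X) = f i *m (e i *m X) + h i *m X.
  by rewrite -(bracket_ef i) /mx_bracket mulmxBl !mulmxA addrC subrK.
have step q : q.+1%:R *: (e i *m F q.+1) = f i *m (e i *m F q) + (m%:R - 2 * q%:R) *: F q.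
  by rewrite scalemxAr -fF ef hF.
elim: k => [|k IH].
  have := step 0%N; rewrite scale1r => ->.
  by rewrite {1}/F dpow0 mul1mx ev mulmx0 add0r mulr0.
apply: (@scalerI _ _ (k.+2%:R : K)); first by rewrite natS_neq0.
rewrite step IH -scalemxAr fF scalerA -scalerDl scalerA; congr (_ *: _).
by rewrite -![k.+2%:R]natr1 -![k.+1%:R]natr1; ring.
Qed.

Let eFm r : (r <= m)%N -> dpow r (e i) *m F m = F (m - r).
Proof.
elim: r => [|r IH] rm; first by rewrite dpow0 mul1mx subn0.
apply: (@scalerI _ _ (r.+1%:R : K)); first by rewrite natS_neq0.
rewrite scalemxAl -dpowS -mulmxA IH; last exact: ltnW.
rewrite -(subnSK rm) eF; congr (_ *: _).
by rewrite -natrB ?leq_subr // subKn.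
Qed.

Let eFm0 r : (m < r)%N -> dpow r (e i) *m F m = 0.
Proof.
elim: r => // r IH; rewrite ltnS leq_eqVlt => /orP[/eqP <-|/IH h0].
  apply: (@scalerI _ _ (m.+1%:R : K)); first by rewrite natS_neq0.
  rewrite scalemxAl -dpowS -mulmxA eFm // subnn scaler0.
  by rewrite /F dpow0 mul1mx ev.
apply: (@scalerI _ _ (r.+1%:R : K)); first by rewrite natS_neq0.
by rewrite scalemxAl -dpowS -mulmxA h0 mulmx0 scaler0.
Qed.

Let F0 l : (m < l)%N -> F l = 0.
Proof.
move=> ml; rewrite /F /dpow -scalemxAl -(subnK ml) exprD -mulmxE -mulmxA fv.
by rewrite mulmx0 scaler0.
Qed.

(** With F k = f_i^(k) v one has e_i^(r) F m = F (m - r), and F (m - r) has weight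
  2 r - m for h_i. So c^h x_i(1/c) turns the lowest vector of the string into
  sum_l c^-l F l, which is y_i(1/c) v. *)
Lemma string_swap c : c != 0 -> cm i c *m (xm i c^-1 *m F m) = ym i c^-1 *m v.
Proof.
move=> c0; pose N := maxn d m.+1.
have trunc (G : nat -> 'cV[K]_d) : (forall l, (m < l)%N -> G l = 0) ->
    \sum_(l < N) G l = \sum_(l < m.+1) G l.
  move=> G0; rewrite (big_ord_widen N G (leq_maxr d m.+1)).
  rewrite [LHS](bigID (fun l : 'I_N => (l < m.+1)%N)) /= [X in _ + X]big1 ?addr0 //.
  by move=> l; rewrite -leqNgt => /G0.
rewrite /xm /ym !(@nilp_expE _ _ _ N) ?leq_maxl //; first last.
- by apply: nilpZ; apply: nilp_e.
- by apply: nilpZ; apply: nilp_f.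
rewrite !mulmx_suml (trunc (fun l => dpow l (c^-1 *: e i) *m F m)); last first.
  by move=> l ml; rewrite dpowZ -scalemxAl eFm0 ?scaler0.
rewrite (trunc (fun l => dpow l (c^-1 *: f i) *m v)); last first.
  by move=> l ml; rewrite dpowZ -scalemxAl -/(F l) F0 ?scaler0.
rewrite mulmx_sumr (reindex_inj rev_ord_inj) /=; apply: eq_bigr => l _.
have lm : (l <= m)%N by rewrite -ltnS.
rewrite !dpowZ -!(scalemxAl (_ ^+ _)) subSS eFm ?leq_subr // subKn // -/(F l) -scalemxAr.
rewrite (weight_vec_cm _ _ (@F_wt l)) scalerA; congr (_ *: _).
rewrite !mxE mu_i (cartan_diag ha).
have -> : m%:Z - l%:Z * 2 = (m - l)%N%:Z + - l%:Z by rewrite -subzn //; ring.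
rewrite expfzDr // -invr_expz -!exprnP exprVn exprVn mulrA mulVf ?mul1r //.
by rewrite expf_neq0.
Qed.

End String.

Local Notation "<| u , v |>" := (fm_pairing (M := M) u v).

Lemma pairing_xm i s u v : <| xm i s *m u, v |> = <| u, ym i s *m v |>.
Proof.
rewrite /fm_pairing trmx_mul -!mulmxA; congr ((_ *m _) 0 0).
rewrite mulmxA (@exp_contravariant _ _ _ _ (s *: f i)) ?mulmxA //.
by rewrite linearZ /= -scalemxAl -scalemxAr fm_form_e.
Qed.

Lemma pairing_ym i s u v : <| ym i s *m u, v |> = <| u, xm i s *m v |>.
Proof.
rewrite /fm_pairing trmx_mul -!mulmxA; congr ((_ *m _) 0 0).
rewrite mulmxA (@exp_contravariant _ _ _ _ (s *: e i)) ?mulmxA //.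
by rewrite linearZ /= -scalemxAl -scalemxAr fm_form_f.
Qed.

(** The form is invariant under the Cartan subalgebra, so distinct weight spaces are
  orthogonal. *)
Lemma form_wt b b' : fm_form M b b' != 0 -> wt b = wt b'.
Proof.
move=> Gb; apply/rowP => i; have := fm_form_h M i => /matrixP/(_ b b').
rewrite tr_diag_mx fm_hE fm_hEr => /eqP; rewrite mulrC => /eqP /(mulfI Gb).
by move/eqP; rewrite eqr_int => /eqP.
Qed.

Lemma pairing_cm i c u v : <| cm i c *m u, v |> = <| u, cm i c *m v |>.
Proof.
rewrite /fm_pairing trmx_mul -!mulmxA; congr ((_ *m _) 0 0).
rewrite !mulmxA; congr (_ *m _); rewrite tr_diag_mx; apply/matrixP => b b'.
rewrite mul_diag_mx mul_mx_diag !mxE.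
by case: (eqVneq (fm_form M b b') 0) => [->|/form_wt ->]; rewrite ?mulr0 ?mul0r // mulrC.
Qed.

(** * Unipotent and torus parts *)

Definition yprod (ii : nat -> 'I_n) (t : nat -> K) p : 'M[K]_d :=
  \big[mulmx/1%:M]_(k < p) ym (ii k) (t k).
Definition tprod (ii : nat -> 'I_n) (c : nat -> K) p : 'M[K]_d :=
  \big[mulmx/1%:M]_(k < p) cm (ii k) (c k).
Definition Phi_nat (ii : nat -> 'I_n) (c : nat -> K) k := S_nat a (ii k) ii c k.

(** Moving the torus to the right rescales the arguments of the y_i; this is where
  the monomials of the isomorphism come from, in [Yprod_split]. *)
Lemma tprod_ym ii c p i t : (forall k, (k < p)%N -> c k != 0) ->
  tprod ii c p *m ym i t = ym i ((root_val a i ii c p)^-1 * t) *m tprod ii c p.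
Proof.
elim: p t => [|p IH] t hc.
  by rewrite /tprod /root_val !big_ord0 mul1mx mulmx1 invr1 mul1r.
have hc' k : (k < p)%N -> c k != 0 by move=> kp; apply/hc/leqW.
rewrite /tprod big_ord_recr /= -/(tprod ii c p) -mulmxA cm_ym ?hc // !mulmxA IH //.
by rewrite root_valS invfM mulrA invr_expz.
Qed.

Lemma Yprod_split ii c p : (forall k, (k < p)%N -> c k != 0) ->
  Yprod ii c p = yprod ii (Phi_nat ii c) p *m tprod ii c p.
Proof.
elim: p => [|p IH] hc; first by rewrite /Yprod /yprod /tprod !big_ord0 mulmx1.
have hc' k : (k < p)%N -> c k != 0 by move=> kp; apply/hc/leqW.
rewrite /Yprod /yprod /tprod !big_ord_recr /= -/(Yprod ii c p) -/(tprod ii c p).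
rewrite -/(yprod ii (Phi_nat ii c) p) IH // /Ym.
rewrite -!(mulmxA (yprod _ _ _)); congr (_ *m _).
by rewrite !mulmxA tprod_ym // /Phi_nat /S_nat invfM.
Qed.

Lemma tprod_diag ii c p : tprod ii c p = diag_mx (\row_b \prod_(k < p) c k ^ wt b 0 (ii k)).
Proof.
elim: p => [|p IH].
  rewrite /tprod big_ord0; apply/matrixP => b b'; rewrite !mxE big_ord0.
  by case: eqP.
rewrite /tprod big_ord_recr /= -/(tprod ii c p) IH mulmx_diag.
by congr diag_mx; apply/rowP => b; rewrite !mxE big_ord_recr.
Qed.

Lemma tprod_hw ii c p : tprod ii c p *m hw = (\prod_(k < p | ii k == j0) c k) *: hw.
Proof.
elim: p => [|p IH]; first by rewrite /tprod !big_ord0 mul1mx scale1r.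
rewrite /tprod big_ord_recr /= -/(tprod ii c p) -mulmxA.
rewrite (weight_vec_cm _ _ (weight_vec_hw)) -scalemxAr IH scalerA.
rewrite [in RHS]big_mkcond big_ord_recr /= -big_mkcond /= fund_weightE mulrC; congr (_ * _ *: _).
by case: eqVneq; rewrite ?expr1z ?expr0z.
Qed.

Lemma xm_upper i t : lower_uni gup (xm i t).
Proof. by apply: lower_uni_exp; apply: strictly_lowersZ; apply: e_raises. Qed.

Lemma pairing_lower (v : 'cV[K]_d) : (forall b, v b 0 != 0 -> height del (wt b) < height del Lam) ->
  <| v, hw |> = 0.
Proof.
move=> hv; apply/eqP; apply: contraT => /mulmx_neq0[b' [/mulmx_neq0[b []]]].
rewrite mxE => /hv h1 /form_wt e1 /hw_wt e2.
by move: h1; rewrite e1 e2 ltxx.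
Qed.

Lemma pairingDl u v w : <| u + v, w |> = <| u, w |> + <| v, w |>.
Proof. by rewrite /fm_pairing linearD /= !mulmxDl mxE. Qed.

Lemma pairingZl s u w : <| s *: u, w |> = s * <| u, w |>.
Proof. by rewrite /fm_pairing linearZ /= -!scalemxAl mxE. Qed.

Lemma pairing_hw_uni g : lower_uni gdn g -> <| g *m hw, hw |> = 1.
Proof.
move=> hg; have -> : g *m hw = (g - 1%:M) *m hw + hw by rewrite mulmxBl mul1mx subrK.
rewrite pairingDl pairing_lower ?add0r; first by rewrite /fm_pairing fm_form_hw.
by move=> b /mulmx_neq0[b' [/hg + /hw_wt <-]].
Qed.

Lemma pairing_f i u v : <| f i *m u, v |> = <| u, e i *m v |>.
Proof. by rewrite /fm_pairing trmx_mul -!mulmxA (mulmxA _^T (fm_form M)) fm_form_f !mulmxA. Qed.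

Lemma pairing_h i u v : <| h i *m u, v |> = <| u, h i *m v |>.
Proof. by rewrite /fm_pairing trmx_mul -!mulmxA (mulmxA _^T (fm_form M)) fm_form_h !mulmxA. Qed.

Lemma pairing0r u : <| u, 0 |> = 0.
Proof. by rewrite /fm_pairing mulmx0 mxE. Qed.

(** The matrix coefficient of g from the weight Lambda to the weight
  Lambda - alpha_{j0}. On U^- it is the coordinate along U_{-alpha_{j0}}. *)
Definition simple_coord (g : 'M[K]_d) : K := <| e j0 *m (g *m hw), hw |>.

Lemma simple_coord_ym s g : lower_uni gdn g ->
  simple_coord (ym j0 s *m g) = s + simple_coord g.
Proof.
move=> hg; rewrite /simple_coord -mulmxA (mulmxA (e j0)).
have -> : e j0 *m ym j0 s = ym j0 s *m (e j0 + s *: h j0 - s ^+ 2 *: f j0).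
  have -> : e j0 + s *: h j0 - s ^+ 2 *: f j0 = Ady j0 (- s) (e j0).
    by rewrite (Ady_e) sqrrN scaleNr opprK.
  by rewrite /Ady /Ad opprK !mulmxA (ymN) mul1mx.
rewrite -mulmxA pairing_ym (xm_hw) !mulmxDl mulNmx -!scalemxAl -scaleNr !pairingDl !pairingZl.
rewrite pairing_f fm_hw_e pairing0r mulr0 addr0 pairing_h fm_hw_h fund_weightE eqxx scale1r.
by rewrite pairing_hw_uni // mulr1 addrC.
Qed.

(** Transporting s_i to the two sides of the pairing replaces hw by f hw and e by f,
  and leaves the coefficient of a lower unipotent matrix from the weight
  Lambda - alpha to the weight Lambda, which is 0. *)
Lemma simple_coord_reflected g : lower_uni gdn g ->
  simple_coord (sm j0 *m g *m sm' j0) = 0.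
Proof.
move=> hg; rewrite /simple_coord -(mulmxA _ (sm' j0)) -(mulmxA _ g) (mulmxA (e j0)).
have -> : e j0 *m sm j0 = - (sm j0 *m f j0).
  by rewrite (Ad_move (smV j0) (Ad_sm'_e j0)) mulmxN.
have ymhw t : ym j0 t *m hw = hw + t *: (f j0 *m hw) := ym_hw t.
have xfhw t : xm j0 t *m (f j0 *m hw) = f j0 *m hw + t *: hw := xm_f_hw t.
have yfhw t : ym j0 t *m (f j0 *m hw) = f j0 *m hw.
  rewrite /ym exp_vec1 //; first by apply: nilpZ; apply: nilp_f.
  by rewrite -scalemxAl (f2_hw) scaler0.
have -> : sm' j0 *m hw = - (f j0 *m hw).
  rewrite /sm' -!mulmxA (xm_hw) ymhw mulmxDr (xm_hw) -scalemxAr xfhw.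
  by rewrite !scaleN1r scale1r opprD addrCA subrr addr0.
rewrite mulNmx !mulmxN opprK -mulmxA.
have smhw w : <| sm j0 *m w, hw |> = - <| w, f j0 *m hw |>.
  rewrite /sm -!mulmxA pairing_xm pairing_ym pairing_xm ymhw mulmxDr (xm_hw) -scalemxAr xfhw.
  rewrite !scaleN1r scale1r opprD addrCA subrr addr0 mulmxN yfhw.
  by rewrite /fm_pairing mulmxN mxE.
rewrite smhw pairing_f e_f_hw pairing_lower ?oppr0 // => b.
have fhw b' : (f j0 *m hw) b' 0 != 0 -> height del (wt b') < height del Lam.
  by case/mulmx_neq0 => c [/(f_lowers) + /hw_wt <-].
have -> : g *m (f j0 *m hw) = (g - 1%:M) *m (f j0 *m hw) + f j0 *m hw.
  by rewrite mulmxBl mul1mx subrK.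
rewrite mxE; case: (eqVneq ((f j0 *m hw) b 0) 0) => [->|/fhw //].
by rewrite addr0 => /mulmx_neq0[c [/hg + /fhw]]; apply: lt_trans.
Qed.

End Module.

(** * Extremal vectors and the lowest weight coefficient *)

Section Extremal.
Variables (K : numFieldType) (n : nat) (a : 'M[int]_n) (del : 'I_n -> int).
Hypothesis ha : finite_cartan a del.
Variable M : forall j : 'I_n, fundamental_module K a j.
Local Notation W := (weyl_act a).
Local Notation "<| u , v |>" := (fm_pairing u v).

Let Wt j mu := is_weight (M j) mu.
Let Wt_fund j : Wt j (fund_weight j) := is_weight_Lam (M j).
Let Wt_refl j i mu : Wt j mu -> Wt j (simple_refl a i mu) := @weight_refl _ _ _ _ ha _ (M j) i mu.
Let Wt_le j mu : Wt j mu -> positive_weight a (fund_weight j - mu) := @weight_le _ _ _ _ ha _ (M j) mu.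

Lemma letter_mem i w : reduced_longest_word a w -> i \in w.
Proof. exact: (longest_mem ha Wt_fund Wt_refl Wt_le). Qed.

Variable j : 'I_n.
Local Notation E := (extremal_vector (M j)).
Local Notation hw := (fm_hw (M j)).

Lemma extremal_dpow i w : E (i :: w) =
  dpow `|W w (fund_weight j) 0%R i| (fm_f (M j) i) *m E w.
Proof. by rewrite /dpow -scalemxAl. Qed.

Lemma extremal_wt w : reduced_word a w -> weight_vec (W w (fund_weight j)) (E w).
Proof.
elim: w => [_|i w IH red]; first exact: weight_vec_hw.
have {}IH := IH (reduced_suffix red).
have m0 := extremal_ge0 ha Wt_fund Wt_refl Wt_le j red.
rewrite extremal_dpow /dpow -scalemxAl; apply: weight_vecZ.
rewrite /= /simple_refl -{1}[W w _ 0 i](gez0_abs m0).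
elim: (absz _) => [|k IHk]; first by rewrite expr0 mul1mx scale0r subr0.
rewrite exprS -mulmxE -mulmxA.
have -> : W w (fund_weight j) - k.+1%:Z *: simple_root a i =
          W w (fund_weight j) - k%:Z *: simple_root a i - simple_root a i.
  rewrite -addrA -opprD; congr (_ - _); rewrite -[X in _ = _ + X]scale1r -scalerDl.
  by congr (_ *: _); lia.
exact: weight_vec_f.
Qed.

(** Contravariance moves Y_i(c) onto the extremal vector, where [string_swap] applies
  and gives y_i(1/c) times the previous extremal vector; this y_i moves back as
  x_i. *)
Lemma pairing_Ym i w c z : c != 0 -> reduced_word a (i :: w) ->
  <| Ym (M j) i c *m z, E (i :: w) |> = <| xm (M j) i c^-1 *m z, E w |>.
Proof.
move=> c0 red.
have m0 := extremal_ge0 ha Wt_fund Wt_refl Wt_le j red.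
have nW := extremal_not_Wt ha Wt_fund Wt_refl Wt_le (j := j) red.
have vw := extremal_wt (reduced_suffix red).
set mu := W w (fund_weight j) in m0 nW vw.
have muE : mu 0 i = `|mu 0%R i|%N%:Z by rewrite gez0_abs.
have ev : fm_e (M j) i *m E w = 0 by apply: weight_vec0 nW; apply: weight_vec_e.
have fv : (fm_f (M j) i ^+ `|mu 0%R i|.+1) *m E w = 0.
  have fw k : weight_vec (mu - k%:Z *: simple_root a i) (fm_f (M j) i ^+ k *m E w).
    elim: k => [|k IHk]; first by rewrite expr0 mul1mx scale0r subr0.
    rewrite exprS -mulmxE -mulmxA.
    have -> : mu - k.+1%:Z *: simple_root a i = mu - k%:Z *: simple_root a i - simple_root a i.
      rewrite -addrA -opprD; congr (_ - _); rewrite -[X in _ = _ + X]scale1r -scalerDl.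
      by congr (_ *: _); lia.
    exact: weight_vec_f.
  apply: weight_vec0 (fw _) _ => /(Wt_refl i); congr (~ Wt j _): nW.
  apply/rowP => k; rewrite !mxE (cartan_diag ha).
  by move: muE; move: (absz _) => m ->; rewrite intS; ring.
rewrite extremal_dpow -/mu /Ym -mulmxA (pairing_ym (M := M j)) pairing_cm.
by rewrite (string_swap ha vw muE ev fv c0) -(pairing_xm (M := M j)).
Qed.

(** Y_i(c) lies in U s_i U, so a product of Y's along a reduced word lies in U w U,
  where this coefficient is 1. In terms of vectors: after [pairing_Ym], the factor
  x_i(s) passes through the remaining letters and fixes hw, so that induction
  applies for all s outside a finite set; the pairing is polynomial in s, hence
  constant, and may be evaluated at s = 1/c. *)
Lemma lowest_pairing_word i0 w c : reduced_word a w ->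
  (forall k, (k < size w)%N -> c k != 0) ->
  <| Yprod (M j) (nth i0 w) c (size w) *m hw, E w |> = 1.
Proof.
elim: w c => [|i w IH] c red hc.
  by rewrite /Yprod big_ord0 mul1mx /fm_pairing fm_form_hw.
rewrite /Yprod big_ord_recl -mulmxA /= pairing_Ym //; last exact: hc.
pose c' k := c k.+1.
have hc' k : (k < size w)%N -> c' k != 0 by move=> kw; apply: hc.
rewrite -/(Yprod (M j) (nth i0 w) c' (size w)); set z := _ *m hw.
pose p : {poly K} := \sum_(k < fm_dim (M j))
  <| dpow k (fm_e (M j) i) *m z, E w |> *: 'X^k.
have pE s : p.[s] = <| xm (M j) i s *m z, E w |>.
  rewrite /p horner_sum /xm (nilp_expE (nilpZ s (nilp_e ha (M j) i)) (leqnn _)) mulmx_suml.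
  rewrite /fm_pairing raddf_sum /= !mulmx_suml summxE; apply: eq_bigr => k _.
  by rewrite hornerZ hornerXn dpowZ -(scalemxAl (_ ^+ _)) linearZ /= -!(scalemxAl (_ ^+ _)) [RHS]mxE mulrC.
pose B : {poly K} := \prod_(k < (size w).+1) (1 + (S_sum a i (nth i0 w) c' k) *: 'X).
have BE s : B.[s] = \prod_(k < (size w).+1) (1 + s * S_sum a i (nth i0 w) c' k).
  by rewrite /B horner_prod; apply: eq_bigr => k _; rewrite hornerD hornerZ hornerX hornerC mulrC.
have B0 : B != 0.
  apply: contraTneq (oner_neq0 K) => B0; have := BE 0; rewrite B0 horner0 big1.
    by move=> <-; rewrite eqxx.
  by move=> k _; rewrite mul0r addr0.
have : p - 1 = 0.
  apply: (poly_vanish B0) => s; rewrite BE => /prodf_neq0 hT.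
  have hT' k : (k <= size w)%N -> 1 + s * S_sum a i (nth i0 w) c' k != 0.
    by move=> kw; apply: (hT (Ordinal (kw : (k < (size w).+1)%N))).
  rewrite hornerD hornerN hornerC pE /z mulmxA (xm_Yprod ha) // -mulmxA (xm_hw ha).
  rewrite IH ?subrr //; first exact: reduced_suffix red.
  move=> k kw; rewrite /shift_coord !mulf_neq0 ?invr_eq0 ?hc' ?hT' //.
  exact: ltnW.
by move/(canRL (subrK _)); rewrite add0r => p1; rewrite -pE p1 hornerC.
Qed.

End Extremal.

(** * The group inside the product of the modules *)

Section Ambient.
Variables (K : fieldType) (n : nat) (a : 'M[int]_n).
Variable M : forall j : 'I_n, fundamental_module K a j.

Lemma ambientP (g g' : ambient M) : (forall j, g j = g' j) -> g = g'.
Proof. exact: functional_extensionality_dep. Qed.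

Lemma gmulA : associative (@gmul K n a M).
Proof. by move=> g g' g''; apply: ambientP => j; apply: mulmxA. Qed.
Lemma gmul1g : left_id (gone M) (@gmul K n a M).
Proof. by move=> g; apply: ambientP => j; apply: mul1mx. Qed.
Lemma gmulg1 : right_id (gone M) (@gmul K n a M).
Proof. by move=> g; apply: ambientP => j; apply: mulmx1. Qed.

HB.instance Definition _ := Monoid.isLaw.Build (ambient M) (gone M) (@gmul K n a M)
  gmulA gmul1g gmulg1.

Lemma gprodE p (F : 'I_p -> ambient M) j :
  (\big[@gmul K n a M/gone M]_(k < p) F k) j = \big[mulmx/1%:M]_(k < p) F k j.
Proof. exact: (big_morph (fun g : ambient M => g j)). Qed.

Lemma generatedM S (g h : ambient M) : generated S g -> generated S h -> generated S (gmul g h).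
Proof.
elim=> [|x y Sx _ IH] hh; first by rewrite gmul1g.
by rewrite -gmulA; apply: generated_mul => //; apply: IH.
Qed.

Lemma generated1 S (g : ambient M) : S g -> generated S g.
Proof. by move=> Sg; rewrite -[g]gmulg1; apply: generated_mul => //; apply: generated_one. Qed.

(** Groups are given as generated monoids, so inverses are carried along. *)
Definition invertible_in (P : ambient M -> Prop) g :=
  exists g', [/\ P g, P g', gmul g g' = gone M & gmul g' g = gone M].

Lemma invertible_inM (P : ambient M -> Prop) g h :
  (forall x y, P x -> P y -> P (gmul x y)) ->
  invertible_in P g -> invertible_in P h -> invertible_in P (gmul g h).
Proof.
move=> PM [g' [Pg Pg' gg' g'g]] [h' [Ph Ph' hh' h'h]].
exists (gmul h' g'); split; [exact: PM | exact: PM | |].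
  by rewrite -gmulA (gmulA h) hh' gmul1g.
by rewrite -gmulA (gmulA g') g'g gmul1g.
Qed.

Lemma generated_inv (P S : ambient M -> Prop) : P (gone M) ->
  (forall x y, P x -> P y -> P (gmul x y)) ->
  (forall g, S g -> invertible_in P g) -> forall g, generated S g -> invertible_in P g.
Proof.
move=> P1 PM PS g; elim=> [|x y Sx _ IH].
  by exists (gone M); split; rewrite ?gmul1g.
by apply: invertible_inM => //; apply: PS.
Qed.

End Ambient.

(** The structure maps on B^- and the projection to U^- are of this form. The
  second hypothesis asks that the value depend on the point only, not on the
  coordinates or the factorization used to describe it. *)
Lemma the_valueE (S T : Type) (R : S -> T -> Prop) x y :
  R x y -> (forall z, R x z -> z = y) -> the_value R x = Some y.
Proof.
move=> Rxy uniq; rewrite /the_value; case: pselect => [h|]; last first.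
  by case; exists y; split=> // z /uniq.
by case: cid => z /= [/uniq ->].
Qed.

Section Group.
Variables (K : numFieldType) (n : nat) (a : 'M[int]_n) (del : 'I_n -> int).
Hypothesis ha : finite_cartan a del.
Variable M : forall j : 'I_n, fundamental_module K a j.
Local Notation W := (weyl_act a).
Local Notation "g ** h" := (gmul g h) (at level 40, left associativity).
Local Notation y_ := (y_ M).
Local Notation x_ := (x_ M).
Local Notation gone := (gone M).
Implicit Types (g h u : ambient M).

Lemma y_D i s t : y_ i s ** y_ i t = y_ i (s + t).
Proof. by apply: ambientP => j; apply: (ymD ha (M j)). Qed.
Lemma x_D i s t : x_ i s ** x_ i t = x_ i (s + t).
Proof. by apply: ambientP => j; apply: (xmD ha (M j)). Qed.
Lemma y_0 i : y_ i 0 = gone.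
Proof. by apply: ambientP => j; apply: (ym0 (M j)). Qed.
Lemma x_0 i : x_ i 0 = gone.
Proof. by apply: ambientP => j; apply: (xm0 (M j)). Qed.

Definition sbarV i : ambient M := x_ i 1 ** y_ i (-1) ** x_ i 1.
Definition sbar_wordV w : ambient M := foldr (fun i g => gmul g (sbarV i)) gone w.

Lemma sbarVr i : sbar M i ** sbarV i = gone.
Proof. by apply: ambientP => j; apply: (smV ha (M j)). Qed.
Lemma sbarVl i : sbarV i ** sbar M i = gone.
Proof. by apply: ambientP => j; apply: (smV' ha (M j)). Qed.

Lemma sbar_wordVr w : sbar_word M w ** sbar_wordV w = gone.
Proof.
elim: w => [|i w IH] /=; first by rewrite gmul1g.
by rewrite gmulA -(gmulA (sbar M i)) IH gmulg1 sbarVr.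
Qed.

Lemma sbar_wordVl w : sbar_wordV w ** sbar_word M w = gone.
Proof.
elim: w => [|i w IH] /=; first by rewrite gmul1g.
by rewrite gmulA -(gmulA _ (sbarV i)) sbarVl gmulg1 IH.
Qed.

Lemma gconjE (S S' g : ambient M) : S ** S' = gone -> gconj S g = S ** g ** S'.
Proof.
move=> SS'; apply: ambientP => j; rewrite /gconj /gmul /ginv.
have e : S j *m S' j = 1%:M by rewrite -[LHS]/((S ** S') j) SS'.
have [Sj _] := mulmx1_unit e; congr (_ *m _).
by rewrite -[RHS]mul1mx -(mulVmx Sj) -mulmxA e mulmx1.
Qed.

Lemma gconjM (S S' g h : ambient M) : S ** S' = gone -> S' ** S = gone ->
  gconj S (g ** h) = gconj S g ** gconj S h.
Proof.
by move=> SS' S'S; rewrite !(gconjE _ SS') !gmulA -(gmulA _ S') S'S gmulg1.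
Qed.

Lemma gconj_gone (S S' : ambient M) : S ** S' = gone -> gconj S gone = gone.
Proof. by move=> SS'; rewrite (gconjE _ SS') gmulg1. Qed.

Lemma sbar_word_wt w j b b' : sbar_word M w j b b' != 0 ->
  fm_wt b = W w (fm_wt b').
Proof.
elim: w b b' => [|i w IH] b b' /=.
  by rewrite mxE; case: (eqVneq b b') => [->//|_]; rewrite eqxx.
by move/mulmx_neq0 => [c [/(sm_wt ha) -> /IH ->]].
Qed.

Lemma sbar_wordV_wt w j b b' : sbar_wordV w j b b' != 0 ->
  fm_wt b' = W w (fm_wt b).
Proof.
elim: w b b' => [|i w IH] b b' /=.
  by rewrite mxE; case: (eqVneq b b') => [->//|_]; rewrite eqxx.
move/mulmx_neq0 => [c [/IH <- /(sm'_wt ha) ->]].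
by rewrite (reflK ha).
Qed.

Definition lowerP (g : ambient M) := forall j, lower_uni (gdn del (M:=M j)) (g j).
Definition raiseP (g : ambient M) := forall j, raising (gup del (M:=M j)) (g j).

Lemma lowerP1 : lowerP gone.
Proof. by move=> j; apply: lower_uni1. Qed.
Lemma lowerPM g h : lowerP g -> lowerP h -> lowerP (g ** h).
Proof. by move=> hg hh j; apply: lower_uniM. Qed.
Lemma raiseP1 : raiseP gone.
Proof. by move=> j; apply: raising1. Qed.
Lemma raisePM g h : raiseP g -> raiseP h -> raiseP (g ** h).
Proof. by move=> hg hh j; apply: raisingM. Qed.

Lemma root_height w i : positive_weight a (W w (simple_root a i)) ->
  0 < height del (W w (simple_root a i)).
Proof. by move=> hp; apply: (pos_height ha) => //; apply: (act_neq0 ha); apply: (root_neq0 ha). Qed.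

Lemma gconj_y_comp w i t j : gconj (sbar_word M w) (y_ i t) j =
  nilp_exp (t *: Ad (sbar_word M w j) (sbar_wordV w j) (fm_f (M j) i)).
Proof.
rewrite (gconjE _ (sbar_wordVr w)) /gmul -Ad_exp //.
  by rewrite -[LHS]/((_ ** _) j) sbar_wordVr.
by rewrite -[LHS]/((_ ** _) j) sbar_wordVl.
Qed.

Lemma gconj_x_comp w i t j : gconj (sbar_word M w) (x_ i t) j =
  nilp_exp (t *: Ad (sbar_word M w j) (sbar_wordV w j) (fm_e (M j) i)).
Proof.
rewrite (gconjE _ (sbar_wordVr w)) /gmul -Ad_exp //.
  by rewrite -[LHS]/((_ ** _) j) sbar_wordVr.
by rewrite -[LHS]/((_ ** _) j) sbar_wordVl.
Qed.

(** The conjugate of f_i by a representative of w lowers weights by w alpha_i. *)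
Lemma gconj_y_lower w i t : positive_weight a (W w (simple_root a i)) ->
  lowerP (gconj (sbar_word M w) (y_ i t)).
Proof.
move=> /root_height hp j; rewrite gconj_y_comp; apply: lower_uni_exp.
apply: strictly_lowersZ => b b' /mulmx_neq0[c [/mulmx_neq0[c' [/sbar_word_wt e1 /f_wt e2]]]].
move=> /sbar_wordV_wt e3; rewrite /gdn e1 e2 e3 actD actN heightD heightN; lia.
Qed.

Lemma gconj_x_raise w i t : positive_weight a (W w (simple_root a i)) ->
  raiseP (gconj (sbar_word M w) (x_ i t)).
Proof.
move=> /root_height hp j; rewrite gconj_x_comp; apply: raising_uni; apply: lower_uni_exp.
apply: strictly_lowersZ => b b' /mulmx_neq0[c [/mulmx_neq0[c' [/sbar_word_wt e1 /e_wt e2]]]].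
move=> /sbar_wordV_wt e3; rewrite /gup e1 e2 e3 actD heightD; lia.
Qed.

Lemma gconj_inv w (g g' : ambient M) : g ** g' = gone ->
  gconj (sbar_word M w) g ** gconj (sbar_word M w) g' = gone.
Proof.
move=> gg'; rewrite -(gconjM _ _ (sbar_wordVr w) (sbar_wordVl w)) gg'.
exact: gconj_gone (sbar_wordVr w).
Qed.

Lemma Uminus_inv g : Uminus g -> invertible_in lowerP g.
Proof.
apply: generated_inv => [||h [w [i [t [hp ->]]]]]; [exact: lowerP1 | exact: lowerPM |].
exists (gconj (sbar_word M w) (y_ i (- t))).
by split; rewrite ?gconj_inv // ?y_D ?subrr ?addNr ?y_0 //; apply: gconj_y_lower.
Qed.

Lemma Uplus_inv g : Uplus g -> invertible_in raiseP g.
Proof.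
apply: generated_inv => [||h [w [i [t [hp ->]]]]]; [exact: raiseP1 | exact: raisePM |].
exists (gconj (sbar_word M w) (x_ i (- t))).
by split; rewrite ?gconj_inv // ?x_D ?subrr ?addNr ?x_0 //; apply: gconj_x_raise.
Qed.

Lemma torus_inv g : torus g -> invertible_in raiseP g.
Proof.
apply: generated_inv => [||h [i [c [c0 ->]]]]; [exact: raiseP1 | exact: raisePM |].
exists (cochar M i c^-1); split; try by move=> j; apply: raising_diag.
  by apply: ambientP => j; apply: (cmV (M j)).
by apply: ambientP => j; apply: (cmV' (M j)).
Qed.

Lemma borel_inv b : borel b -> invertible_in raiseP b.
Proof.
move=> [u [t [/Uplus_inv hu /torus_inv ht ->]]].
by apply: invertible_inM => //; apply: raisePM.
Qed.

Lemma Uminus_lower g : Uminus g -> lowerP g.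
Proof. by move/Uminus_inv => [g' []]. Qed.

(** U^- meets B trivially: an element of both lowers and raises the height. *)
Lemma Uminus_borel_uniq u u' b b' : Uminus u -> Uminus u' ->
  invertible_in raiseP b -> invertible_in raiseP b' -> u ** b = u' ** b' -> u = u'.
Proof.
move=> /Uminus_inv[v [hu _ uv vu]] /Uminus_inv[v' [hu' hv' u'v' v'u']].
move=> [c [hb hc bc cb]] [c' [hb' _ _ _]] E.
have E' : v' ** u = b' ** c.
  have -> : b' = v' ** (u ** b) by rewrite E gmulA v'u' gmul1g.
  by rewrite -!gmulA bc gmulg1.
have : v' ** u = gone.
  apply: ambientP => j; apply: (@lower_raising_eq1 _ _ (gdn del (M := M j))).
    exact: (lowerPM hv' hu).
  by rewrite E'; apply: (raisePM hb' hc).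
by move/(congr1 (gmul u')); rewrite gmulA u'v' gmul1g gmulg1.
Qed.

Lemma proj_UminusE u (b : ambient M) : Uminus u -> borel b ->
  proj_Uminus (u ** b) = Some u.
Proof.
move=> hu hb; apply: the_valueE; first by split=> //; exists b.
move=> u' [hu' [b' [hb' E]]]; apply: Uminus_borel_uniq hu' hu _ _ (esym E).
  exact: borel_inv.
exact: borel_inv.
Qed.

Lemma Uminus_y i t : Uminus (y_ i t).
Proof.
apply: generated1; exists [::], i, t; split; first exact: pos_root ha i.
by rewrite (gconjE _ (gmul1g _)) gmul1g gmulg1.
Qed.

Lemma Uplus_x i t : Uplus (x_ i t).
Proof.
apply: generated1; exists [::], i, t; split; first exact: pos_root ha i.
by rewrite (gconjE _ (gmul1g _)) gmul1g gmulg1.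
Qed.

Lemma Uminus_prod p (ii : 'I_p -> 'I_n) (t : 'I_p -> K) :
  Uminus (\big[@gmul K n a M/gone]_(k < p) y_ (ii k) (t k)).
Proof.
elim/big_ind: _ => [|g h|k _]; [exact: generated_one | exact: generatedM | exact: Uminus_y].
Qed.

Definition reflected i (u' : ambient M) :=
  Uminus u' /\ exists2 u'', Uminus u'' & u' = gconj (sbar M i) u''.

Lemma reflected1 i : reflected i gone.
Proof.
split; first exact: generated_one; exists gone; first exact: generated_one.
by rewrite (gconj_gone (sbarVr i)).
Qed.

Lemma reflectedM i g h : reflected i g -> reflected i h -> reflected i (g ** h).
Proof.
move=> [Ug [g' Ug' eg]] [Uh [h' Uh' eh]]; split; first exact: generatedM.
exists (g' ** h'); first exact: generatedM.
by rewrite (gconjM _ _ (sbarVr i) (sbarVl i)) -eg -eh.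
Qed.

Lemma reflectedI i g : Uminus g -> Uminus (sbarV i ** g ** sbar M i) -> reflected i g.
Proof.
move=> Ug Ug'; split=> //; exists (sbarV i ** g ** sbar M i) => //.
rewrite (gconjE _ (sbarVr i)) -(gmulA (sbar M i)) -(gmulA (sbarV i ** g)) sbarVr gmulg1.
by rewrite gmulA sbarVr gmul1g.
Qed.

(** For t <> 0 this is [sm'_conj_ymk]; for t = 0, conjugation by s_i^-1 and by s_i
  agree on U_{-alpha_k} up to a sign, and s_i alpha_k is positive. *)
Lemma reflected_conj i k b t : i != k -> reflected i (y_ i (- t) ** y_ k b ** y_ i t).
Proof.
move=> ik; apply: reflectedI.
  by apply: generatedM; first apply: generatedM; apply: Uminus_y.
have [->|t0] := eqVneq t 0.
  rewrite oppr0 y_0 gmul1g gmulg1.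
  have -> : sbarV i ** y_ k b ** sbar M i = gconj (sbar_word M [:: i]) (y_ k (b * (-1) ^+ `|a i k|%N)).
    rewrite (gconjE _ (sbar_wordVr _)) /= gmulg1 gmul1g.
    by apply: ambientP => j; apply: (sm'_ymk_sm ha (M j)).
  apply: generated1; exists [:: i], k, (b * (-1) ^+ `|a i k|%N); split=> //=.
  rewrite /simple_refl root_coef -scaleNr; apply: (posD ha); first exact: pos_root ha k.
  apply: (posZ ha); last exact: pos_root ha i.
  by rewrite oppr_ge0 (cartan_off_le0 ha).
have -> : sbarV i ** (y_ i (- t) ** y_ k b ** y_ i t) ** sbar M i =
   y_ i t^-1 ** y_ k (b * (- t) ^+ `|a i k|%N) ** y_ i (- t^-1).
  by apply: ambientP => j; apply: (sm'_conj_ymk ha (M j)).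
by apply: generatedM; first apply: generatedM; apply: Uminus_y.
Qed.

(** Collect the letters i on the left, the others being conjugated into s_i U^- s_i^-1
  on the way. *)
Lemma prod_component i p (ii : 'I_p -> 'I_n) (t : 'I_p -> K) : exists2 u', reflected i u' &
  \big[@gmul K n a M/gone]_(k < p) y_ (ii k) (t k) = y_ i (\sum_(k < p | ii k == i) t k) ** u'.
Proof.
elim: p ii t => [|p IH] ii t.
  by exists gone; [exact: reflected1 | rewrite !big_ord0 y_0 gmul1g].
rewrite big_ord_recl; have [u' hu' ->] := IH (ii \o lift ord0) (t \o lift ord0).
set s := \sum_(_ < p | _) _.
have -> : \sum_(k < p.+1 | ii k == i) t k = (if ii ord0 == i then t ord0 else 0) + s.
  by rewrite big_mkcond big_ord_recl -big_mkcond.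
case: (eqVneq (ii ord0) i) => [->|ki].
  by exists u' => //; rewrite gmulA y_D.
exists (y_ i (- s) ** y_ (ii ord0) (t ord0) ** y_ i s ** u').
  by apply: reflectedM => //; apply: reflected_conj; rewrite eq_sym.
by rewrite add0r !gmulA y_D subrr y_0 gmul1g.
Qed.

(** Existence is [prod_component]; the coordinate is unique because [simple_coord]
  reads it off. *)
Lemma eps_UE i p (ii : 'I_p -> 'I_n) (t : 'I_p -> K) :
  eps_U i (\big[@gmul K n a M/gone]_(k < p) y_ (ii k) (t k)) =
  Some (\sum_(k < p | ii k == i) t k).
Proof.
have [u' [Uu' [u'' Uu'' eu']] ->] := prod_component i ii t.
apply: the_valueE; first by exists u', u''; split.
move=> s [v' [v'' [Uv' Uv'' ev' E]]].
have coord r w w' : Uminus w -> Uminus w' -> w = gconj (sbar M i) w' ->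
    simple_coord ((y_ i r ** w) i) = r.
  move=> /Uminus_lower Uw /Uminus_lower Uw' ew.
  rewrite (simple_coord_ym ha) // ew (gconjE _ (sbarVr i)).
  by rewrite (simple_coord_reflected ha) ?addr0.
have h := coord s _ _ Uv' Uv'' ev'.
by rewrite -E (coord _ _ _ Uu' Uu'' eu') in h.
Qed.

End Group.

(** * Cartan matrices of the classical types *)

Lemma sum_pick n (g : nat -> int) c r i s :
  \sum_(k < n) g k * (if (k + r == i + s)%N then c else 0) =
  if (r <= i + s < n + r)%N then g (i + s - r)%N * c else 0.
Proof.
case: ifP => [/andP[ri rn]|].
  have mn : (i + s - r < n)%N by lia.
  rewrite (bigD1 (Ordinal mn)) //= subnK // eqxx big1 ?addr0 // => k km.
  case: eqP => [e|_]; last by rewrite mulr0.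
  by case/eqP: km; apply: val_inj; rewrite /= -e addnK.
move=> h; rewrite big1 // => k _; case: eqP => [e|_]; last by rewrite mulr0.
by have := ltn_ord k; lia.
Qed.

(** The entry (k, i) of the Cartan matrix as a sum of terms, each supported on
  one value of k - i, so that sums over a column can be evaluated termwise. *)
Definition diagram_coef (X : classical_type) (n i k : nat) : int :=
  (if (k + 0 == i + 0)%N then 2 else 0)
  + (if (k + 1 == i + 0)%N then
       match X with TypeC => if i.+1 == n then -2 else -1
                  | TypeD => if (i.+1 < n)%N then -1 else 0 | _ => -1 end else 0)
  + (if (k + 0 == i + 1)%N then
       match X with TypeB => if i.+2 == n then -2 else -1
                  | TypeD => if (i.+2 < n)%N then -1 else 0 | _ => -1 end else 0)
  + (if (k + 2 == i + 0)%N then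
       match X with TypeD => if i.+1 == n then -1 else 0 | _ => 0 end else 0)
  + (if (k + 0 == i + 2)%N then
       match X with TypeD => if i.+3 == n then -1 else 0 | _ => 0 end else 0).

Lemma cartanE X n (k i : 'I_n) : cartan X n k i = diagram_coef X n i k.
Proof.
rewrite /diagram_coef mxE -val_eqE /=; have := ltn_ord i; have := ltn_ord k.
move: (nat_of_ord i) (nat_of_ord k) => {}i {}k kn in_.
by case: X; repeat (case: ifP => /=); lia.
Qed.

Definition concave (n k : nat) : int := (k%:Z + 1) * (2 * n%:Z - k%:Z).

(** A concave function of the node, up to a factor 2 and to adjustments at the end of
  the diagram. The heights of the simple roots are, up to sign, its second
  differences. *)
Definition coroot_height (X : classical_type) (n k : nat) : int :=
  match X with
  | TypeA => (k%:Z + 1) * (n%:Z - k%:Z)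
  | TypeB => if k.+1 == n then concave n k else 2 * concave n k
  | TypeC => concave n k
  | TypeD => if (k.+2 < n)%N then 2 * concave n k else concave n n.-2
  end.

Lemma classical_finite_cartan X n : valid_rank X n ->
  finite_cartan (cartan X n) (fun k : 'I_n => coroot_height X n k).
Proof.
move=> hn; split.
- by move=> i; rewrite mxE eqxx.
- move=> i j ij; rewrite mxE (negPf ij).
  by case: X {hn}; repeat (case: ifP => _); try (by apply: Or31); try (by apply: Or32); apply: Or33.
- move=> k; rewrite /coroot_height /concave; have := ltn_ord k.
  by case: X hn => /=; repeat (case: ifP => /=); nia.
- move=> i; rewrite /height.
  under eq_bigr => k _ do rewrite root_coef cartanE.
  rewrite /diagram_coef; under eq_bigr => k _ do rewrite !mulrDr.
  rewrite !big_split /=.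
  have hi := ltn_ord i; rewrite !(@sum_pick n (coroot_height X n)).
  move: (nat_of_ord i) hi => {}i hi; rewrite /coroot_height /concave.
  rewrite !addn0 !addn1 !addn2 !subn0 subn1 subn2 /=.
  case: X hn => /= hn; case: i hi => [|[|i]] hi /=.
  all: repeat (case: ifP => /=); try nia.
Qed.

(** * Generic points and rational functions *)

Section Generic.
Variables (K : numFieldType) (L : nat).
Implicit Types (P Q : ('I_L -> K) -> Prop) (f g : ('I_L -> K) -> K).

Lemma generically_mono P Q : (forall x, P x -> Q x) -> generically P -> generically Q.
Proof. by move=> PQ [p p0 hp]; exists p => // x /hp /PQ. Qed.

Lemma genericallyT P : (forall x, P x) -> generically P.
Proof. by move=> hP; exists 1; rewrite ?oner_neq0. Qed.

Lemma generically_and P Q : generically P -> generically Q -> generically (fun x => P x /\ Q x).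
Proof.
move=> [p p0 hp] [q q0 hq]; exists (p * q); first by rewrite mulf_neq0.
by move=> x; rewrite mevalM mulf_eq0 negb_or => /andP[/hp ? /hq].
Qed.

Lemma generically_forall (I : finType) (P : I -> ('I_L -> K) -> Prop) :
  (forall i, generically (P i)) -> generically (fun x => forall i, P i x).
Proof.
move=> hP; suff : generically (fun x => forall i, i \in enum I -> P i x).
  by apply: generically_mono => x h i; apply: h; rewrite mem_enum.
elim: (enum I) => [|i s IH]; first exact: genericallyT.
apply: generically_mono (generically_and (hP i) IH) => x [Pi hs] k.
by rewrite inE => /orP[/eqP ->|/hs].
Qed.

Lemma generically_torus : generically (@in_torus K L).
Proof.
apply: generically_forall => k; exists 'X_k.
  by apply: contraTneq (oner_neq0 K) => h; have := mevalXU (fun=> 1 : K) k; rewrite h meval0 => <-; rewrite eqxx.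
by move=> x; rewrite mevalXU.
Qed.

Definition torus_rational f := exists num den : {mpoly K[L]},
  forall x, in_torus x -> den.@[x] != 0 /\ f x = num.@[x] / den.@[x].
Definition torus_unit f := exists num den : {mpoly K[L]},
  forall x, in_torus x -> [/\ num.@[x] != 0, den.@[x] != 0 & f x = num.@[x] / den.@[x]].

Lemma torus_unit_rational f : torus_unit f -> torus_rational f.
Proof. by move=> [p [q h]]; exists p, q => x /h[]. Qed.

Lemma torus_unit_ext f g : (forall x, in_torus x -> f x = g x) -> torus_unit f -> torus_unit g.
Proof. by move=> fg [p [q h]]; exists p, q => x hx; rewrite -fg //; apply: h. Qed.

Lemma torus_unit1 : torus_unit (fun=> 1).
Proof. by exists 1, 1 => x _; rewrite meval1 divr1 oner_neq0. Qed.

Lemma torus_unit_coord k : torus_unit (fun x => x k).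
Proof. by exists 'X_k, 1 => x hx; rewrite mevalXU meval1 divr1 oner_neq0. Qed.

Lemma torus_unitM f g : torus_unit f -> torus_unit g -> torus_unit (fun x => f x * g x).
Proof.
move=> [p [q h]] [p' [q' h']]; exists (p * p'), (q * q') => x hx.
have [p0 q0 ->] := h x hx; have [p0' q0' ->] := h' x hx.
by rewrite !mevalM !mulf_neq0 // invfM mulrACA.
Qed.

Lemma torus_unitV f : torus_unit f -> torus_unit (fun x => (f x)^-1).
Proof.
move=> [p [q h]]; exists q, p => x hx; have [p0 q0 ->] := h x hx.
by rewrite invf_div.
Qed.

Lemma torus_unitX f (z : int) : torus_unit f -> torus_unit (fun x => f x ^ z).
Proof.
move=> hf; have hX m : torus_unit (fun x => f x ^+ m).
  elim: m => [|m IH]; first exact: torus_unit_ext torus_unit1.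
  by apply: torus_unit_ext (torus_unitM hf IH) => x _; rewrite exprS.
case: z => m; first exact: torus_unit_ext (hX m).
by apply: torus_unit_ext (torus_unitV (hX m.+1)) => x _; rewrite NegzE -invr_expz.
Qed.

Lemma torus_unit_prod p (P : pred 'I_p) (F : 'I_p -> ('I_L -> K) -> K) :
  (forall k, torus_unit (F k)) -> torus_unit (fun x => \prod_(k < p | P k) F k x).
Proof.
move=> hF; elim: (index_enum _) => [|k s IH].
  by apply: torus_unit_ext torus_unit1 => x _; rewrite big_nil.
case Pk: (P k); last by apply: torus_unit_ext IH => x _; rewrite big_cons Pk.
by apply: torus_unit_ext (torus_unitM (hF k) IH) => x _; rewrite big_cons Pk.
Qed.

Lemma torus_rationalD f g : torus_rational f -> torus_rational g ->
  torus_rational (fun x => f x + g x).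
Proof.
move=> [p [q h]] [p' [q' h']]; exists (p * q' + p' * q), (q * q') => x hx.
have [q0 ->] := h x hx; have [q0' ->] := h' x hx.
by rewrite mevalD !mevalM mulf_neq0 // addf_div.
Qed.

Lemma torus_rationalZ s f : torus_rational f -> torus_rational (fun x => s * f x).
Proof.
move=> [p [q h]]; exists (s *: p), q => x hx.
by have [q0 ->] := h x hx; rewrite mevalZ mulrA.
Qed.

Lemma torus_rational_ext f g : (forall x, f x = g x) -> torus_rational f -> torus_rational g.
Proof. by move=> fg [p [q h]]; exists p, q => x hx; rewrite -fg; apply: h. Qed.

Lemma torus_rational_sum p (P : pred 'I_p) (F : 'I_p -> ('I_L -> K) -> K) :
  (forall k, torus_rational (F k)) -> torus_rational (fun x => \sum_(k < p | P k) F k x).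
Proof.
move=> hF; elim: (index_enum _) => [|k s IH].
  by exists 0, 1 => x _; rewrite big_nil meval0 meval1 mul0r oner_neq0.
case Pk: (P k); last by apply: torus_rational_ext IH => x; rewrite big_cons Pk.
by apply: torus_rational_ext (torus_rationalD (hF k) IH) => x; rewrite big_cons Pk.
Qed.

(** The value at x0 shows that the numerator is not the zero polynomial. *)
Lemma torus_rational_neq0 f x0 : torus_rational f -> in_torus x0 -> f x0 != 0 ->
  generically (fun x => f x != 0).
Proof.
move=> [p [q h]] hx0 fx0.
have gp : generically (fun x => p.@[x] != 0).
  exists p => //; have [q0 E] := h x0 hx0.
  by apply: contraNneq fx0 => p0; rewrite E p0 meval0 mul0r.
apply: generically_mono (generically_and generically_torus gp) => x [hx px].
by have [qx ->] := h x hx; rewrite mulf_neq0 ?invr_eq0.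
Qed.

Lemma torus_unit_fractions (F : 'I_L -> ('I_L -> K) -> K) : (forall k, torus_unit (F k)) ->
  exists num den : 'I_L -> {mpoly K[L]}, (forall k, den k != 0) /\
  forall x, in_torus x -> F ^~ x = (fun k => (num k).@[x] / (den k).@[x]).
Proof.
move=> hF; have [num hnum] := fin_all_exists hF; have [den hden] := fin_all_exists hnum.
exists num, den; split=> [k|x hx]; last first.
  by apply: functional_extensionality_dep => k; have [] := hden k x hx.
have [|_ d1 _] := hden k (fun=> 1); first by move=> ?; apply: oner_neq0.
by apply: contraNneq d1 => ->; rewrite meval0.
Qed.

End Generic.

(** * The two crystals *)

Section Crystals.
Variables (K : numFieldType) (n : nat) (a : 'M[int]_n) (del : 'I_n -> int).
Hypothesis ha : finite_cartan a del.
Variable M : forall j : 'I_n, fundamental_module K a j.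
Variables (L : nat) (iota : L.-tuple 'I_n) (i0 : 'I_n).
Local Notation "g ** h" := (gmul g h) (at level 40, left associativity).
Local Notation i_ k := (tnth iota k).
Local Notation Yw := (Y_word M iota).
Local Notation yw := (y_word M iota).
Local Notation Phi := (Phi_coord a iota).
Local Notation S_ := (S_ a iota).
Local Notation ii := (nth i0 iota).
Implicit Types (c : 'I_L -> K) (i j : 'I_n).

(** The value 1 outside the range keeps a point of the torus nonzero at every
  index. *)
Definition ext c (k : nat) : K := oapp c 1 (insub k).

Lemma extE c (k : 'I_L) : ext c k = c k.
Proof. by rewrite /ext valK. Qed.

Lemma ext_neq0 c k : in_torus c -> ext c k != 0.
Proof. by move=> hc; rewrite /ext; case: insubP => [u _ _|_] /=; [apply: hc | apply: oner_neq0]. Qed.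

Lemma iiE (k : 'I_L) : i_ k = ii k.
Proof. exact: tnth_nth. Qed.

Lemma prefix_prod i c m : (m <= L)%N ->
  \prod_(k < L | (k < m)%N) c k ^ a (i_ k) i = root_val a i ii (ext c) m.
Proof.
move=> mL; rewrite /root_val (big_ord_widen L (fun l => ext c l ^ a (ii l) i) mL).
by apply: eq_bigr => k _; rewrite extE iiE.
Qed.

Lemma S_E i c (m : 'I_L) : S_ i c m = S_nat a i ii (ext c) m.
Proof. by rewrite /Defs.S_ /S_nat prefix_prod ?extE // ltnW. Qed.

Lemma PhiE c (k : 'I_L) : Phi c k = Phi_nat a ii (ext c) k.
Proof. by rewrite /Phi_coord /Phi_nat /S_nat iiE prefix_prod ?extE // ltnW. Qed.

Lemma Phi_S i c (m : 'I_L) : i_ m == i -> Phi c m = S_ i c m.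
Proof. by move/eqP => mi; rewrite PhiE S_E /Phi_nat -iiE mi. Qed.

Lemma S_sumE i c m : (m <= L)%N ->
  S_sum a i ii (ext c) m = \sum_(k < L | (k < m)%N && (i_ k == i)) S_ i c k.
Proof.
move=> mL; rewrite /S_sum big_mkcond.
rewrite (big_ord_widen L (fun k => if ii k == i then S_nat a i ii (ext c) k else 0) mL).
by rewrite -big_mkcondr; apply: eq_big => k; rewrite -iiE // S_E.
Qed.

Lemma Y_wordE c j : Yw c j = Yprod (M j) ii (ext c) L.
Proof. by rewrite /Y_word gprodE; apply: eq_bigr => k _; rewrite -iiE extE. Qed.

Definition tor c : ambient M := \big[@gmul K n a M/gone M]_(k < L) cochar M (i_ k) (c k).

Lemma torE c j : tor c j = tprod (M j) ii (ext c) L.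
Proof. by rewrite /tor gprodE; apply: eq_bigr => k _; rewrite -iiE extE. Qed.

Lemma y_word_PhiE c j : yw (Phi c) j = yprod (M j) ii (Phi_nat a ii (ext c)) L.
Proof. by rewrite /y_word gprodE; apply: eq_bigr => k _; rewrite PhiE -iiE. Qed.

Lemma Y_word_split c : in_torus c -> Yw c = yw (Phi c) ** tor c.
Proof.
move=> hc; apply: ambientP => j; rewrite Y_wordE /gmul y_word_PhiE torE.
by apply: Yprod_split => k _; apply: ext_neq0.
Qed.

Lemma torus_tor c : in_torus c -> torus (tor c).
Proof.
move=> hc; rewrite /tor; elim/big_ind: _ => [|x y|k _].
- exact: generated_one.
- exact: generatedM.
- by apply: generated1; exists (i_ k), (c k).
Qed.

Lemma Uminus_y_word t : Uminus (yw t).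
Proof. exact: (Uminus_prod ha M (fun k => i_ k)). Qed.

(** Although the coordinates c need not be determined by the point, its unipotent and
  torus parts are. *)
Lemma Y_word_uniq c c' : in_torus c -> in_torus c' -> Yw c = Yw c' ->
  yw (Phi c) = yw (Phi c') /\ tor c = tor c'.
Proof.
move=> hc hc' E; rewrite !Y_word_split // in E.
have E1 : yw (Phi c) = yw (Phi c').
  by apply: (Uminus_borel_uniq ha (Uminus_y_word _) (Uminus_y_word _) _ _ E);
     apply/torus_inv/torus_tor.
split=> //; have [v [_ _ _ vu]] := Uminus_inv ha (Uminus_y_word (Phi c)).
by move/(congr1 (gmul v)): E; rewrite -E1 !gmulA vu !gmul1g.
Qed.

Lemma tor_hw c j : tor c j *m fm_hw (M j) = (\prod_(k < L | i_ k == j) c k) *: fm_hw (M j).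
Proof.
rewrite torE tprod_hw; congr (_ *: _).
by apply: eq_big => k; rewrite -iiE // extE.
Qed.

(** A weight is a combination of fundamental weights, so its value on a torus element
  is determined by theirs. *)
Lemma weight_val_fund (lam : 'rV[int]_n) c : \prod_k c k ^ lam 0 (i_ k) =
  \prod_j (\prod_(k < L | i_ k == j) c k) ^ lam 0 j.
Proof.
rewrite (partition_big (fun k => i_ k) xpredT) //=; apply: eq_bigr => j _.
rewrite (big_morph (fun x => x ^ lam 0 j) (fun x y => expfzMl x y _) (exp1rz _ _)).
by apply: eq_bigr => k /eqP ->.
Qed.

Lemma root_val_fund i c : \prod_k c k ^ a (i_ k) i =
  \prod_j (\prod_(k < L | i_ k == j) c k) ^ a j i.
Proof.
have := weight_val_fund (simple_root a i) c.
under eq_bigr => k _ do rewrite root_coef.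
by under [in RHS]eq_bigr => j _ do rewrite root_coef.
Qed.

Lemma tor_root i c c' : tor c = tor c' ->
  \prod_k c k ^ a (i_ k) i = \prod_k c' k ^ a (i_ k) i.
Proof.
move=> E; rewrite !root_val_fund; apply: eq_bigr => j _; congr (_ ^ _).
have := tor_hw c j; rewrite E tor_hw => /eqP; rewrite -subr_eq0 -scalerBl scaler_eq0.
by rewrite (negPf (fm_hw_neq0 _)) orbF subr_eq0 => /eqP.
Qed.

Lemma Phi_mapE c : in_torus c -> Phi_map M iota (Yw c) = Some (yw (Phi c)).
Proof.
move=> hc; apply: the_valueE; first by exists c.
by move=> u [c' [hc' E ->]]; have [] := Y_word_uniq hc' hc (esym E).
Qed.

Lemma gamma_BE i c : in_torus c -> gamma_B iota i (Yw c) = Some (\prod_k c k ^ a (i_ k) i).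
Proof.
move=> hc; apply: the_valueE; first by exists c.
by move=> u [c' [hc' E ->]]; have [_ /tor_root] := Y_word_uniq hc' hc (esym E).
Qed.

Lemma eps_y_word i t : eps_U i (yw t) = Some (\sum_(k < L | i_ k == i) t k).
Proof. exact: (eps_UE ha M i (fun k => i_ k)). Qed.

Lemma sum_Phi_S i c : \sum_(m < L | i_ m == i) Phi c m = \sum_(m < L | i_ m == i) S_ i c m.
Proof. by apply: eq_bigr => m; apply: Phi_S. Qed.

Lemma eps_uniq i c c' : in_torus c -> in_torus c' -> Yw c = Yw c' ->
  \sum_(m < L | i_ m == i) S_ i c m = \sum_(m < L | i_ m == i) S_ i c' m.
Proof.
move=> hc hc' /(Y_word_uniq hc hc')[E _].
by have := eps_y_word i (Phi c); rewrite E eps_y_word !sum_Phi_S => -[].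
Qed.

Lemma eps_BE i c : in_torus c ->
  eps_B iota i (Yw c) = Some (\sum_(m < L | i_ m == i) S_ i c m).
Proof.
move=> hc; apply: the_valueE; first by exists c.
by move=> u [c' [hc' E ->]]; apply: eps_uniq.
Qed.

Definition moved i s c : 'I_L -> K :=
  fun k => c k * (act_B_num a iota i s c k / act_B_den a iota i s c k).

Lemma act_B_denE i s c (j : 'I_L) : act_B_den a iota i s c j =
  \sum_(m < L | i_ m == i) S_ i c m + (s - 1) * S_sum a i ii (ext c) j.
Proof.
rewrite /act_B_den (S_sumE i c (ltnW (ltn_ord j))).
rewrite [X in _ = X + _](bigID (fun m : 'I_L => (m < j)%N)) /=.
rewrite -mulr_sumr mulrBl mul1r.
have -> : \sum_(m < L | (i_ m == i) && ~~ (m < j)%N) S_ i c m =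
          \sum_(m < L | (j <= m)%N && (i_ m == i)) S_ i c m.
  by apply: eq_bigl => m; rewrite -leqNgt andbC.
have -> : \sum_(m < L | (i_ m == i) && (m < j)%N) S_ i c m =
          \sum_(m < L | (m < j)%N && (i_ m == i)) S_ i c m.
  by apply: eq_bigl => m; rewrite andbC.
by ring.
Qed.

Lemma act_B_numE i s c (j : 'I_L) : act_B_num a iota i s c j =
  \sum_(m < L | i_ m == i) S_ i c m + (s - 1) * S_sum a i ii (ext c) j.+1.
Proof.
rewrite /act_B_num (S_sumE i c (ltn_ord j)).
rewrite [X in _ = X + _](bigID (fun m : 'I_L => (m < j.+1)%N)) /=.
rewrite -mulr_sumr mulrBl mul1r.
have -> : \sum_(m < L | (i_ m == i) && ~~ (m < j.+1)%N) S_ i c m =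
          \sum_(m < L | (j < m)%N && (i_ m == i)) S_ i c m.
  by apply: eq_bigl => m; rewrite -leqNgt andbC.
have -> : \sum_(m < L | (i_ m == i) && (m < j.+1)%N) S_ i c m =
          \sum_(m < L | (m <= j)%N && (i_ m == i)) S_ i c m.
  by apply: eq_bigl => m; rewrite andbC ltnS.
by ring.
Qed.

Definition act_defined i s c :=
  [/\ s != 0, in_torus c &
      forall j : 'I_L, act_B_num a iota i s c j != 0 /\ act_B_den a iota i s c j != 0].

Lemma moved_torus i s c : act_defined i s c -> in_torus (moved i s c).
Proof.
move=> [_ hc hnd] k; have [h1 h2] := hnd k.
by rewrite /moved !mulf_neq0 ?invr_eq0.
Qed.

(** Up to a factor x_i(r) on the right, e_i^s is left multiplication by
  x_i((s - 1) / eps), which depends on the point only. *)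
Lemma x_Y_word i s c : i \in iota -> act_defined i s c ->
  let eps := \sum_(m < L | i_ m == i) S_ i c m in eps != 0 /\
  exists r, x_ M i ((s - 1) / eps) ** Yw c = Yw (moved i s c) ** x_ M i r.
Proof.
move=> /tnthP[k0 _] hd eps; have [s0 hc hnd] := hd.
have L0 : (0 < L)%N by apply: leq_ltn_trans (ltn_ord k0).
have eps0 : eps != 0.
  have := (hnd (Ordinal L0)).2; rewrite act_B_denE /=.
  by rewrite S_sum0 mulr0 addr0.
split=> //; eexists.
pose tau := (s - 1) / eps; rewrite -/tau.
have Tden (k : 'I_L) : 1 + tau * S_sum a i ii (ext c) k = act_B_den a iota i s c k / eps.
  by rewrite act_B_denE -/eps /tau; field.
have Tnum (k : 'I_L) : 1 + tau * S_sum a i ii (ext c) k.+1 = act_B_num a iota i s c k / eps.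
  by rewrite act_B_numE -/eps /tau; field.
have T0 k : (k <= L)%N -> 1 + tau * S_sum a i ii (ext c) k != 0.
  case: k => [_|k kL]; first by rewrite S_sum0 mulr0 addr0 oner_neq0.
  rewrite (Tnum (Ordinal kL)) mulf_neq0 ?invr_eq0 //.
  exact: (hnd (Ordinal kL)).1.
apply: ambientP => j; rewrite /gmul Y_wordE (xm_Yprod ha); first last.
- exact: T0.
- by move=> k _; apply: ext_neq0.
congr (_ *m _); rewrite Y_wordE; apply: eq_bigr => k _; congr (Ym _ _ _).
rewrite extE /shift_coord /moved extE Tden Tnum; congr (_ * _).
by have [_ d0] := hnd k; field; rewrite ?eps0 ?d0.
Qed.

Lemma torusV c : in_torus c -> tor (fun k => (c k)^-1) ** tor c = gone M /\
  tor c ** tor (fun k => (c k)^-1) = gone M.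
Proof.
move=> hc; have E : tor (fun k => (c k)^-1) ** tor c = gone M.
  apply: ambientP => j; rewrite /gmul !torE !tprod_diag mulmx_diag.
  apply/matrixP => b b'; rewrite !mxE; case: (eqVneq b b') => [_|//]; rewrite !mulr1n.
  rewrite -big_split big1 // => k _ /=; rewrite !extE -expfzMl mulVf ?hc //.
  by rewrite exp1rz.
split=> //; apply: ambientP => j; apply: mulmx1C.
by rewrite -[LHS]/((_ ** _) j) E.
Qed.

Lemma borel_xt i r t t' : torus t -> torus t' -> (exists r', t ** x_ M i r = x_ M i r' ** t) ->
  borel (t ** x_ M i r ** t').
Proof.
move=> ht ht' [r' E]; exists (x_ M i r'), (t ** t'); split.
- exact: (Uplus_x ha).
- exact: generatedM.
- by rewrite E gmulA.
Qed.

Lemma tor_x i r c : in_torus c -> exists r', tor c ** x_ M i r = x_ M i r' ** tor c.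
Proof.
move=> hc; exists (root_val a i ii (ext c) L * r).
apply: ambientP => j; rewrite /gmul torE.
suff H m t : tprod (M j) ii (ext c) m *m xm (M j) i t =
    xm (M j) i (root_val a i ii (ext c) m * t) *m tprod (M j) ii (ext c) m by apply: H.
elim: m t => [|m IH] t.
  by rewrite /tprod /root_val !big_ord0 mul1mx mulmx1 mul1r.
rewrite /tprod big_ord_recr /= -/(tprod (M j) ii (ext c) m) -mulmxA cm_xm ?ext_neq0 //.
by rewrite !mulmxA IH root_valS mulrA.
Qed.

(** By [x_Y_word], x_i((s - 1) / eps) y(Phi c) equals y(Phi c') times an element of
  B, where c' are the moved coordinates. *)
Lemma act_UE i s c : i \in iota -> act_defined i s c ->
  act_U i s (yw (Phi c)) = Some (yw (Phi (moved i s c))).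
Proof.
move=> hi hd; have [eps0 [r E]] := x_Y_word hi hd; have [s0 hc _] := hd.
have hm := moved_torus hd.
rewrite /act_U eps_y_word sum_Phi_S s0 eps0 /=.
have [V1 V2] := torusV hc.
have -> : yw (Phi c) = Yw c ** tor (fun k => (c k)^-1).
  by rewrite Y_word_split // -gmulA V2 gmulg1.
rewrite gmulA E Y_word_split // -!gmulA; apply: (proj_UminusE ha).
  exact: Uminus_y_word.
rewrite gmulA; apply: borel_xt; [exact: torus_tor | | exact: tor_x].
by apply: torus_tor => k; rewrite invr_eq0.
Qed.

(** Two coordinate systems of one point give, by [x_Y_word], the same product of an
  element of U^-, one of T and one of U, in which the first two factors are
  determined. *)
Lemma act_BE i s c : i \in iota -> act_defined i s c ->
  act_B iota i s (Yw c) = Some (Yw (moved i s c)).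
Proof.
move=> hi hd; have [eps0 [r E]] := x_Y_word hi hd; have [s0 hc hnd] := hd.
apply: the_valueE; first by exists c; split.
move=> y [c' [_ hc' hnd' Ec ->]].
have hd' : act_defined i s c' by split.
have [_ [r' E']] := x_Y_word hi hd'.
rewrite -(eps_uniq i hc hc' Ec) -Ec E in E'.
have hm := moved_torus hd; have hm' := moved_torus hd'.
rewrite -/(moved i s c').
rewrite (Y_word_split hm) (Y_word_split hm') in E' *; rewrite -!gmulA in E'.
have inv (b : 'I_L -> K) q : in_torus b -> invertible_in (raiseP del (M := M)) (tor b ** x_ M i q).
  move=> hb; apply: (borel_inv ha); rewrite -[_ ** _]gmulg1.
  apply: borel_xt; [exact: torus_tor | exact: generated_one | exact: tor_x].
have E1 := Uminus_borel_uniq ha (Uminus_y_word _) (Uminus_y_word _) (inv _ _ hm) (inv _ _ hm') E'.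
rewrite -E1 in E' *; congr (_ ** _).
have [v [_ _ _ vu]] := Uminus_inv ha (Uminus_y_word (Phi (moved i s c))).
move/(congr1 (gmul v)): E'; rewrite !gmulA vu !gmul1g => E2.
apply: ambientP => j; rewrite !torE !tprod_diag; congr diag_mx; apply/rowP => b.
have /matrixP/(_ b b) : (tor (moved i s c) ** x_ M i r) j = (tor (moved i s c') ** x_ M i r') j.
  by rewrite E2.
rewrite /gmul !torE !tprod_diag !mul_diag_mx ![(\matrix_(_, _) _) b b]mxE.
have d1 q : x_ M i q j b b = 1.
  exact: (lower_uni_diag b (@xm_upper _ _ _ _ ha _ (M j) i q)).
by rewrite !d1 !mulr1 => ->.
Qed.

Hypothesis long : reduced_longest_word a iota.

(** F_j takes the value 1 on Y(c) = y(Phi c) t(c), and t(c) scales the highest weight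
  vector by the product of the c_k with i_k = j. *)
Lemma lowest_pairingE j c : in_torus c ->
  lowest_pairing iota j (yw (Phi c)) = (\prod_(k < L | i_ k == j) c k)^-1.
Proof.
move=> hc; have := lowest_pairing_word ha M j i0 long.1 (fun k _ => ext_neq0 k hc).
rewrite size_tuple -Y_wordE Y_word_split // /gmul -mulmxA tor_hw -scalemxAr pairingZl => E.
have c0 : \prod_(k < L | i_ k == j) c k != 0 by apply/prodf_neq0 => k _; apply: hc.
by apply: (mulfI c0); rewrite divff // -E.
Qed.

Lemma gamma_UE i c : in_torus c ->
  gamma_U iota i (yw (Phi c)) = Some (\prod_k c k ^ a (i_ k) i).
Proof.
move=> hc; rewrite /gamma_U; have -> : [forall j, lowest_pairing iota j (yw (Phi c)) != 0].
  apply/forallP => j; rewrite lowest_pairingE // invr_eq0.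
  by apply/prodf_neq0 => k _; apply: hc.
congr Some; rewrite root_val_fund; apply: eq_bigr => j _.
by rewrite lowest_pairingE // exprz_inv opprK.
Qed.

(** * The inverse map and the isomorphism *)

(** The equations a_k = Phi_k(A) are triangular and are solved for A_k in the order
  of k; the first natural number only bounds the depth of the recursion. *)
Fixpoint psi_fuel (t : nat -> K) (q k : nat) : K :=
  if q is q'.+1 then ((\prod_(l < k) psi_fuel t q' l ^ a (ii l) (ii k)) * t k)^-1 else 1.

Definition Psi t (k : 'I_L) : K := psi_fuel (ext t) k.+1 k.

Lemma psi_fuel_enough (t : nat -> K) q q' k : (k < q)%N -> (k < q')%N -> psi_fuel t q k = psi_fuel t q' k.
Proof.
elim: q q' k => // q IH [|q'] // k kq kq' /=; congr ((_ * _)^-1).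
by apply: eq_bigr => l _; rewrite (IH q') //; apply: leq_trans (ltn_ord l) _.
Qed.

Lemma PsiE t (k : 'I_L) :
  Psi t k = ((\prod_(l < L | (l < k)%N) Psi t l ^ a (i_ l) (i_ k)) * t k)^-1.
Proof.
rewrite {1}/Psi /= extE; congr ((_ * _)^-1).
rewrite (big_ord_widen L (fun l => psi_fuel (ext t) k l ^ a (ii l) (ii k))) ?(ltnW (ltn_ord k)) //.
by apply: eq_bigr => l lk; rewrite -!iiE /Psi (@psi_fuel_enough (ext t) k l.+1 l).
Qed.

Lemma Psi_torus t : in_torus t -> in_torus (Psi t).
Proof.
move=> ht k; have [m] := ubnP (val k); elim: m k => // m IH k km.
rewrite PsiE invr_eq0 mulf_neq0 //; apply/prodf_neq0 => l lk.
by rewrite expfz_neq0 // IH //; apply: leq_trans lk _.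
Qed.

Lemma Phi_torus c : in_torus c -> in_torus (Phi c).
Proof.
move=> hc k; rewrite /Phi_coord invr_eq0 mulf_neq0 //; apply/prodf_neq0 => l _.
by rewrite expfz_neq0.
Qed.

Lemma Phi_Psi t : in_torus t -> Phi (Psi t) = t.
Proof.
move=> ht; apply: functional_extensionality_dep => k; rewrite /Phi_coord [Psi t k]PsiE.
set P := \prod_(_ < L | _) _.
have P0 : P != 0 by apply/prodf_neq0 => l _; rewrite expfz_neq0 // Psi_torus.
by rewrite invfM invrK mulKf.
Qed.

Lemma Psi_Phi c : in_torus c -> Psi (Phi c) = c.
Proof.
move=> hc; apply: functional_extensionality_dep => k.
have [m] := ubnP (val k); elim: m k => // m IH k km.
rewrite PsiE /Phi_coord.
have -> : \prod_(l < L | (l < k)%N) Psi (Phi c) l ^ a (i_ l) (i_ k) =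
          \prod_(l < L | (l < k)%N) c l ^ a (i_ l) (i_ k).
  by apply: eq_bigr => l lk; rewrite IH //; apply: leq_trans lk _.
set P := \prod_(_ < L | _) _.
have P0 : P != 0 by apply/prodf_neq0 => l _; rewrite expfz_neq0.
by rewrite invf_div mulrC mulKf.
Qed.

Lemma torus_unit_Phi k : torus_unit (fun c => Phi c k).
Proof.
apply: torus_unitV; apply: torus_unitM; last exact: torus_unit_coord.
by apply: torus_unit_prod => l; apply: torus_unitX; apply: torus_unit_coord.
Qed.

Lemma torus_unit_Psi k : torus_unit (fun t => Psi t k).
Proof.
have [m] := ubnP (val k); elim: m k => // m IH k km.
apply: (@torus_unit_ext _ _ (fun t =>
  ((\prod_(l < L | (l < k)%N) (if (l < k)%N then Psi t l else 1) ^ a (i_ l) (i_ k)) * t k)^-1)).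
  by move=> t ht; rewrite PsiE; congr ((_ * _)^-1); apply: eq_bigr => l ->.
apply: torus_unitV; apply: torus_unitM; last exact: torus_unit_coord.
apply: torus_unit_prod => l; apply: (@torus_unitX _ _ (fun t => if (l < k)%N then Psi t l else 1)).
case lk: (l < k)%N; last exact: torus_unit1.
by apply: IH; apply: leq_trans lk _.
Qed.

Lemma torus_unit_S i m : torus_unit (fun c => S_ i c m).
Proof.
apply: torus_unitV; apply: torus_unitM; last exact: torus_unit_coord.
by apply: torus_unit_prod => l; apply: torus_unitX; apply: torus_unit_coord.
Qed.

(** The coordinate at the last occurrence m0 of i enters S_{m0} only. With all other
  coordinates equal to 1, the sum is w_{m0} / z + R, which cannot vanish for both
  z = 1 and z = 2. An occurrence of i exists because the word is a longest one. *)
Lemma generic_S_sum i (w : 'I_L -> K) : (forall m, w m != 0) ->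
  generically (fun c => \sum_(m < L | i_ m == i) w m * S_ i c m != 0).
Proof.
move=> w0; have /tnthP[k0 ik0] : i \in iota by apply: (letter_mem ha M).
have ik0' : i_ k0 == i by rewrite -ik0.
case: (@arg_maxnP _ k0 (fun m => i_ m == i) val ik0') => m0 im0 mmax.
pose R := \sum_(m < L | (i_ m == i) && (m != m0)) w m.
pose pt z : 'I_L -> K := fun m => if m == m0 then z else 1.
have pt_torus z : z != 0 -> in_torus (pt z).
  by move=> z0 m; rewrite /pt; case: (m == m0) => //; apply: oner_neq0.
have val z : \sum_(m < L | i_ m == i) w m * S_ i (pt z) m = w m0 / z + R.
  rewrite (bigD1 m0) //=; congr (_ + _).
    rewrite /Defs.S_ big1 => [|k km]; first by rewrite mul1r /pt eqxx.
    by rewrite /pt; case: eqP km => [->|_ _]; rewrite ?ltnn ?exp1rz.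
  apply: eq_bigr => m /andP[im mm0]; rewrite /Defs.S_ big1 => [|k km].
    by rewrite /pt (negPf mm0) mul1r invr1 mulr1.
  rewrite /pt; case: eqP km => [->|_ _]; last by rewrite exp1rz.
  by move=> m0m; have := mmax m im; rewrite /geq /= leqNgt m0m.
have rat : torus_rational (fun c => \sum_(m < L | i_ m == i) w m * S_ i c m).
  by apply: torus_rational_sum => m; apply/torus_rationalZ/torus_unit_rational/torus_unit_S.
have two : (2 : K) != 0 by rewrite pnatr_eq0.
have [R0|R0] := eqVneq (w m0 + R) 0; last first.
  by apply: (torus_rational_neq0 rat (pt_torus 1 (oner_neq0 _))); rewrite val divr1.
apply: (torus_rational_neq0 rat (pt_torus 2 two)); rewrite val.
have -> : w m0 / 2 + R = - (w m0 / 2).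
  by rewrite (_ : R = - w m0); [field | apply/eqP; rewrite -addr_eq0 addrC R0].
by rewrite oppr_eq0 mulf_neq0 ?invr_eq0.
Qed.

Lemma generic_act_defined i (s : K) : s != 0 -> generically (act_defined i s).
Proof.
move=> s0; have H (Q : 'I_L -> pred 'I_L) (F : ('I_L -> K) -> 'I_L -> K) :
  (forall c k, F c k = \sum_(m < L | Q k m && (i_ m == i)) s * S_ i c m
     + \sum_(m < L | ~~ Q k m && (i_ m == i)) S_ i c m) ->
  generically (fun c => forall k, F c k != 0).
  move=> FE; apply: generically_forall => k.
  apply: generically_mono (generic_S_sum i (w := fun m => if Q k m then s else 1) _).
    move=> c; rewrite FE (bigID (Q k)) /=; congr (_ != 0); congr (_ + _).
      by apply: eq_big => [m|m /andP[_ ->] //]; rewrite andbC.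
    by apply: eq_big => [m|m /andP[_ /negPf ->]]; rewrite ?mul1r // andbC.
  by move=> m; case: ifP => _ //; apply: oner_neq0.
have Hnum := H (fun k m => (m <= k)%N) (fun c k => act_B_num a iota i s c k).
have Hden := H (fun k m => (m < k)%N) (fun c k => act_B_den a iota i s c k).
apply: generically_mono (generically_and (generically_torus K L)
  (generically_and (Hnum _) (Hden _))) => [c [hc [h1 h2]]|c k|c k].
- by split.
- by rewrite /act_B_num; congr (_ + _); apply: eq_bigl => m; rewrite ltnNge.
- by rewrite /act_B_den; congr (_ + _); apply: eq_bigl => m; rewrite leqNgt.
Qed.

(** From y(t) one recovers the torus part, hence Y(Psi t), by [y_word_tor]. *)
Definition Phi_inv : gc_point (U_crystal M iota) -> option (gc_point (B_crystal M iota)) :=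
  the_value (fun u x : ambient M => exists t, [/\ in_torus t, u = yw t & x = Yw (Psi t)]).

(** The coefficients F_j of the point are the inverses of the fundamental weights of
  the torus part. *)
Lemma y_word_tor c c' : in_torus c -> in_torus c' -> yw (Phi c) = yw (Phi c') ->
  tor c = tor c'.
Proof.
move=> hc hc' E; have P j : \prod_(k < L | i_ k == j) c k = \prod_(k < L | i_ k == j) c' k.
  apply: invr_inj; rewrite -!lowest_pairingE //.
  by rewrite E.
apply: ambientP => j; rewrite !torE !tprod_diag; congr diag_mx; apply/rowP => b.
rewrite !mxE; transitivity (\prod_k c k ^ fm_wt b 0 (i_ k)).
  by apply: eq_bigr => k _; rewrite extE iiE.
rewrite weight_val_fund; under eq_bigr => j' _ do rewrite P.
rewrite -weight_val_fund; apply: eq_bigr => k _; by rewrite extE iiE.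
Qed.

Lemma Phi_invE t : in_torus t -> Phi_inv (yw t) = Some (Yw (Psi t)).
Proof.
move=> ht; apply: the_valueE; first by exists t.
move=> x [t' [ht' E ->]]; rewrite !Y_word_split ?Phi_Psi //; try exact: Psi_torus.
rewrite E; congr (_ ** _); apply: y_word_tor; rewrite ?Phi_Psi //; exact: Psi_torus.
Qed.

Lemma Phi_birational : birational_map (Phi_map M iota).
Proof.
have gT := generically_torus K L.
have PhiM c : in_torus c -> Phi_map M iota (Yw c) = Some (yw (Phi c)).
  exact: Phi_mapE.
split.
  have [num [den [den0 E]]] := torus_unit_fractions torus_unit_Phi.
  exists num, den; split=> //; apply: generically_mono gT => c hc.
  by rewrite /= PhiM // -E.
exists Phi_inv; split.
- have [num [den [den0 E]]] := torus_unit_fractions torus_unit_Psi.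
  exists num, den; split=> //; apply: generically_mono gT => c hc.
  by rewrite /= Phi_invE // -E.
- apply: generically_mono gT => c hc; exists (Yw c); split=> //=.
  by rewrite PhiM //= Phi_invE ?Psi_Phi //; apply: Phi_torus.
- apply: generically_mono gT => t ht; exists (yw t); split=> //=.
  by rewrite Phi_invE //= PhiM ?Phi_Psi //; apply: Psi_torus.
Qed.

Lemma Phi_isomorphism :
  crystal_isomorphism (B_crystal M iota) (U_crystal M iota) (Phi_map M iota).
Proof.
have gT := generically_torus K L.
have PhiM c : in_torus c -> Phi_map M iota (Yw c) = Some (yw (Phi c)).
  exact: Phi_mapE.
split; first exact: Phi_birational.
- move=> i s s0; have hi : i \in iota by apply: (letter_mem ha M).
  apply: generically_mono (generic_act_defined i s0) => c hd.
  exists (yw (Phi (moved i s c))) => /=; have [_ hc _] := hd; split.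
    by rewrite (act_BE hi hd) /= PhiM //; apply: moved_torus hd.
  by rewrite PhiM //= (act_UE hi hd).
- move=> i; apply: generically_mono gT => c hc.
  exists (\prod_k c k ^ a (i_ k) i); rewrite /= PhiM //= gamma_BE //.
  by rewrite gamma_UE.
- move=> i; apply: generically_mono gT => c hc.
  exists (\sum_(m < L | i_ m == i) S_ i c m); rewrite /= PhiM //= eps_BE //.
  by rewrite eps_y_word sum_Phi_S.
Qed.

End Crystals.

Theorem theorem7p1 (R : realType) (X : classical_type) (n L : nat)
  (hn : valid_rank X n)
  (M : forall j : 'I_n, fundamental_module R[i] (cartan X n) j)
  (iota : L.-tuple 'I_n)
  (hiota : reduced_longest_word (cartan X n) iota) :
  crystal_isomorphism (B_crystal M iota) (U_crystal M iota) (Phi_map M iota).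
Proof.
have n0 : (0 < n)%N by case: X hn {M hiota} => /=; lia.
exact: (@Phi_isomorphism _ n _ _ (classical_finite_cartan hn) M L iota (Ordinal n0) hiota).
Qed.
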